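(* Bounded C2E \textsc{Nondeterministic Constraint Logic} and bounded C2C \textsc{Nondeterministic Constraint Logic} are both weakly $\mathsf{NP}$-hard (i.e. $\mathsf{NP}$-hard when weights are encoded in binary) on constraint graphs of treewidth $2$.
   Context: A constraint graph is an undirected graph with a positive integer weight on every edge and a nonnegative integer weight (its minimum inflow) on every vertex. A legal configuration is an assignment of an orientation to every edge such that for every vertex, the total weight of the edges oriented into that vertex is at least that vertex's minimum inflow. A reconfiguration sequence is a sequence of legal configurations in which each configuration is obtained from the previous one by reversing exactly one edge; it is bounded if every edge is reversed at most once. Bounded C2C NCL: given a constraint graph $G$ and legal configurations $C_1,C_2$, is there a bounded reconfiguration sequence from $C_1$ to $C_2$? Bounded C2E NCL: given a constraint graph $G$, a target edge $e$ and a legal configuration $C_1$, is there a bounded reconfiguration sequence starting at $C_1$ that reverses $e$? *)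

(* Defs.v *)
From mathcomp Require Import all_boot.
From mathcomp Require Import ssralg poly.

Set Implicit Arguments.
Unset Strict Implicit.
Unset Printing Implicit Defensive.

Local Open Scope nat_scope.

Inductive move := MoveLeft | Stay | MoveRight.

(* [None] is the blank, [Some (inl b)] an input/output bit and
   [Some (inr a)] an auxiliary symbol from the finite set [W]. *)
Definition symbol (W : finType) := option (bool + W).

Definition blank {W : finType} : symbol W := None.
Definition bit {W : finType} (b : bool) : symbol W := Some (inl b).

(* Multi-tape, possibly nondeterministic: [tm_delta q a] lists the actions
   available in state [q] when the heads scan [a]; no action means halt. *)
Record tm := TM {
  tm_tapes : nat;  (* there are [tm_tapes.+1] tapes *)
  tm_state : finType;
  tm_work : finType;
  tm_start : tm_state;
  tm_acc : pred tm_state;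
  tm_delta : tm_state -> {ffun 'I_tm_tapes.+1 -> symbol tm_work} ->
             seq (tm_state * ('I_tm_tapes.+1 -> symbol tm_work * move)) }.

(* A two-way infinite tape [(l, r)]: [r] is read rightwards starting with the
   scanned cell, [l] leftwards from the cell before it, and every cell beyond
   the two lists is blank. *)
Definition tape (W : finType) := (seq (symbol W) * seq (symbol W))%type.

Definition scan W (t : tape W) : symbol W := head blank t.2.

Definition write_move W (am : symbol W * move) (t : tape W) : tape W :=
  let: (l, r) := (t.1, am.1 :: behead t.2) in
  match am.2 with
  | MoveLeft => (behead l, head blank l :: r)
  | Stay => (l, r)
  | MoveRight => (head blank r :: l, behead r)
  end.

Definition tm_config (M : tm) :=
  (tm_state M * {ffun 'I_(tm_tapes M).+1 -> tape (tm_work M)})%type.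

Definition tm_init (M : tm) (x : seq bool) : tm_config M :=
  (tm_start M,
   [ffun i => ([::], if i == ord0 then map bit x else [::])]).

Definition tm_actions (M : tm) (c : tm_config M) :=
  tm_delta c.1 [ffun i => scan (c.2 i)].

Definition tm_step (M : tm) : rel (tm_config M) := fun c c' =>
  c' \in [seq (a.1, [ffun i => write_move (a.2 i) (c.2 i)])
         | a <- tm_actions c].

Definition tm_halted (M : tm) (c : tm_config M) : bool := nilp (tm_actions c).

Definition deterministic (M : tm) :=
  forall q a, size (@tm_delta M q a) <= 1.

(* [path (@tm_step M) c s]: [c :: s] is a computation with [size s] steps. *)
Definition polynomial_time (M : tm) :=
  exists p : {poly nat}, forall (x : seq bool) (s : seq (tm_config M)),
    path (@tm_step M) (tm_init M x) s -> size s <= p.[size x]%R.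

Definition tm_accepts (M : tm) (x : seq bool) :=
  exists s : seq (tm_config M),
    [/\ path (@tm_step M) (tm_init M x) s,
        tm_halted (last (tm_init M x) s) &
        tm_acc (last (tm_init M x) s).1].

(* The output is the word on the first tape from its head up to the blanks. *)
Definition tm_outputs (M : tm) (x y : seq bool) :=
  exists s : seq (tm_config M),
    [/\ path (@tm_step M) (tm_init M x) s,
        tm_halted (last (tm_init M x) s) &
        exists m, ((last (tm_init M x) s).2 ord0).2
                  = map bit y ++ nseq m blank].

Definition in_NP (L : seq bool -> Prop) :=
  exists M : tm, polynomial_time M /\ forall x, L x <-> tm_accepts M x.

Definition polytime_computable (f : seq bool -> seq bool) :=
  exists M : tm,
    [/\ deterministic M, polynomial_time M & forall x, tm_outputs M x (f x)].

Record problem := Problem {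
  instance : Type;
  yes : instance -> Prop;
  encode : instance -> seq bool;
  encode_inj : injective encode }.

(* The problem is NP-hard on the class [Q] of instances: every language in NP
   has a polynomial-time many-one reduction to it with all values in [Q]. *)
Definition NP_hard_on (P : problem) (Q : instance P -> Prop) :=
  forall L : seq bool -> Prop, in_NP L ->
    exists f : seq bool -> instance P,
      [/\ polytime_computable (fun x => encode (f x)),
          forall x, Q (f x) &
          forall x, L x <-> yes (f x)].

(* Simple graphs: an edge is given by its endpoints in increasing order, and
   distinct edges have distinct pairs of endpoints. *)
Record cgraph := CGraph {
  nv : nat;
  ne : nat;
  ends : {ffun 'I_ne -> 'I_nv * 'I_nv};
  weight : {ffun 'I_ne -> nat};
  inflow : {ffun 'I_nv -> nat};
  ends_lt : [forall e, (ends e).1 < (ends e).2];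
  ends_inj : injectiveb ends;
  weight_gt0 : [forall e, 0 < weight e] }.

Definition adj (G : cgraph) : rel 'I_(nv G) := fun u v =>
  [exists e, (ends G e == (u, v)) || (ends G e == (v, u))].

(* [C e] holds iff [e] points to its larger endpoint. *)
Definition config (G : cgraph) := {ffun 'I_(ne G) -> bool}.

Definition edge_head (G : cgraph) (C : config G) (e : 'I_(ne G)) : 'I_(nv G) :=
  if C e then (ends G e).2 else (ends G e).1.

Definition legal (G : cgraph) (C : config G) : bool :=
  [forall v, inflow G v <= \sum_(e | edge_head C e == v) weight G e].

Definition reversal (G : cgraph) : rel (config G) := fun C C' =>
  #|[set e | C e != C' e]| == 1.

Definition reconf_seq (G : cgraph) (C : config G) (s : seq (config G)) : bool :=
  all (@legal G) (C :: s) && path (@reversal G) C s.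

Definition num_reversals (G : cgraph) (C : config G) (s : seq (config G))
    (e : 'I_(ne G)) : nat :=
  count (fun CC : config G * config G => CC.1 e != CC.2 e) (zip (C :: s) s).

Definition bounded_reconf_seq (G : cgraph) (C : config G)
    (s : seq (config G)) : bool :=
  reconf_seq C s && [forall e, num_reversals C s e <= 1].

Record c2c_instance := C2C {
  c2c_graph : cgraph;
  c2c_from : config c2c_graph;
  c2c_to : config c2c_graph;
  c2c_from_legal : legal c2c_from;
  c2c_to_legal : legal c2c_to }.

Definition c2c_yes (I : c2c_instance) :=
  exists s, bounded_reconf_seq (c2c_from I) s
            /\ last (c2c_from I) s = c2c_to I.

Record c2e_instance := C2E {
  c2e_graph : cgraph;
  c2e_edge : 'I_(ne c2e_graph);
  c2e_from : config c2e_graph;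
  c2e_from_legal : legal c2e_from }.

Definition c2e_yes (I : c2e_instance) :=
  exists s, bounded_reconf_seq (c2e_from I) s
            /\ 0 < num_reversals (c2e_from I) s (c2e_edge I).

Definition is_tree (I : finType) (t : rel I) :=
  [/\ 0 < #|I|, symmetric t, irreflexive t,
      (forall i j, connect t i j) &
      (forall c : seq I, ucycle t c -> size c <= 2)].

Record tree_decomposition (V : finType) (g : rel V) := TreeDecomposition {
  td_node : finType;
  td_tree : rel td_node;
  td_bag : td_node -> {set V};
  td_is_tree : is_tree td_tree;
  td_vertex : forall v, exists i, v \in td_bag i;
  td_edge : forall u v, g u v -> exists i, (u \in td_bag i) && (v \in td_bag i);
  td_connected : forall v i j, v \in td_bag i -> v \in td_bag j ->
    connect [rel x y | [&& td_tree x y, v \in td_bag x & v \in td_bag y]] i j }.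

(* Truncated subtraction: the graph without vertices gets width 0, not -1. *)
Definition td_width (V : finType) (g : rel V) (D : tree_decomposition g) :=
  (\max_(i : td_node D) #|td_bag i|).-1.

Definition has_treewidth (G : cgraph) (k : nat) :=
  (exists D : tree_decomposition (@adj G), td_width D = k)
  /\ (forall D : tree_decomposition (@adj G), k <= td_width D).

(* Binary digits, least significant first, without leading zeros. *)
Definition bits (n : nat) : seq bool :=
  mkseq (fun i => odd (n %/ 2 ^ i)) (up_log 2 n.+1).

Fixpoint enc_seq (T : Type) (E : T -> seq bool) (s : seq T) : seq bool :=
  if s is x :: s' then true :: E x ++ enc_seq E s' else [:: false].

Definition enc_bits : seq bool -> seq bool := enc_seq (fun b => [:: b]).
Definition enc_nat (n : nat) : seq bool := enc_bits (bits n).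

Definition enc_cgraph (G : cgraph) : seq bool :=
  enc_seq enc_nat (codom (inflow G)) ++
  enc_seq (fun e => enc_nat (ends G e).1 ++ enc_nat (ends G e).2
                    ++ enc_nat (weight G e)) (enum 'I_(ne G)).

Definition enc_config (G : cgraph) (C : config G) : seq bool :=
  enc_bits (codom C).

Definition enc_c2c (I : c2c_instance) : seq bool :=
  enc_cgraph (c2c_graph I) ++ enc_config (c2c_from I) ++ enc_config (c2c_to I).

Definition enc_c2e (I : c2e_instance) : seq bool :=
  enc_cgraph (c2e_graph I) ++ enc_nat (c2e_edge I) ++ enc_config (c2e_from I).

Definition prefix_inj (T : Type) (E : T -> seq bool) :=
  forall x y s t, E x ++ s = E y ++ t -> x = y /\ s = t.

Lemma enc_seq_prefix_inj T (E : T -> seq bool) :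
  prefix_inj E -> prefix_inj (enc_seq E).
Proof.
move=> EI; elim=> [|x a IH] [|y b] s t //=; first by case.
by rewrite -!catA => -[] /EI[<-] /IH[<- <-].
Qed.

Lemma enc_bits_prefix_inj : prefix_inj enc_bits.
Proof. by apply: enc_seq_prefix_inj => x y s t [-> ->]. Qed.

Lemma bits_inj : injective bits.
Proof.
pose val_of := foldr (fun (b : bool) m => b + m.*2) 0.
have aux k n : n < 2 ^ k ->
    val_of (mkseq (fun i => odd (n %/ 2 ^ i)) k) = n.
  elim: k n => [|k IH] n; first by case: n.
  rewrite expnS => ltn; rewrite /mkseq /= expn0 divn1 -[1]/(1 + 0) iotaDl.
  rewrite -map_comp (@eq_map _ _ _ (fun i => odd (n./2 %/ 2 ^ i))); last first.
    by move=> i /=; rewrite expnS divnMA divn2.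
  have /IH: n./2 < 2 ^ k by rewrite -divn2 ltn_divLR // mulnC.
  by rewrite /mkseq => ->; rewrite odd_double_half.
have bitsK : cancel bits val_of.
  by move=> n; apply: aux; apply: up_logP.
exact: can_inj bitsK.
Qed.

Lemma enc_nat_prefix_inj : prefix_inj enc_nat.
Proof. by move=> x y s t /enc_bits_prefix_inj[/bits_inj-> ->]. Qed.

Lemma codom_ffun_inj (n : nat) (T : Type) (f g : {ffun 'I_n -> T}) :
  codom f = codom g -> f = g.
Proof.
rewrite /codom /image_mem => /eq_in_map eqfg; apply/ffunP => i.
by apply: eqfg; rewrite mem_enum.
Qed.

Lemma enc_config_prefix_inj (G : cgraph) : prefix_inj (@enc_config G).
Proof. by move=> x y s t /enc_bits_prefix_inj[/codom_ffun_inj-> ->]. Qed.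

Lemma enc_cgraph_prefix_inj : prefix_inj enc_cgraph.
Proof.
pose E (d : nat * nat * nat) := enc_nat d.1.1 ++ enc_nat d.1.2 ++ enc_nat d.2.
pose D (G : cgraph) e :=
  (nat_of_ord (ends G e).1, nat_of_ord (ends G e).2, weight G e).
have EI : prefix_inj E.
  move=> [[x1 x2] x3] [[y1 y2] y3] s t; rewrite /E /= -!catA.
  move=> /enc_nat_prefix_inj[<-] /enc_nat_prefix_inj[<-].
  by move=> /enc_nat_prefix_inj[<- <-].
have encE (G : cgraph) : enc_cgraph G =
    enc_seq enc_nat (codom (inflow G)) ++ enc_seq E (codom (D G)).
  rewrite /enc_cgraph; congr (_ ++ _); rewrite /codom /image_mem.
  by elim: (enum _) => //= e s ->.
move=> G H s t; rewrite !encE -!catA.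
move=> /(enc_seq_prefix_inj enc_nat_prefix_inj)[eqi].
move=> /(enc_seq_prefix_inj EI)[eqd ->]; split=> //.
move: G H eqi eqd => [n m ends w i p1 p2 p3] [n' m' ends' w' i' p1' p2' p3'].
rewrite /D /= => eqi eqd.
have eqn : n = n' by have := congr1 size eqi; rewrite !size_codom !card_ord.
have eqm : m = m' by have := congr1 size eqd; rewrite !size_codom !card_ord.
subst n' m'; have {eqi} eqi := codom_ffun_inj eqi; subst i'.
move: eqd; rewrite /codom /image_mem => /eq_in_map eqd.
have eqe : ends = ends'.
  apply/ffunP => e; have := eqd e (mem_enum _ e).
  by case: (ends e) (ends' e) => u v [u' v'] /= [/ord_inj-> /ord_inj->].
have eqw : w = w' by apply/ffunP => e; have [] := eqd e (mem_enum _ e).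
by subst ends' w'; congr CGraph; apply: bool_irrelevance.
Qed.

Lemma enc_c2c_inj : injective enc_c2c.
Proof.
move=> [G C1 C2 l1 l2] [H D1 D2 k1 k2]; rewrite /enc_c2c /=.
move=> /enc_cgraph_prefix_inj[eqGH]; subst H.
move=> /enc_config_prefix_inj[eqC]; subst D1.
rewrite -[X in X = _]cats0 -[X in _ = X]cats0.
move=> /enc_config_prefix_inj[eqC _]; subst D2.
by congr C2C; apply: bool_irrelevance.
Qed.

Lemma enc_c2e_inj : injective enc_c2e.
Proof.
move=> [G e C l] [H f D k]; rewrite /enc_c2e /=.
move=> /enc_cgraph_prefix_inj[eqGH]; subst H.
move=> /enc_nat_prefix_inj[/ord_inj eqe]; subst f.
rewrite -[X in X = _]cats0 -[X in _ = X]cats0.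
move=> /enc_config_prefix_inj[eqC _]; subst D.
by congr C2E; apply: bool_irrelevance.
Qed.

Definition bounded_C2C : problem := Problem c2c_yes enc_c2c_inj.
Definition bounded_C2E : problem := Problem c2e_yes enc_c2e_inj.

(* Main.v *)
Require Import Defs.
From mathcomp Require Import all_boot.
From mathcomp Require Import ssralg poly.
From mathcomp Require Import zify.

(** The tableau of a nondeterministic machine, read row after row, is a word of
    tiles that match their successor horizontally and the tile [N] positions
    further on vertically. Carrying exactly one tile at a position, and each
    matching condition "code + complement = constant", is one digit of a subset
    sum problem in a large base, so that acceptance becomes a subset sum.

    Items [a_j] with target [S] become a graph with two adjacent hubs 0 and 1
    and one vertex per item, joined to both hubs by edges of weight [a_j]. The
    inflows force the edge between the hubs to be reversed only when the items
    released by hub 0 weigh at most [S] and the items received by hub 1 at least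
    [S]; once it is reversed, all other edges can follow. The bags made of the
    hubs and one item form a star of width 2.

    The encoding of this graph is the value of an expression in a language of
    nested loops over words, and every such expression is evaluated by a
    multi-tape machine in polynomial time. *)

Set Implicit Arguments.
Unset Strict Implicit.
Unset Printing Implicit Defensive.

Local Open Scope nat_scope.

(** * Tape programs *)

(** The obstacle is that the reduction has to be carried out by an explicit machine, so every number
    of the instance needs a description that can be printed without arithmetic. Each base is a power
    of two, which makes the binary form of a number a concatenation of fixed-width blocks. No
    selection of items produces a carry, and the complementary inflow, total minus target, has
    explicit digits because the subtraction needs no borrow. The weight of the edge between the hubs
    is a power of two above both inflows. The only numbers computed are lengths of words. A tile
    also guesses its two neighbours and the action of its row, and the colors verify the guesses;
    the set of tiles thus depends on the machine alone. The input is padded between two end marks to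
    a word whose length is both the width and the height of the tableau: loops over this word supply
    all counters, and each boundary digit depends on a single letter of it. *)

Section Tapes.
Variable W : finType.
Implicit Types t u : tape W.

Definition eqtape t u := forall i,
  nth blank t.1 i = nth blank u.1 i /\ nth blank t.2 i = nth blank u.2 i.

Lemma eqtape_refl t : eqtape t t. Proof. by []. Qed.

Lemma eqtape_trans t u v : eqtape t u -> eqtape u v -> eqtape t v.
Proof. by move=> e f i; have [-> ->] := e i; apply: f. Qed.

Lemma eqtape_scan t u : eqtape t u -> scan t = scan u.
Proof. by move=> /(_ 0)[_]; rewrite !nth0. Qed.

Lemma eqtape_write_move am t u :
  eqtape t u -> eqtape (write_move am t) (write_move am u).
Proof.
case: am t u => a m [l r] [l' r'] e.
have el i : nth blank l i = nth blank l' i by have [] := e i.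
have er i : nth blank r i = nth blank r' i by have [] := e i.
have hl : head blank l = head blank l' by rewrite -!nth0.
have hr : head blank r = head blank r' by rewrite -!nth0.
by case: m => -[|i] //=; rewrite ?nth_behead ?el ?er ?hl ?hr //;
   case: i => [|i] /=; rewrite ?nth_behead ?el ?er.
Qed.

(** Only up to [eqtape]: writing back the blank scanned on an empty right list lengthens that list
    by one cell. *)
Lemma write_move_idle t : eqtape (write_move (scan t, Stay) t) t.
Proof. by case: t => l [|a r] [|[|i]]. Qed.

(** The two resting positions of a head: a word to be read has the head on its first letter, a word
    under construction has it on the blank after its last letter. *)
Definition home (w : seq (bool + W)) : tape W := ([::], map Some w).
Definition ending (w : seq (bool + W)) : tape W := (rev (map Some w), [::]).

Lemma scan_home w : scan (home w) = ohead w.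
Proof. by case: w. Qed.

End Tapes.

Section Programs.
Variables (W : finType) (K : nat).
Local Notation sym := (symbol W).
Local Notation scans := {ffun 'I_K.+1 -> sym}.
Local Notation tapes := {ffun 'I_K.+1 -> tape W}.
Local Notation actions := ('I_K.+1 -> sym * move).

(** A program has a single entry and a single exit, [None], so that programs can be chained. The
    exit transition still performs its action. *)
Record prog := Prog {
  pst : finType;
  pstart : pst;
  pdelta : pst -> scans -> option pst * actions }.

Definition scanT (T : tapes) : scans := [ffun i => scan (T i)].
Definition act (a : actions) (T : tapes) : tapes :=
  [ffun i => write_move (a i) (T i)].

Inductive reaches (p : prog) : pst p -> tapes -> tapes -> nat -> Prop :=
| reach_exit s T a :
    pdelta s (scanT T) = (None, a) -> reaches s T (act a T) 1
| reach_step s s' T T' a n :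
    pdelta s (scanT T) = (Some s', a) -> reaches s' (act a T) T' n ->
    reaches s T T' n.+1.

Definition idle (sc : scans) : actions := fun i => (sc i, Stay).

(* The cells of [z i] describe tape [i]; tapes beyond [K] do not exist. *)
Definition agree (T : tapes) (z : nat -> tape W) :=
  forall i : 'I_K.+1, eqtape (T i) (z i).

Variant hoare (p : prog) (z z' : nat -> tape W) (n : nat) : Prop :=
  Hoare of forall T, agree T z -> exists T' m,
    [/\ m <= n, reaches (pstart p) T T' m & agree T' z'].

Definition upd (z : nat -> tape W) (i : nat) (t : tape W) :=
  fun j => if j == i then t else z j.

Lemma agree_scan T z (i : nat) :
  i <= K -> agree T z -> scanT T (inord i) = scan (z i).
Proof.
by move=> le_iK /(_ (inord i)) /eqtape_scan; rewrite ffunE inordK.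
Qed.

Lemma agree_idle T z : agree T z -> agree (act (idle (scanT T)) T) z.
Proof.
move=> Tz i; apply: eqtape_trans (Tz i); rewrite !ffunE /idle ffunE.
exact: write_move_idle.
Qed.

Lemma hoare_conv p z z' u u' n m :
  (forall i, eqtape (u i) (z i)) -> hoare p z z' n ->
  (forall i, eqtape (z' i) (u' i)) -> n <= m -> hoare p u u' m.
Proof.
move=> uz [hp] zu nm; split=> T Tu.
have Tz : agree T z by move=> i; apply: eqtape_trans (Tu i) (uz i).
have [T' [k [le_kn r T'z]]] := hp T Tz.
exists T', k; split=> //; first exact: leq_trans nm.
by move=> i; apply: eqtape_trans (T'z i) (zu i).
Qed.

Lemma hoare_post p z z' u' n m :
  hoare p z z' n -> (forall i, eqtape (z' i) (u' i)) -> n <= m ->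
  hoare p z u' m.
Proof. by move=> h; apply: hoare_conv h => i; apply: eqtape_refl. Qed.

Definition op_delta (i j : 'I_K.+1) (g : sym -> sym * move) (_ : unit)
    (sc : scans) : option unit * actions :=
  (None, fun k => if k == i then g (sc j) else idle sc k).

Definition Op (i j : nat) g : prog := Prog tt (op_delta (inord i) (inord j) g).

Lemma hoare_op i j g z : i <= K -> j <= K ->
  hoare (Op i j g) z (upd z i (write_move (g (scan (z j))) (z i))) 1.
Proof.
move=> iK jK; split=> T Tz; exists (act (op_delta (inord i) (inord j) g tt (scanT T)).2 T).
exists 1; split=> //; first exact: reach_exit.
move=> k; rewrite ffunE /= (agree_scan jK Tz) /upd.
have -> : (k == inord i :> 'I_K.+1) = ((k : nat) == i).
  by rewrite -val_eqE /= inordK.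
case: eqP => [eq_ki|_].
  by apply: eqtape_write_move; rewrite -eq_ki; apply: Tz.
apply: eqtape_trans (Tz k); rewrite /idle ffunE; exact: write_move_idle.
Qed.

Section Seq.
Variables p q : prog.

(** The exit transition of [p] leads directly to the start of [q], so the running times simply add
    up. *)
Definition seq_delta (s : pst p + pst q) (sc : scans) :
    option (pst p + pst q) * actions :=
  match s with
  | inl s => let: (s', a) := pdelta s sc in
             (Some (if s' is Some s1 then inl s1 else inr (pstart q)), a)
  | inr s => let: (s', a) := pdelta s sc in (omap inr s', a)
  end.

Definition Seq : prog := Prog (inl (pstart p)) seq_delta.

Lemma seq_reaches_r s T T' n :
  reaches s T T' n -> @reaches Seq (inr s) T T' n.
Proof.
elim=> {s T T' n} [s T a e|s s' T T' a n e _ IH].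
  by apply: reach_exit; rewrite /= e.
by apply: reach_step IH; rewrite /= e.
Qed.

Lemma seq_reaches_l s T T' T'' n m :
  reaches s T T' n -> reaches (pstart q) T' T'' m ->
  @reaches Seq (inl s) T T'' (n + m).
Proof.
move=> r; elim: r T'' m => {s T T' n} [s T a e|s s' T T' a n e _ IH] T'' m r.
  rewrite add1n; apply: (@reach_step Seq _ (inr (pstart q)) _ _ a).
    by rewrite /= e.
  exact: seq_reaches_r.
by rewrite addSn; apply: reach_step (IH _ _ r); rewrite /= e.
Qed.

Lemma hoare_seq z1 z2 z3 n m :
  hoare p z1 z2 n -> hoare q z2 z3 m -> hoare Seq z1 z3 (n + m).
Proof.
move=> [hp] [hq]; split=> T /hp[T' [k [kn r /hq[T'' [l [lm r' T''z]]]]]].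
by exists T'', (k + l); split; [exact: leq_add|exact: seq_reaches_l r r'|].
Qed.
End Seq.

Section While.
Variables (j : nat) (P : pred sym) (p : prog).

Definition while_delta (s : unit + pst p) (sc : scans) :
    option (unit + pst p) * actions :=
  match s with
  | inl _ => (if P (sc (inord j)) then Some (inr (pstart p)) else None, idle sc)
  | inr s => let: (s', a) := pdelta s sc in
             (Some (if s' is Some s1 then inr s1 else inl tt), a)
  end.

Definition While : prog := Prog (inl tt) while_delta.

Hypothesis jK : j <= K.

Lemma while_reaches s T T' T'' n m :
  reaches s T T' n -> @reaches While (inl tt) T' T'' m ->
  @reaches While (inr s) T T'' (n + m).
Proof.
move=> r; elim: r T'' m => {s T T' n} [s T a e|s s' T T' a n e _ IH] T'' m r.
  by rewrite add1n; apply: reach_step r; rewrite /= e.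
by rewrite addSn; apply: reach_step (IH _ _ r); rewrite /= e.
Qed.

Lemma hoare_while_done z : ~~ P (scan (z j)) -> hoare While z z 1.
Proof.
move=> nP; split=> T Tz; exists (act (idle (scanT T)) T), 1; split=> //.
  by apply: reach_exit; rewrite /= (agree_scan jK Tz) (negbTE nP).
exact: agree_idle.
Qed.

(** One iteration is unfolded, with one extra step for the test. Loops are verified by induction on
    the word still to be scanned, in place of an invariant. *)
Lemma hoare_while_step z1 z2 z3 n m : P (scan (z1 j)) ->
  hoare p z1 z2 n -> hoare While z2 z3 m -> hoare While z1 z3 (n + m).+1.
Proof.
move=> Pz [hp] [hw]; split=> T Tz.
have [T' [k [kn r /hw[T'' [l [lm r' T''z]]]]]] := hp _ (agree_idle Tz).
exists T'', (k + l).+1; split=> //; first by rewrite ltnS leq_add.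
apply: (@reach_step While _ (inr (pstart p)) _ _ (idle (scanT T))).
  by rewrite /= (agree_scan jK Tz) Pz.
exact: while_reaches r r'.
Qed.
End While.

Section Cond.
Variables (j : nat) (P : pred sym) (p q : prog).

Definition cond_delta (s : unit + (pst p + pst q)) (sc : scans) :
    option (unit + (pst p + pst q)) * actions :=
  match s with
  | inl _ => (Some (inr (if P (sc (inord j)) then inl (pstart p)
                         else inr (pstart q))), idle sc)
  | inr (inl s) => let: (s', a) := pdelta s sc in
                   (omap (fun s1 => inr (inl s1)) s', a)
  | inr (inr s) => let: (s', a) := pdelta s sc in
                   (omap (fun s1 => inr (inr s1)) s', a)
  end.

Definition Cond : prog := Prog (inl tt) cond_delta.

Lemma hoare_cond z z' n : j <= K ->
  (if P (scan (z j)) then hoare p z z' n else hoare q z z' n) ->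
  hoare Cond z z' n.+1.
Proof.
move=> jK h; split=> T Tz.
have rl s T1 T2 k : reaches s T1 T2 k -> @reaches Cond (inr (inl s)) T1 T2 k.
  elim=> {T1 T2 k} [s1 T1 a e|s1 s' T1 T2 a k e _ IH].
    by apply: reach_exit; rewrite /= e.
  by apply: reach_step IH; rewrite /= e.
have rr s T1 T2 k : reaches s T1 T2 k -> @reaches Cond (inr (inr s)) T1 T2 k.
  elim=> {T1 T2 k} [s1 T1 a e|s1 s' T1 T2 a k e _ IH].
    by apply: reach_exit; rewrite /= e.
  by apply: reach_step IH; rewrite /= e.
case: ifP h => Pz [h]; have [T' [k [kn r T'z]]] := h _ (agree_idle Tz);
  exists T', k.+1; split=> //.
  apply: (@reach_step Cond _ (inr (inl (pstart p))) _ _ (idle (scanT T))).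
    by rewrite /= (agree_scan jK Tz) Pz.
  exact: rl.
apply: (@reach_step Cond _ (inr (inr (pstart q))) _ _ (idle (scanT T))).
  by rewrite /= (agree_scan jK Tz) Pz.
exact: rr.
Qed.
End Cond.

Definition Skip := Op 0 0 (fun s => (s, Stay)).

Lemma hoare_skip z : hoare Skip z z 1.
Proof.
apply: hoare_post (hoare_op _ _ (leq0n _) (leq0n _)) _ (leqnn _) => i.
by rewrite /upd; case: eqP => [->|_] //; apply: write_move_idle.
Qed.

Definition nonblank (s : sym) := s != blank.

Definition Put i (a : bool + W) := Op i i (fun _ => (Some a, MoveRight)).

Lemma hoare_put i a z w : i <= K -> z i = ending w ->
  hoare (Put i a) z (upd z i (ending (rcons w a))) 1.
Proof.
move=> iK zi; apply: hoare_post (hoare_op _ _ iK iK) _ (leqnn _) => j.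
rewrite /upd; case: eqP => // _; rewrite zi /ending map_rcons rev_rcons /=.
exact: eqtape_refl.
Qed.

Definition Left i := Op i i (fun s => (s, MoveLeft)).
Definition Right i := Op i i (fun s => (s, MoveRight)).
(** The first move to the left brings the head from the blank after a word onto its last letter;
    otherwise the loop would stop at once. *)
Definition Rewind i :=
  Seq (Left i) (Seq (While i nonblank (Left i)) (Right i)).

Lemma hoare_rewind i l r z : i <= K -> z i = (map Some l, map Some r) ->
  hoare (Rewind i) z (upd z i (home (rev l ++ r))) (2 * size l + 3).
Proof.
move=> iK zi.
(* The tape after this first move: the head scans the first entry of [l], the letter just left of
   its original position, or a blank if [l] is empty. *)
pose t (l : seq (bool + W)) (r : seq sym) : tape W :=
  (behead (map Some l), head blank (map Some l) :: r).
have loop l1 r1 z1 : z1 i = t l1 r1 ->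
    hoare (While i nonblank (Left i)) z1
      (upd z1 i ([::], blank :: catrev (map Some l1) r1)) (2 * size l1 + 1).
  elim: l1 r1 z1 => [|a l1 IH] r1 z1 z1i.
    apply: hoare_post (hoare_while_done _ iK _) _ (leqnn _).
      by rewrite z1i.
    by move=> j; rewrite /upd; case: eqP => [->|_]; rewrite ?z1i.
  have -> : 2 * size (a :: l1) + 1 = (1 + (2 * size l1 + 1)).+1 by rewrite /=; lia.
  apply: (hoare_while_step iK); [by rewrite z1i|exact: hoare_op|].
  rewrite z1i; apply: hoare_post (IH (Some a :: r1) _ _) _ (leqnn _).
    by rewrite /upd eqxx.
  by move=> j; rewrite /upd; case: eqP.
have -> : 2 * size l + 3 = 1 + (2 * size l + 1 + 1) by lia.
apply: hoare_seq; first exact: hoare_op.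
apply: hoare_seq.
  apply: loop; rewrite /upd eqxx zi /t /=; first by [].
apply: hoare_post (hoare_op _ _ iK iK) _ (leqnn _) => j.
rewrite /upd eqxx; case: eqP => // _ k; rewrite /= nth_nil.
split; first by case: k => //= k; rewrite nth_nil.
rewrite map_cat map_rev -catrevE.
(* Leaving a cell writes it explicitly into the list, so an empty [r] comes back as one blank. *)
have: forall n, nth blank (scan (map Some l, map Some r) :: behead (map Some r)) n
    = nth blank (map Some r) n.
  by move=> n; have [] := write_move_idle (map Some l, map Some r) n.
rewrite /scan /=.
move: (head _ _ :: _) => r0.
elim: (map Some l) r0 (map Some r) k => [|a l1 IH] r1 r2 k e //=.
by apply: IH => -[].
Qed.

Definition Copy i o :=
  Seq (While i nonblank (Seq (Op o i (fun s => (s, MoveRight))) (Right i)))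
      (Rewind i).

Lemma hoare_copy i o v w z : i <= K -> o <= K -> i != o ->
  z i = home w -> z o = ending v ->
  hoare (Copy i o) z (upd z o (ending (v ++ w))) (5 * size w + 4).
Proof.
move=> iK oK io zi zo; have oi : (o == i) = false by rewrite eq_sym (negbTE io).
have loop w1 v1 l1 z1 : z1 i = (map Some l1, map Some w1) -> z1 o = ending v1 ->
    hoare (While i nonblank (Seq (Op o i (fun s => (s, MoveRight))) (Right i))) z1
      (upd (upd z1 i (map Some (catrev w1 l1), [::])) o (ending (v1 ++ w1)))
      (3 * size w1 + 1).
  elim: w1 v1 l1 z1 => [|a w1 IH] v1 l1 z1 z1i z1o.
    apply: hoare_post (hoare_while_done _ iK _) _ (leqnn _).
      by rewrite z1i.
    move=> j; rewrite /upd cats0 -z1o /=.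
    by case: eqP => [->|_]; first by []; case: eqP => [->|_]; rewrite ?z1i.
  have -> : 3 * size (a :: w1) + 1 = (1 + 1 + (3 * size w1 + 1)).+1.
    by rewrite /=; lia.
  apply: (hoare_while_step iK); first by rewrite z1i.
    by apply: hoare_seq; exact: hoare_op.
  rewrite -cat_rcons; apply: hoare_post (IH (rcons v1 a) (a :: l1) _ _ _) _ (leqnn _).
  - by rewrite /upd eqxx (negbTE io) z1i.
  - by rewrite /upd oi eqxx z1i z1o /ending /= map_rcons rev_rcons.
  - by move=> j; rewrite /upd; case: eqP => // _; case: eqP.
have -> : 5 * size w + 4 = 3 * size w + 1 + (2 * size w + 3) by lia.
apply: hoare_seq; first by apply: (loop w v [::]) => //; rewrite zi.
rewrite -[X in 2 * X]size_rev.
apply: hoare_post (hoare_rewind (l := rev w) (r := [::]) iK _) _ (leqnn _).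
  by rewrite /upd (negbTE io) eqxx /rev.
rewrite revK cats0 => j; rewrite /upd; case: eqP => [->|_].
  by rewrite (negbTE io) zi.
exact: eqtape_refl.
Qed.

Definition Erase i := Op i i (fun _ => (blank, MoveRight)).

(** The cell left behind is blank and lies at the end of the left list, where [eqtape] does not see
    it; the shortened word is again at home. *)
Lemma hoare_erase i a w z : i <= K -> z i = home (a :: w) ->
  hoare (Erase i) z (upd z i (home w)) 1.
Proof.
move=> iK zi; apply: hoare_post (hoare_op _ _ iK iK) _ (leqnn _) => j.
by rewrite /upd; case: eqP => // _; rewrite zi /= => -[|[|k]].
Qed.

Definition Clear i := While i nonblank (Erase i).

Lemma hoare_clear i w z : i <= K -> z i = home w ->
  hoare (Clear i) z (upd z i (home [::])) (2 * size w + 1).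
Proof.
move=> iK; elim: w z => [|a w IH] z zi.
  apply: hoare_post (hoare_while_done _ iK _) _ (leqnn _); first by rewrite zi.
  by move=> j; rewrite /upd; case: eqP => [->|_]; rewrite ?zi.
have -> : 2 * size (a :: w) + 1 = (1 + (2 * size w + 1)).+1 by rewrite /=; lia.
apply: (hoare_while_step iK); [by rewrite zi|exact: hoare_erase zi|].
apply: hoare_post (IH _ _) _ (leqnn _); first by rewrite /upd eqxx.
by move=> j; rewrite /upd; case: eqP.
Qed.

(** At home the cell left of the head is blank and free, so a word can serve as a stack that grows
    to the left. Loops keep their reversed prefix in this way. *)
Definition Push i j := Seq (Left i) (Op i j (fun s => (s, Stay))).

Lemma hoare_push i j a v w z : i <= K -> j <= K -> i != j ->
  z i = home v -> z j = home (a :: w) ->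
  hoare (Push i j) z (upd z i (home (a :: v))) 2.
Proof.
move=> iK jK ij zi zj.
apply: hoare_post (hoare_seq (hoare_op _ _ iK iK) (hoare_op _ _ iK jK)) _ (leqnn _).
have ji : (j == i) = false by rewrite eq_sym (negbTE ij).
move=> k; rewrite /upd eqxx ji zi zj /=; case: eqP => // _ [|k'] //=.
by split; [|case: (v) k' => [|b v'] [|[|k']]].
Qed.

Definition is_true_bit (s : sym) := if s is Some (inl true) then true else false.

(** The least significant bit comes first: leading ones become zeros, and the next cell, a zero or
    the blank after the word, becomes a one. *)
Definition Incr i :=
  Seq (While i is_true_bit (Op i i (fun _ => (bit false, MoveRight))))
      (Seq (Op i i (fun _ => (bit true, Stay))) (Rewind i)).

Fixpoint incr_bits (b : seq bool) :=
  match b with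
  | [::] => [:: true]
  | true :: b' => false :: incr_bits b'
  | false :: b' => true :: b'
  end.

Lemma incr_bits_split b : exists k b', [/\ b = nseq k true ++ b',
  ~~ head false b' & incr_bits b = nseq k false ++ true :: behead b'].
Proof.
elim: b => [|[] b [k [b' [e1 e2 e3]]]]; first by exists 0, [::].
  by exists k.+1, b'; rewrite /= -e1 -e3.
by exists 0, (false :: b).
Qed.

Lemma hoare_incr i b z : i <= K -> z i = home (map inl b) ->
  hoare (Incr i) z (upd z i (home (map inl (incr_bits b)))) (4 * size b + 5).
Proof.
move=> iK; have [k [c [eb nc ->]]] := incr_bits_split b; rewrite {}eb => zi.
pose loop := While i is_true_bit (Op i i (fun _ => (bit false, MoveRight))).
have loopP n l z1 : z1 i = (map Some l, map bit (nseq n true ++ c)) ->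
    hoare loop z1 (upd z1 i (map Some (nseq n (inl false) ++ l), map bit c))
      (2 * n + 1).
  elim: n l z1 => [|n IH] l z1 z1i.
    apply: hoare_post (hoare_while_done _ iK _) _ (leqnn _).
      by rewrite z1i /=; case: (c) nc => [|[]].
    by move=> j; rewrite /upd; case: eqP => [->|_]; rewrite ?z1i.
  have -> : 2 * n.+1 + 1 = (1 + (2 * n + 1)).+1 by lia.
  apply: (hoare_while_step iK); [by rewrite z1i|exact: hoare_op|].
  apply: hoare_post (IH (inl false :: l) _ _) _ (leqnn _).
    by rewrite /upd eqxx z1i.
  move=> j; rewrite /upd; case: eqP => // _.
  by rewrite -cat_rcons -cats1 -(nseqD n 1) addn1.
have le : 2 * k + 1 + (1 + (2 * k + 3)) <= 4 * size (nseq k true ++ c) + 5.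
  by rewrite size_cat size_nseq; lia.
apply: hoare_post (hoare_seq (loopP k [::] z _) (hoare_seq (hoare_op _ _ iK iK)
  (hoare_rewind (l := nseq k (inl false)) (r := inl true :: map inl (behead c))
                iK _))) _ _.
- by rewrite zi /home -map_comp.
- by rewrite /upd eqxx /write_move /= cats0 -map_comp behead_map.
- move=> j; rewrite /upd; case: eqP => // _.
  by rewrite map_cat map_nseq /= rev_nseq; apply: eqtape_refl.
- by rewrite size_nseq.
Qed.
End Programs.

(** * A language of loops over words *)

Lemma bits0 : bits 0 = [::]. Proof. by rewrite /bits up_log1. Qed.

Lemma bits_half n : 0 < n -> bits n = odd n :: bits n./2.
Proof.
move=> n_gt0; have up : up_log 2 n.+1 = (up_log 2 n./2.+1).+1.
  have nE := odd_double_half n.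
  apply/eqP; rewrite eqn_leq; apply/andP; split.
    apply: up_log_min => //; rewrite expnS.
    have := up_logP n./2.+1 (erefl : 1 < 2); lia.
  have: 0 < up_log 2 n.+1 by rewrite up_log_gt0.
  have := up_logP n.+1 (erefl : 1 < 2).
  case: (up_log 2 n.+1) => [|k] //; rewrite expnS => le_n _; rewrite ltnS.
  by apply: up_log_min => //; lia.
rewrite /bits up /mkseq /= divn1; congr (_ :: _).
rewrite -[1]/(1 + 0) iotaDl -map_comp; apply: eq_map => i /=.
by rewrite expnS divnMA divn2.
Qed.

Lemma bits_double (b : bool) n : 0 < b + n -> bits (b + n.*2) = b :: bits n.
Proof.
move=> bn; rewrite bits_half; last by case: b bn => //=; lia.
by rewrite half_bit_double oddD odd_double addbF oddb.
Qed.

Lemma bits_incr n : bits n.+1 = incr_bits (bits n).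
Proof.
elim/ltn_ind: n => n IH; have nE := odd_double_half n.
rewrite -[in LHS]nE -[in RHS]nE; case: (odd n) nE => /= nE; last first.
  rewrite add0n -[_.+1]/(true + _) bits_double //.
  by case: n./2 => [|m] //; rewrite -[m.+1.*2]/(false + _) bits_double.
rewrite [bits (1 + _)](@bits_double true) //= -IH; last by lia.
by rewrite -(@bits_double false).
Qed.

Lemma size_bits n : size (bits n) <= n.
Proof. by rewrite size_mkseq up_log_min // ltn_expl. Qed.

Section Expr.
Variable W : finType.
Local Notation letter := (bool + W)%type.
Local Notation env := (nat -> seq letter).

Inductive expr :=
| EConst of seq letter
| ECat of expr & expr
| EFor of nat & expr
| EIf of nat & pred (option letter) & expr & expr
| EBin of nat
| ELet of expr & expr.

Definition scons (w : seq letter) (r : env) : env :=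
  fun i => if i is j.+1 then r j else w.

Fixpoint loop (F : seq letter -> seq letter -> seq letter) pre w :=
  if w is a :: s then F w pre ++ loop F (a :: pre) s else [::].

(* In the body of [EFor i e], variable 0 is the suffix of the word [i] from the
   current letter on and variable 1 the reversed prefix before it; [EBin i]
   writes the length of [i] in binary. *)
Fixpoint eval (r : env) (e : expr) : seq letter :=
  match e with
  | EConst w => w
  | ECat e1 e2 => eval r e1 ++ eval r e2
  | EFor i e => loop (fun w pre => eval (scons w (scons pre r)) e) [::] (r i)
  | EIf i P e1 e2 => if P (ohead (r i)) then eval r e1 else eval r e2
  | EBin i => map inl (bits (size (r i)))
  | ELet e1 e2 => eval (scons (eval r e1) r) e2
  end.

(** Scratch tapes: a loop needs two for its variables, [EBin] a counter and a copy to consume,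
    [ELet] one for the value. Subexpressions run one after the other and share theirs. *)
Fixpoint tapes_needed (e : expr) : nat :=
  match e with
  | EConst _ => 0
  | ECat e1 e2 | EIf _ _ e1 e2 => maxn (tapes_needed e1) (tapes_needed e2)
  | EFor _ e => (tapes_needed e).+2
  | EBin _ => 2
  | ELet e1 e2 => (maxn (tapes_needed e1) (tapes_needed e2)).+1
  end.

(** Bounds of the form [s.+2 ^ d] stand for polynomials: the base is at least 2, so sums, products
    and constants are absorbed by the exponent. *)
Lemma leq_exp_add b x y c d : 1 < b -> x <= b ^ c -> y <= b ^ d ->
  x + y <= b ^ (c + d).+1.
Proof.
move=> b1 xc yd; have b0 : 0 < b by lia.
have h : b ^ c <= b ^ (c + d) by rewrite leq_exp2l // leq_addr.
have h' : b ^ d <= b ^ (c + d) by rewrite leq_exp2l // leq_addl.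
rewrite expnS; apply: leq_trans (leq_mul b1 (leqnn _)); lia.
Qed.

Lemma leq_exp_mul b x y c d : x <= b ^ c -> y <= b ^ d ->
  x * y <= b ^ (c + d).
Proof. by move=> xc yd; rewrite expnD leq_mul. Qed.

Lemma leq_exp_const b x : 1 < b -> x <= b ^ x.
Proof. by move=> b1; apply: ltnW; apply: ltn_expl. Qed.

(** Every constructor preserves polynomial size: a loop multiplies by the length of a word, and
    [ELet] composes two bounds, so that exponents multiply. *)
Lemma size_eval e : exists d, forall r s, (forall i, size (r i) <= s) ->
  size (eval r e) <= s.+2 ^ d.
Proof.
elim: e => [w|e1 [d1 IH1] e2 [d2 IH2]|i e [d IH]|i P e1 [d1 IH1] e2 [d2 IH2]|
            i|e1 [d1 IH1] e2 [d2 IH2]] /=.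
- by exists (size w) => r s _; apply: leq_exp_const.
- exists (d1 + d2).+1 => r s rs; rewrite size_cat.
  by apply: leq_exp_add => //; [apply: IH1|apply: IH2].
- exists (1 + d) => r s rs.
  apply: (@leq_trans (size (r i) * s.+2 ^ d)); last first.
    by apply: leq_exp_mul => //; apply: leq_trans (rs i) _; rewrite expn1; lia.
  have: size (r i) + size (Nil letter) <= s by rewrite addn0.
  elim: (r i) (Nil letter) => [|a w IHw] pre //= le_s.
  rewrite size_cat mulSn leq_add //; last by apply: IHw => /=; lia.
  by apply: IH => -[|[|j]] //=; lia.
- exists (d1 + d2) => r s rs; case: ifP => _.
    by apply: leq_trans (IH1 _ _ rs) _; rewrite leq_exp2l // leq_addr.
  by apply: leq_trans (IH2 _ _ rs) _; rewrite leq_exp2l // leq_addl.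
- exists 1 => r s rs; rewrite size_map expn1.
  by apply: leq_trans (size_bits _) _; apply: leq_trans (rs i) _; lia.
- exists (d1.+2 * d2) => r s rs.
  have le1 := IH1 _ _ rs.
  have b0 : 0 < s.+2 ^ d1 by rewrite expn_gt0.
  have b1 : s.+2 <= s.+2 ^ d1.+1 by rewrite expnS; nia.
  (* The exponent [d1.+1] also bounds the old variables; one more factor absorbs the [.+2] of the
     new base. *)
  apply: leq_trans (IH2 _ (s.+2 ^ d1.+1) _) _.
    move=> [|j] /=; last by apply: leq_trans (rs j) _; lia.
    by apply: leq_trans le1 _; rewrite leq_exp2l.
  rewrite expnM; case: d2 {IH2} => // d2; rewrite leq_exp2r //.
  by rewrite [s.+2 ^ d1.+2]expnS; nia.
Qed.

Lemma hoare_rewind_ending K i w (z : nat -> tape W) : i <= K ->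
  z i = ending w -> hoare (Rewind W K i) z (upd z i (home w)) (2 * size w + 3).
Proof.
move=> iK zi; rewrite -[X in home X]revK -[X in home X]cats0 -size_rev.
by apply: hoare_rewind => //; rewrite zi map_rev.
Qed.

Definition ready (rho : nat -> nat) (r : env) (m o : nat) (z : nat -> tape W)
    (v : seq letter) :=
  [/\ forall i, z (rho i) = home (r i),
      forall t, m <= t -> z t = home [::] & z o = ending v].

(* Variable [i] is stored on tape [rho i], the tapes from [m] on are empty, and
   the value of [e] is appended to the word on tape [o]. *)
Definition compiles (e : expr) (d : nat) := forall K rho m o,
  m + tapes_needed e <= K.+1 -> o < m -> (forall i, rho i < m) ->
  (forall i, rho i != o) ->
  exists p : prog W K, forall r z v s, (forall i, size (r i) <= s) ->
    ready rho r m o z v ->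
    hoare p z (upd z o (ending (v ++ eval r e))) (s.+2 ^ d).

Lemma compile_const w : exists d, compiles (EConst w) d.
Proof.
exists (size w).+1 => K rho m o mK om rhom rhoo.
exists (foldr (fun a p => Seq (Put K o a) p) (Skip W K) w) => r z v s _ [_ _] /=.
have oK : o <= K by move: mK => /=; lia.
move=> zo; suff H : hoare (foldr (fun a p => Seq (Put K o a) p) (Skip W K) w)
    z (upd z o (ending (v ++ w))) (size w).+1.
  by apply: (hoare_post H) => [j|]; [apply: eqtape_refl|apply: leq_exp_const].
elim: w z v zo {mK} => [|a w IH] z v zo /=.
  apply: hoare_post (hoare_skip _ _) _ _ => // j.
  by rewrite /upd; case: eqP => // ->; rewrite zo cats0.
rewrite -add1n; apply: hoare_seq; first exact: hoare_put zo.
apply: hoare_post (IH _ (rcons v a) _) _ (leqnn _); first by rewrite /upd eqxx.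
by move=> j; rewrite /upd; case: eqP => // _; rewrite cat_rcons.
Qed.

Lemma compile_cat e1 e2 : (exists d, compiles e1 d) ->
  (exists d, compiles e2 d) -> exists d, compiles (ECat e1 e2) d.
Proof.
move=> [d1 IH1] [d2 IH2]; exists (d1 + d2).+1 => K rho m o /= mK om rhom rhoo.
have [|p1 H1] := IH1 K rho m o _ om rhom rhoo; first by lia.
have [|p2 H2] := IH2 K rho m o _ om rhom rhoo; first by lia.
exists (Seq p1 p2) => r z v s rs rd; have [zr zm zo] := rd.
apply: hoare_post (hoare_seq (H1 _ _ _ _ rs rd) (H2 _ _ (v ++ eval r e1) _ rs _))
  _ (leq_exp_add _ (leqnn _) (leqnn _)) => //.
- split=> [i|t mt|]; rewrite /upd ?eqxx // ?(negbTE (rhoo i)) //.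
  by case: eqP => [et|_]; [lia|apply: zm].
- by move=> j; rewrite /upd; case: eqP => // _; rewrite catA.
Qed.

Lemma compile_if i P e1 e2 : (exists d, compiles e1 d) ->
  (exists d, compiles e2 d) -> exists d, compiles (EIf i P e1 e2) d.
Proof.
move=> [d1 IH1] [d2 IH2]; exists (1 + (d1 + d2)).+1 => K rho m o /= mK om rhom rhoo.
have [|p1 H1] := IH1 K rho m o _ om rhom rhoo; first by lia.
have [|p2 H2] := IH2 K rho m o _ om rhom rhoo; first by lia.
exists (Cond (rho i) P p1 p2) => r z v s rs rd; have [zr zm zo] := rd.
have: hoare (Cond (rho i) P p1 p2) z (upd z o (ending
    (v ++ if P (ohead (r i)) then eval r e1 else eval r e2)))
    (s.+2 ^ (d1 + d2)).+1.
  apply: hoare_cond; first by have := rhom i; lia.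
  rewrite zr scan_home; case: (P _); [apply: hoare_post (H1 _ _ _ _ rs rd) _ _|
                   apply: hoare_post (H2 _ _ _ _ rs rd) _ _] => //.
    by rewrite leq_exp2l // leq_addr.
  by rewrite leq_exp2l // leq_addl.
move=> H; apply: hoare_post H _ _ => //.
by rewrite -add1n; apply: leq_exp_add => //; rewrite expn1.
Qed.

(** The value of [e1] is built on the first free tape, rewound to become variable 0 of [e2], and
    erased at the end, so that the scratch tapes are empty again. *)
Lemma compile_let e1 e2 : (exists d, compiles e1 d) ->
  (exists d, compiles e2 d) -> exists d, compiles (ELet e1 e2) d.
Proof.
move=> [d1 IH1] [d2 IH2]; have [d0 szE] := size_eval e1.
(* One term per phase; [e2] runs on words of length up to [s + s.+2 ^ d0], whence the product, and
   20 absorbs the constants. *)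
pose D := d1 + d0 + d0.+2 * d2 + d0 + 20.
exists D => K rho m o /= mK om rhom rhoo.
have [||||p1 H1] := IH1 K rho m.+1 m _ _ _ _.
- by lia.
- by lia.
- by move=> i; have := rhom i; lia.
- by move=> i; have := rhom i; lia.
have [||||p2 H2] := IH2 K (fun i => if i is j.+1 then rho j else m) m.+1 o _ _ _ _.
- by lia.
- by lia.
- by move=> [|i] //; have := rhom i; lia.
- by move=> [|i] //; lia.
exists (Seq p1 (Seq (Rewind W K m) (Seq p2 (Clear W K m)))) => r z v s rs rd.
have [zr zm zo] := rd; set w := eval r e1.
have le_w : size w <= s.+2 ^ d0 by apply: szE.
have mo : (o == m) = false by lia.
have mr i : (rho i == m) = false by have := rhom i; lia.
have mK' : m <= K by lia.
apply: hoare_post (hoare_seq (H1 r z [::] s rs _) (hoare_seq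
  (hoare_rewind_ending (w := w) mK' _) (hoare_seq
  (H2 (scons w r) _ v (s + s.+2 ^ d0) _ _) (hoare_clear (w := w) mK' _)))) _ _.
- split=> //; last by rewrite zm.
  by move=> t mt; apply: zm; lia.
- by rewrite /upd eqxx.
- by case=> [|j] /=; [lia|have := rs j; lia].
- split=> [[|i]|t mt|]; rewrite /upd ?eqxx ?mr ?mo //=.
  by rewrite gtn_eqF ?zm //; lia.
- by rewrite /upd eq_sym mo eqxx.
- move=> j; rewrite /upd; case: eqP => [->|_]; last by case: eqP.
  by rewrite eq_sym mo zm.
have b0 : 0 < s.+2 ^ d0 by rewrite expn_gt0.
have h1 : s.+2 ^ d1 <= s.+2 ^ d1 by [].
have h2 : 2 * size w + 3 <= s.+2 ^ (d0 + 3).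
  by rewrite expnD !expnS; nia.
have h3 : (s + s.+2 ^ d0).+2 ^ d2 <= s.+2 ^ (d0.+2 * d2).
  rewrite expnM; case: (d2) => // d; rewrite leq_exp2r // !expnS; nia.
have h4 : 2 * size w + 1 <= s.+2 ^ (d0 + 3).
  by rewrite expnD !expnS; nia.
apply: leq_trans (leq_exp_add _ h1 (leq_exp_add _ h2 (leq_exp_add _ h3 h4))) _ => //.
by rewrite leq_exp2l // /D; lia.
Qed.

(** A copy of the word is erased letter by letter while a binary counter on tape [m] is incremented;
    the word itself stays intact. *)
Lemma compile_bin i : exists d, compiles (EBin i) d.
Proof.
exists 5 => K rho m o /= mK om rhom rhoo; set m1 := m.+1.
exists (Seq (Copy W K (rho i) m1) (Seq (Rewind W K m1)
  (Seq (While m1 (@nonblank W) (Seq (Incr W K m) (Erase W K m1)))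
       (Seq (Copy W K m o) (Clear W K m))))) => r z v s rs rd.
have [zr zm zo] := rd; have rm := rhom i.
have mK' : m <= K by lia.
have m1K : m1 <= K by rewrite /m1; lia.
have m1m : (m1 == m) = false by rewrite /m1; lia.
have mm1 : (m == m1) = false by rewrite /m1; lia.
have loopP k w z1 : z1 m = home (map inl (bits k)) -> z1 m1 = home w ->
    hoare (While m1 (@nonblank W) (Seq (Incr W K m) (Erase W K m1))) z1
      (upd (upd z1 m (home (map inl (bits (k + size w))))) m1 (home [::]))
      (size w * (4 * (k + size w) + 7) + 1).
  elim: w k z1 => [|a w IH] k z1 z1m z1m1.
    apply: hoare_post (hoare_while_done _ m1K _) _ (leqnn _).
      by rewrite z1m1.
    move=> j; rewrite /upd addn0 -z1m -z1m1.
    by case: eqP => [->|_] //; case: eqP => [->|_].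
  apply: hoare_post (hoare_while_step m1K _ (hoare_seq (hoare_incr mK' z1m)
     (hoare_erase (a := a) (w := w) m1K _)) (IH k.+1 _ _ _)) _ _.
  - by rewrite z1m1.
  - by rewrite /upd m1m.
  - by rewrite /upd mm1 eqxx bits_incr.
  - by rewrite /upd eqxx.
  - move=> j; rewrite /upd; case: eqP => // _; case: eqP => // _.
    by rewrite addSnnS.
  - by have := size_bits k; rewrite /=; nia.
have om' : (o == m) = false by lia.
have mo' : (m == o) = false by lia.
have om1 : (o == m1) = false by rewrite /m1; lia.
have m1o : (m1 == o) = false by rewrite /m1; lia.
have rm1 : (rho i == m1) = false by rewrite /m1; lia.
set n := size (r i); have le_n : n <= s by apply: rs.
have szn := size_bits n.
apply: hoare_post (hoare_seq (hoare_copy (w := r i) (v := [::]) _ m1K _ _ _)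
  (hoare_seq (hoare_rewind_ending (w := r i) m1K _)
  (hoare_seq (loopP 0 (r i) _ _ _)
  (hoare_seq (hoare_copy (w := map inl (bits n)) (v := v) mK' _ _ _ _)
             (hoare_clear (w := map inl (bits n)) mK' _))))) _ _.
- by lia.
- by rewrite rm1.
- exact: zr.
- by rewrite zm // /m1.
- by rewrite /upd eqxx.
- by rewrite /upd mm1 zm // bits0.
- by rewrite /upd eqxx.
- by lia.
- by rewrite mo'.
- by rewrite /upd mm1 eqxx.
- by rewrite /upd om1 om' zo.
- by rewrite /upd mo' mm1 eqxx.
- move=> j; rewrite /upd; case: (eqVneq j m) => [->|jm].
    by rewrite mo' zm.
  case: eqP => // _; case: eqP => [->|_]; last exact: eqtape_refl.
  by rewrite zm.
- by rewrite size_map !expnS expn0; nia.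
Qed.

(** The loop consumes a copy of the word on tape [m], which thus always holds the suffix, and moves
    each letter to tape [m1], the reversed prefix. A final clearing leaves both tapes empty. *)
Lemma compile_for i e : (exists d, compiles e d) ->
  exists d, compiles (EFor i e) d.
Proof.
move=> [d IH]; exists (d + 7) => K rho m o /= mK om rhom rhoo; set m1 := m.+1.
pose rho' j := if j is k.+1 then if k is l.+1 then rho l else m1 else m.
have [||||p H] := IH K rho' m.+2 o _ _ _ _.
- by lia.
- by lia.
- by move=> [|[|j]] //=; have := rhom j; lia.
- by move=> [|[|j]] //=; rewrite /m1; lia.
pose body := Seq p (Seq (Push W K m1 m) (Erase W K m)).
exists (Seq (Copy W K (rho i) m) (Seq (Rewind W K m)
  (Seq (While m (@nonblank W) body) (Clear W K m1)))) => r z v s rs rd.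
have [zr zm zo] := rd; have rm := rhom i.
have mK' : m <= K by lia.
have m1K : m1 <= K by rewrite /m1; lia.
have m1m : (m1 == m) = false by rewrite /m1; lia.
have mm1 : (m == m1) = false by rewrite /m1; lia.
have om' : (o == m) = false by lia.
have mo' : (m == o) = false by lia.
have om1 : (o == m1) = false by rewrite /m1; lia.
have m1o : (m1 == o) = false by rewrite /m1; lia.
have rm' j : (rho j == m) = false by have := rhom j; lia.
have rm1 j : (rho j == m1) = false by have := rhom j; rewrite /m1; lia.
pose F w pre := eval (scons w (scons pre r)) e.
have loopP w pre u z1 : size w + size pre <= s ->
    (forall j, z1 (rho j) = home (r j)) ->
    (forall t, m.+2 <= t -> z1 t = home [::]) ->
    z1 m = home w -> z1 m1 = home pre -> z1 o = ending u ->
    hoare (While m (@nonblank W) body) z1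
      (upd (upd (upd z1 m (home [::])) m1 (home (catrev w pre))) o
           (ending (u ++ loop F pre w)))
      (size w * (s.+2 ^ d + 4) + 1).
  elim: w pre u z1 => [|a w IHw] pre u z1 sz z1r z1m2 z1m z1m1 z1o.
    apply: hoare_post (hoare_while_done _ mK' _) _ _ => //.
      by rewrite z1m.
    move=> j; rewrite /upd cats0; case: eqP => [->|_]; first by rewrite z1o.
    by case: eqP => [->|_]; [rewrite z1m1|case: eqP => [->|_] //; rewrite z1m].
  apply: hoare_post (hoare_while_step mK' _ (hoare_seq
    (H (scons (a :: w) (scons pre r)) z1 u s _ _) (hoare_seq
      (hoare_push (a := a) (w := w) (v := pre) m1K mK' _ _ _)
      (hoare_erase (a := a) (w := w) mK' _)))
    (IHw (a :: pre) (u ++ F (a :: w) pre) _ _ _ _ _ _ _)) _ _.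
  - by rewrite z1m.
  - by move=> [|[|j]]; [move: sz => /=; lia|move: sz => /=; lia|apply: rs].
  - by split; [case=> [|[|j]]; [exact: z1m|exact: z1m1|exact: z1r]|exact: z1m2|].
  - by rewrite m1m.
  - by rewrite /upd m1o.
  - by rewrite /upd mo'.
  - by rewrite /upd mm1 mo'.
  - by move: sz => /=; lia.
  - by move=> j; rewrite /upd rm' rm1 (negbTE (rhoo j)).
  - move=> t mt; rewrite /upd; do 3![case: eqP => [et|_]; first by rewrite /m1 in et; lia].
    exact: z1m2.
  - by rewrite /upd eqxx.
  - by rewrite /upd m1m eqxx.
  - by rewrite /upd om' om1 eqxx.
  - move=> j; rewrite /upd /= -catA; case: eqP => // _; case: eqP => // _.
    by case: eqP.
  - by rewrite /=; lia.
set n := size (r i); have le_n : n <= s by apply: rs.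
apply: hoare_post (hoare_seq (hoare_copy (w := r i) (v := [::]) _ mK' _ _ _)
  (hoare_seq (hoare_rewind_ending (w := r i) mK' _)
  (hoare_seq (loopP (r i) [::] v _ _ _ _ _ _ _)
             (hoare_clear (w := catrev (r i) [::]) m1K _)))) _ _.
- by lia.
- by rewrite rm'.
- exact: zr.
- by rewrite zm.
- by rewrite /upd eqxx.
- by rewrite addn0.
- by move=> j; rewrite /upd rm'.
- move=> t mt; rewrite /upd; case: eqP => [et|_]; first by lia.
  by apply: zm; lia.
- by rewrite /upd eqxx.
- by rewrite /upd m1m zm // /m1.
- by rewrite /upd om'.
- by rewrite /upd m1o eqxx.
- move=> j; rewrite /upd; case: (eqVneq j m1) => [->|jm1].
    by rewrite m1o zm // /m1.
  case: eqP => // _; case: eqP => [->|_]; last exact: eqtape_refl.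
  by rewrite zm.
- have b0 : 0 < s.+2 ^ d by rewrite expn_gt0.
  rewrite catrevE cats0 size_rev -/n expnD !expnS expn0.
  have h : 8 * (s.+2 * s.+2) * s.+2 ^ d <= s.+2 ^ d * (s.+2 * (s.+2 * (s.+2 * (s.+2 * (s.+2 * (s.+2 * (s.+2 * 1))))))).
    by rewrite mulnC leq_mul2l; apply/orP; right; nia.
  apply: leq_trans h; set B := s.+2 ^ d in b0 *.
  have : n * B <= s * B by rewrite leq_mul2r le_n orbT.
  nia.
Qed.

Theorem compile e : exists d, compiles e d.
Proof.
elim: e => [w|e1 IH1 e2 IH2|i e IH|i P e1 IH1 e2 IH2|i|e1 IH1 e2 IH2].
- exact: compile_const.
- exact: compile_cat.
- exact: compile_for.
- exact: compile_if.
- exact: compile_bin.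
- exact: compile_let.
Qed.

End Expr.

(** * From expressions to deterministic polynomial-time machines *)

Lemma horner_nat_exp d n : (('X + 2%:P) ^+ d : {poly nat}).[n]%R = n.+2 ^ d.
Proof.
elim: d => [|d IH]; first by rewrite GRing.expr0 hornerC.
rewrite GRing.exprS hornerM IH hornerD hornerX hornerC expnS.
by rewrite -[n.+2](addn2 n).
Qed.

Section Machine.
Variables (W : finType) (K : nat) (p : prog W K).

Definition machine_delta (s : option (pst p))
    (sc : {ffun 'I_K.+1 -> symbol W}) :=
  if s is Some s1 then [:: pdelta s1 sc] else [::].

Definition machine : tm :=
  @TM K (option (pst p)) W (Some (pstart p)) xpredT machine_delta.

Lemma machine_deterministic : deterministic machine.
Proof. by case. Qed.

Lemma reaches_path s T T' n : reaches s T T' n ->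
  exists cs : seq (tm_config machine),
    [/\ path (@tm_step machine) (Some s, T) cs, size cs = n &
        last (Some s, T) cs = (None, T')].
Proof.
elim=> {s T T' n} [s T a e|s s' T T' a n e _ [cs [pcs szcs lcs]]].
  exists [:: (None, act a T)]; split=> //=.
  by rewrite andbT /tm_step /tm_actions /= -/(scanT T) e /= inE.
exists ((Some s', act a T) :: cs); split; rewrite //= ?szcs // pcs andbT.
by rewrite /tm_step /tm_actions /= -/(scanT T) e /= inE.
Qed.

End Machine.

(** [polynomial_time] quantifies over all computations, but only the halting one is constructed;
    determinism makes every other computation a prefix of it. *)
Lemma deterministic_size (M : tm) c cs cs' : deterministic M ->
  path (@tm_step M) c cs -> tm_halted (last c cs) ->
  path (@tm_step M) c cs' -> size cs' <= size cs.
Proof.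
move=> det; elim: cs c cs' => [|c1 cs IH] c [|c2 cs'] //=.
  by move=> _; rewrite /tm_halted /tm_step => /nilP->.
move=> /andP[s1 p1] h /andP[s2 p2]; rewrite ltnS.
have e : c1 = c2.
  move: s1 s2; rewrite /tm_step /tm_actions.
  have := det c.1 [ffun i => scan (c.2 i)].
  by case: tm_delta => [|a [|b l]] //= _; rewrite !inE => /eqP-> /eqP->.
by move: p2; rewrite -e => /(IH _ _ p1 h).
Qed.

(** [tm_outputs] asks for a literal list of cells, whereas programs control tapes only up to
    [eqtape]; the difference is a tail of blanks. *)
Lemma nth_blank_word (W : finType) (r : seq (symbol W)) (w : seq (bool + W)) :
  (forall i, nth blank r i = nth blank (map Some w) i) ->
  exists m, r = map Some w ++ nseq m blank.
Proof.
elim: w r => [|a w IH] r e.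
  exists (size r); apply: (@eq_from_nth _ blank); rewrite ?size_nseq // => i.
  by rewrite e nth_nil /= nth_nseq if_same.
case: r e => [/(_ 0)|b r e] //.
have [m ->] := IH r (fun i => e i.+1).
by exists m; rewrite /=; have /= -> := e 0.
Qed.

Theorem expr_polytime_computable (W : finType) (e : expr W)
    (f : seq bool -> seq bool) :
  (forall x, eval (fun _ => map inl x) e = map inl (f x)) ->
  polytime_computable f.
Proof.
move=> evalE; have [d0 szE] := size_eval e; have [d compE] := compile e.
pose K := 2 + tapes_needed e.
(* All variables denote the input on tape 0, the value is written on tape 1, and the scratch tapes
   start at 2. *)
have [||||p pP] := compE K (fun _ => 0) 2 1; [by rewrite /K|by []|by []|by []|].
(* The output is read from tape 0 at its head, so the result replaces the input there. *)
pose q := Seq p (Seq (Clear W K 0) (Seq (Rewind W K 1)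
   (Seq (Copy W K 1 0) (Rewind W K 0)))).
pose D := d + d0 + d0 + d0 + 40.
pose z0 x : nat -> tape W := upd (fun _ => home [::]) 0 (home (map inl x)).
have agree0 x : agree (tm_init (machine q) x).2 (z0 x).
  move=> i; rewrite ffunE /z0 /upd /home.
  have -> : (i == ord0) = ((i : nat) == 0) by [].
  by case: eqP => // _; rewrite -map_comp; apply: eqtape_refl.
have qP x : hoare q (z0 x) (upd (upd (z0 x) 1 (home (map inl (f x)))) 0
    (home (map inl (f x)))) ((size x).+2 ^ D).
  have le_f : size (f x) <= (size x).+2 ^ d0.
    by rewrite -(size_map (@inl bool W)) -evalE; apply: szE => _; rewrite size_map.
  have := pP (fun _ => map inl x) (z0 x) [::] (size x) _ _.
  rewrite evalE => H.
  apply: hoare_post (hoare_seq (H _ _) (hoare_seq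
    (hoare_clear (w := map inl x) _ _) (hoare_seq
    (hoare_rewind_ending (w := map inl (f x)) _ _) (hoare_seq
    (hoare_copy (v := [::]) (w := map inl (f x)) _ _ _ _ _)
    (hoare_rewind_ending (w := map inl (f x)) _ _))))) _ _ => //.
  - by move=> _; rewrite size_map.
  - by split=> // t; rewrite /z0 /upd; case: t => [|[|t]].
  - move=> j; rewrite /upd; case: eqP => // _; case: eqP => //.
  rewrite !size_map.
  have b0 : 0 < (size x).+2 ^ d0 by rewrite expn_gt0.
  set s := size x in le_f b0 *.
  have h1 : 2 * s + 1 <= s.+2 ^ 2 by rewrite !expnS; nia.
  have h2 c : c <= 5 -> c * size (f x) + 4 <= s.+2 ^ (d0 + 5).
    by rewrite expnD !expnS expn0; nia.
  have h3 c : c <= 5 -> c * size (f x) + 3 <= s.+2 ^ (d0 + 5).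
    by move=> /h2; lia.
  have b1 : 1 < s.+2 by [].
  apply: leq_trans (leq_exp_add b1 (leqnn _) (leq_exp_add b1 h1 (leq_exp_add b1
    (h3 2 _) (leq_exp_add b1 (h2 5 _) (h3 2 _))))) _ => //.
  by rewrite leq_exp2l // /D; lia.
have run x : exists T' cs, [/\ path (@tm_step (machine q)) (tm_init (machine q) x) cs,
    size cs <= (size x).+2 ^ D, last (tm_init (machine q) x) cs = (None, T') &
    eqtape (T' ord0) (home (map inl (f x)))].
  have [H] := qP x; have [T' [m [lem r T'z]]] := H _ (agree0 x).
  have [cs [pcs szcs lcs]] := reaches_path r.
  by exists T', cs; split; rewrite ?szcs //; apply: T'z ord0.
exists (machine q); split.
- exact: machine_deterministic.
- exists (('X + 2%:P) ^+ D)%R => x s ps; rewrite horner_nat_exp.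
  have [T' [cs [pcs szcs lcs _]]] := run x.
  apply: leq_trans szcs; apply: deterministic_size pcs _ ps => //.
    exact: machine_deterministic.
  by rewrite lcs.
- move=> x; have [T' [cs [pcs szcs lcs T'0]]] := run x.
  exists cs; rewrite lcs; split=> //=.
  have [|m ->] := @nth_blank_word W (T' ord0).2 (map inl (f x)).
    by move=> i; have [] := T'0 i.
  by exists m; rewrite -map_comp.
Qed.

(** * The gadget graph *)

Section Reconfiguration.
Variable G : cgraph.
Implicit Types (C D : config G) (e : 'I_(ne G)).

(** A sequence of configurations is described by the list of edges to reverse; only the parity of
    the occurrences of an edge matters for the outcome. *)
Definition toggle C (es : seq 'I_(ne G)) : config G :=
  [ffun e => C e (+) odd (count_mem e es)].

Fixpoint toggles C es : seq (config G) :=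
  if es is e :: es' then toggle C [:: e] :: toggles (toggle C [:: e]) es'
  else [::].

Lemma toggle_cons C e es : toggle (toggle C [:: e]) es = toggle C (e :: es).
Proof. by apply/ffunP => f; rewrite !ffunE /= addn0 oddD addbA. Qed.

Lemma toggle0 C : toggle C [::] = C.
Proof. by apply/ffunP => f; rewrite ffunE addbF. Qed.

Lemma toggle1_neq C e f : (C f != toggle C [:: e] f) = (e == f).
Proof. by rewrite ffunE /= addn0 oddb; case: (C f) (e == f) => [] []. Qed.

Lemma path_toggles C es : path (@reversal G) C (toggles C es).
Proof.
elim: es C => //= e es IH C; rewrite IH andbT; apply/cards1P; exists e.
by apply/setP => f; rewrite !inE toggle1_neq eq_sym.
Qed.

Lemma num_reversals_cons C D s e :
  num_reversals C (D :: s) e = (C e != D e) + num_reversals D s e.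
Proof. by []. Qed.

Lemma num_reversals_toggles C es e :
  num_reversals C (toggles C es) e = count_mem e es.
Proof.
by elim: es C => //= f es IH C; rewrite num_reversals_cons IH toggle1_neq.
Qed.

Lemma last_toggles C es : last C (toggles C es) = toggle C es.
Proof.
by elim: es C => [|e es IH] C /=; rewrite ?toggle0 // IH toggle_cons.
Qed.

Lemma all_toggles (P : pred (config G)) C es :
  (forall k, P (toggle C (take k es))) -> all P (C :: toggles C es).
Proof.
elim: es C => [|e es IH] C HP /=; first by rewrite -(toggle0 C) (HP 0).
rewrite -{1}(toggle0 C) (HP 0); apply: IH => k.
by rewrite toggle_cons; apply: (HP k.+1).
Qed.

Lemma num_reversals_last C s e : C e != last C s e -> 0 < num_reversals C s e.
Proof.
elim: s C => [|D s IH] C /=; first by rewrite eqxx.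
rewrite num_reversals_cons; case: (C e =P D e) => // -> /IH.
by rewrite add0n.
Qed.

Lemma reversal_witness C s e : reconf_seq C s -> 0 < num_reversals C s e ->
  exists D D', [/\ legal D, legal D', reversal D D' & D e != D' e].
Proof.
elim: s C => [|D s IH] C; rewrite /reconf_seq //= => /andP[].
move=> /and3P[lC lD ls] /andP[r ps]; rewrite num_reversals_cons.
case CD: (_ != _) => /=; first by exists C, D.
by apply: IH; rewrite /reconf_seq /= lD ls.
Qed.

Lemma reversal_eq C D e f : reversal C D -> C e != D e -> f != e -> C f = D f.
Proof.
move=> /cards1P[g /setP r] Ce fe.
have /eqP eg : e == g by have := r e; rewrite !inE Ce => <-.
by apply/eqP; apply: contraNT fe; have := r f; rewrite !inE eg => ->.
Qed.

End Reconfiguration.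

Section Gadget.
Variables (n : nat) (a : nat -> nat) (W R S : nat).

(** Edge 0 joins the hubs; edges [j.*2.+1] and [j.*2.+2] join hub 0 and hub 1 to item [j], which is
    vertex [j.+2]. The smaller endpoint comes first, so [true] directs an edge towards its item, and
    the edge between the hubs towards hub 1. *)
Definition gends (k : nat) : nat * nat :=
  if k is k'.+1 then (nat_of_bool (odd k'), k'./2.+2) else (0, 1).
Definition gweight (k : nat) : nat := if k is k'.+1 then a k'./2 else W.
Definition ginflow (v : nat) : nat :=
  match v with 0 => R | 1 => S | _ => 1 end.

Definition gends_ffun : {ffun 'I_(n.*2).+1 -> 'I_n.+2 * 'I_n.+2} :=
  [ffun e : 'I__ => (inord (gends e).1, inord (gends e).2)].

Lemma gends_bound k : k < (n.*2).+1 -> (gends k).1 < n.+2 /\ (gends k).2 < n.+2.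
Proof. by case: k => [|k] //=; have := odd_double_half k; case: odd => /=; lia. Qed.

Lemma gends1 e : (gends_ffun e).1 = (gends e).1 :> nat.
Proof. by rewrite ffunE /= inordK //; have [] := gends_bound (ltn_ord e). Qed.

Lemma gends2 e : (gends_ffun e).2 = (gends e).2 :> nat.
Proof. by rewrite ffunE /= inordK //; have [] := gends_bound (ltn_ord e). Qed.

Lemma gends_lt : [forall e, (gends_ffun e).1 < (gends_ffun e).2].
Proof.
apply/forallP => e; rewrite gends1 gends2.
by case: e => [[|k] ?] //=; case: odd.
Qed.

Lemma gends_nat_inj : injective gends.
Proof.
move=> [|k] [|l] //= [] eo eh.
by rewrite -(odd_double_half k) -(odd_double_half l) eo eh.
Qed.

Lemma gends_inj : injectiveb gends_ffun.
Proof.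
apply/injectiveP => e f ef; apply: val_inj; apply: gends_nat_inj.
have e1 : (gends e).1 = (gends f).1 by rewrite -!gends1 ef.
have e2 : (gends e).2 = (gends f).2 by rewrite -!gends2 ef.
have: gends e = gends f.
  by rewrite (surjective_pairing (gends e)) e1 e2 -surjective_pairing.
by [].
Qed.

Hypothesis a_gt0 : forall j, 0 < a j.
Hypothesis W_gt0 : 0 < W.

Lemma gweight_gt0 : [forall e, 0 < [ffun e : 'I_(n.*2).+1 => gweight e] e].
Proof.
by apply/forallP => -[[|k] lt]; rewrite ffunE /=; [apply: W_gt0|apply: a_gt0].
Qed.

Definition gadget : cgraph :=
  CGraph [ffun v : 'I_n.+2 => ginflow v] gends_lt gends_inj gweight_gt0.

Implicit Types C : config gadget.

Definition gdir C (k : nat) : bool := C (inord k).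

Lemma sum_double (F : nat -> nat) : \sum_(k < n.*2) F k = \sum_(j < n) (F j.*2 + F j.*2.+1) :> nat.
Proof.
elim: n => [|m IH]; first by rewrite !big_ord0.
by rewrite doubleS !big_ord_recr /= IH addnA.
Qed.

Lemma inflow_sum C (v : 'I_n.+2) :
  \sum_(e | edge_head C e == v) weight gadget e =
  ((if gdir C 0 then 1 else 0) == v :> nat) * W +
  \sum_(j < n) (((if gdir C j.*2.+1 then j.+2 else 0) == v :> nat) +
                ((if gdir C j.*2.+2 then j.+2 else 1) == v :> nat)) * a j.
Proof.
rewrite big_mkcond big_ord_recl /=; congr (_ + _).
  rewrite /edge_head -val_eqE /= /gdir (_ : inord 0 = ord0); last first.
    by apply: val_inj; rewrite /= inordK.
  have -> : weight gadget ord0 = W by rewrite ffunE.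
  have -> : (if C ord0 then (ends gadget ord0).2 else (ends gadget ord0).1)
      = (if C ord0 then 1 else 0) :> nat by rewrite ffunE; case: ifP; rewrite inordK.
  by case: eqP; rewrite ?mul1n.
pose F k := if (if gdir C k.+1 then (gends k.+1).2 else (gends k.+1).1) == v :> nat
  then gweight k.+1 else 0.
transitivity (\sum_(k < n.*2) F k).
  apply: eq_bigr => k _; rewrite /F /edge_head -val_eqE /= /gdir.
  have -> : inord k.+1 = lift ord0 k :> 'I_(n.*2).+1.
    by apply: val_inj; rewrite /= inordK // ltnS.
  by rewrite (fun_if (@nat_of_ord _)) gends1 gends2 ffunE.
rewrite sum_double; apply: eq_bigr => j _; rewrite /F /=.
rewrite odd_double uphalf_double doubleK /= mulnDl.
by congr (_ + _); case: eqP; rewrite ?mul1n.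
Qed.

(** The three conditions are those of hub 0, hub 1 and the items. As weights are positive, inflow 1
    at an item means that one of its two edges enters it. *)
Lemma gadget_legalP C : reflect
  [/\ R <= ~~ gdir C 0 * W + \sum_(j < n) ~~ gdir C j.*2.+1 * a j,
      S <= gdir C 0 * W + \sum_(j < n) ~~ gdir C j.*2.+2 * a j &
      forall j, j < n -> gdir C j.*2.+1 || gdir C j.*2.+2]
  (legal C).
Proof.
have e0 : \sum_(e | edge_head C e == ord0) weight gadget e =
    ~~ gdir C 0 * W + \sum_(j < n) ~~ gdir C j.*2.+1 * a j.
  rewrite inflow_sum; congr (_ + _); first by case: gdir.
  by apply: eq_bigr => j _; congr (_ * _); do 2 case: gdir.
have e1 : \sum_(e | edge_head C e == inord 1) weight gadget e =
    gdir C 0 * W + \sum_(j < n) ~~ gdir C j.*2.+2 * a j.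
  rewrite inflow_sum inordK //; congr (_ + _); first by case: gdir.
  by apply: eq_bigr => j _; congr (_ * _); do 2 case: gdir.
have e2 i (ltin : i < n) : \sum_(e | edge_head C e == inord i.+2) weight gadget e =
    (gdir C i.*2.+1 + gdir C i.*2.+2) * a i.
  rewrite inflow_sum inordK ?ltnS //.
  have -> : (if gdir C 0 then 1 else 0) == i.+2 = false by case: gdir.
  rewrite mul0n add0n (bigD1 (Ordinal ltin)) //= big1 ?addn0.
    by congr (_ * _); do 2 case: gdir => /=; rewrite ?eqxx.
  move=> j /negbTE ji; have {}ji : (j == i :> nat) = false by rewrite -ji.
  by do 2 case: gdir; rewrite /= ?eqSS ?ji.
apply: (iffP forallP) => [H|[H0 H1 H2] v].
  split.
  - by have := H ord0; rewrite e0 ffunE.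
  - by have := H (inord 1); rewrite e1 ffunE inordK.
  - move=> j ltjn; have := H (inord j.+2).
    by rewrite e2 // ffunE inordK ?ltnS //=; do 2 case: gdir.
rewrite ffunE; case: v => [[|[|i]] ltv] /=.
- by rewrite (_ : Ordinal ltv = ord0) ?e0 //; apply: val_inj.
- by rewrite (_ : Ordinal ltv = inord 1) ?e1 //; apply: val_inj; rewrite /= inordK.
- rewrite (_ : Ordinal ltv = inord i.+2) ?e2 //.
    by have := H2 i ltv; have := a_gt0 i; do 2 case: gdir => //=; lia.
  by apply: val_inj; rewrite /= inordK.
Qed.

Hypothesis RS : R + S = \sum_(j < n) a j.
Hypotheses (SW : S <= W) (RW : R <= W).

(** At the start the edge between the hubs enters hub 1, hub 0 holds all items, and every item is
    entered by its edge from hub 1. *)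
Definition gfrom : config gadget :=
  [ffun e : 'I_(n.*2).+1 => if nat_of_ord e is k.+1 then odd k else true].
Definition gto : config gadget := [ffun e => ~~ gfrom e].

Lemma gdir_from k : k < (n.*2).+1 ->
  gdir gfrom k = if k is k'.+1 then odd k' else true.
Proof. by move=> ltk; rewrite /gdir ffunE inordK. Qed.

Lemma sum_splitb (b : nat -> bool) :
  \sum_(j < n) b j * a j + \sum_(j < n) ~~ b j * a j = R + S.
Proof.
rewrite RS -big_split; apply: eq_bigr => j _ /=; rewrite -mulnDl.
by case: (b j); rewrite mul1n.
Qed.

Lemma leq_sum_bool (b c : nat -> bool) : (forall j, j < n -> b j -> c j) ->
  \sum_(j < n) b j * a j <= \sum_(j < n) c j * a j.
Proof.
move=> bc; apply: leq_sum => j _; rewrite leq_mul2r; apply/orP; right.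
by have := bc j (ltn_ord j); case: (b j) => // ->.
Qed.

Lemma ltn_edge1 j : j < n -> j.*2.+1 < (n.*2).+1. Proof. by lia. Qed.
Lemma ltn_edge2 j : j < n -> j.*2.+2 < (n.*2).+1. Proof. by lia. Qed.

Lemma gfrom_legal : legal gfrom.
Proof.
apply/gadget_legalP; split.
- rewrite gdir_from // mul0n add0n (_ : \sum_(j < n) _ = \sum_(j < n) a j).
    by rewrite -RS leq_addr.
  apply: eq_bigr => j _.
  by rewrite gdir_from ?ltn_edge1 //= odd_double mul1n.
- by rewrite gdir_from // mul1n (leq_trans SW) // leq_addr.
- move=> j ltj; rewrite [X in _ || X]gdir_from ?ltn_edge2 //=.
  by rewrite odd_double orbT.
Qed.

Lemma gdir_to k : gdir gto k = ~~ gdir gfrom k.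
Proof. by rewrite /gdir ffunE. Qed.

Lemma gto_legal : legal gto.
Proof.
apply/gadget_legalP; split.
- by rewrite gdir_to gdir_from // mul1n (leq_trans RW) // leq_addr.
- rewrite gdir_to gdir_from // mul0n add0n.
  rewrite (_ : \sum_(j < n) _ = \sum_(j < n) a j); first by rewrite -RS leq_addl.
  apply: eq_bigr => j _.
  by rewrite gdir_to gdir_from ?ltn_edge2 //= odd_double mul1n.
- move=> j ltj; rewrite gdir_to gdir_from ?ltn_edge1 //=.
  by rewrite odd_double.
Qed.

Definition gmain : 'I_(ne gadget) := @ord0 n.*2.

Definition subset_sum := exists J : nat -> bool, \sum_(j < n) J j * a j = S.

(* When the edge [gmain] is reversed, the items that have left vertex 0 weigh
   at most [S] and the items that have reached vertex 1 weigh at least [S]. *)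
Lemma subset_sum_reversal (C D : config gadget) :
  legal C -> legal D -> reversal C D -> C gmain != D gmain -> subset_sum.
Proof.
wlog Cm : C D / C gmain.
  move=> H lC lD r neq; case Cm: (C gmain); first exact: (H C D).
  apply: (H D C) => //; [|rewrite /reversal|by rewrite eq_sym].
    by move: neq; rewrite Cm; case: (D gmain).
  move: r; rewrite /reversal; congr (_ == _); apply: eq_card => e.
  by rewrite !inE eq_sym.
move=> /gadget_legalP[C0 _ C2] /gadget_legalP[_ D1 _] r neq.
have Dm : D gmain = false by move: neq; rewrite Cm; case: (D gmain).
have g0 : inord 0 = gmain by apply: val_inj; rewrite /= inordK.
have e k : 0 < k -> k < (n.*2).+1 -> gdir C k = gdir D k.
  move=> k0 ltk; apply: (reversal_eq r neq).
  by rewrite -val_eqE /= inordK // -lt0n.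
move: C0 D1; rewrite /gdir g0 Cm Dm -/(gdir _ _) !mul0n !add0n => C0 D1.
(* The items that hub 1 has received. Each of their vertices must be entered from hub 0, so they are
   among the items that hub 0 has released. *)
exists (fun j => ~~ gdir D j.*2.+2).
apply/eqP; rewrite eqn_leq; apply/andP; split; last exact: D1.
have := sum_splitb (fun j => gdir C j.*2.+1).
have := @leq_sum_bool (fun j => ~~ gdir D j.*2.+2) (fun j => gdir C j.*2.+1).
move=> /(_ _)/wrap[j ltj|]; last by move: C0; rewrite /gdir; lia.
by rewrite -e ?ltn_edge2 //; have := C2 j ltj; do 2 case: gdir.
Qed.

Section Schedule.
Variable J : nat -> bool.
Hypothesis JS : \sum_(j < n) J j * a j = S.

(* The items of [J] leave vertex 0 and then reach vertex 1; the edge between the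
   two vertices follows, and then the other items in the same order. *)
Definition phase (k : nat) : nat :=
  if k is k'.+1 then
    if odd k' then (if J k'./2 then 1 else 4) else (if J k'./2 then 0 else 3)
  else 2.

Definition schedule : seq 'I_(ne gadget) :=
  sort (fun e f : 'I_(n.*2).+1 => phase e <= phase f) (enum 'I_(n.*2).+1).

Lemma schedule_uniq : uniq schedule.
Proof. by rewrite sort_uniq enum_uniq. Qed.

Lemma mem_schedule e : e \in schedule.
Proof. by rewrite mem_sort mem_enum. Qed.

Lemma take_schedule k (e f : 'I_(n.*2).+1) : phase e < phase f ->
  f \in take k schedule -> e \in take k schedule.
Proof.
move=> lt_ef fk; apply: contraLR lt_ef => ek; rewrite -leqNgt.
have tr : transitive (fun e f : 'I_(n.*2).+1 => phase e <= phase f).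
  by move=> x y z; apply: leq_trans.
have: sorted (fun e f : 'I_(n.*2).+1 => phase e <= phase f) schedule.
  by apply: sort_sorted => x y; apply: leq_total.
rewrite -{1}(cat_take_drop k schedule) (sorted_pairwise tr) pairwise_cat.
move=> /andP[/allrelP H _]; apply: H => //.
by have := mem_schedule e; rewrite -{1}(cat_take_drop k schedule) mem_cat (negbTE ek).
Qed.

(** Until the edge between the hubs moves, hub 0 has lost only items of [J] and keeps the weight [R]
    of the others; by the time it moves, all items of [J] have reached hub 1. The edge of an item at
    hub 0 always moves before the one at hub 1. *)
Lemma schedule_legal k : legal (toggle gfrom (take k schedule)).
Proof.
pose moved j := inord j \in take k schedule.
have dirE j : j < (n.*2).+1 ->
    gdir (toggle gfrom (take k schedule)) j = gdir gfrom j (+) moved j.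
  by move=> ltj; rewrite /gdir ffunE count_uniq_mem ?oddb // take_uniq // schedule_uniq.
have before i j : i < (n.*2).+1 -> j < (n.*2).+1 -> phase i < phase j ->
    moved j -> moved i.
  by move=> lti ltj lt_ij; apply: take_schedule; rewrite !inordK.
have dir0 : gdir (toggle gfrom (take k schedule)) 0 = ~~ moved 0.
  by rewrite dirE // gdir_from.
have dir1 j : j < n -> gdir (toggle gfrom (take k schedule)) j.*2.+1 = moved j.*2.+1.
  by move=> ltj; rewrite dirE ?gdir_from ?ltn_edge1 //= odd_double.
have dir2 j : j < n -> gdir (toggle gfrom (take k schedule)) j.*2.+2 = ~~ moved j.*2.+2.
  by move=> ltj; rewrite dirE ?gdir_from ?ltn_edge2 //= odd_double.
have ph1 j : phase j.*2.+1 = if J j then 0 else 3.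
  by rewrite /= odd_double doubleK.
have ph2 j : phase j.*2.+2 = if J j then 1 else 4.
  by rewrite /= odd_double uphalf_double.
apply/gadget_legalP; split.
- rewrite dir0 negbK; case: (boolP (moved 0)) => m0.
    by rewrite mul1n (leq_trans RW) // leq_addr.
  have := sum_splitb J; rewrite JS => e.
  have -> : R = \sum_(j < n) ~~ J j * a j by lia.
  rewrite mul0n add0n.
  apply: (@leq_sum_bool (fun j => ~~ J j) (fun j => ~~ gdir _ j.*2.+1)) => j ltj.
  rewrite dir1 //; apply: contra => mj; apply: contraR m0 => Jj.
  by apply: before mj; rewrite ?ltn_edge1 // ph1 (negbTE Jj).
- rewrite dir0; case: (boolP (moved 0)) => m0; last first.
    by rewrite mul1n (leq_trans SW) // leq_addr.
  rewrite mul0n add0n -JS.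
  apply: (@leq_sum_bool J (fun j => ~~ gdir _ j.*2.+2)) => j ltj Jj.
  rewrite dir2 // negbK.
  by apply: before m0; rewrite ?ltn_edge2 // ph2 Jj.
- move=> j ltj; rewrite dir1 // dir2 //; case: (boolP (moved j.*2.+2)) => //; rewrite ?orbT //.
  move=> m2; rewrite (before _ _ _ _ _ m2) ?ltn_edge1 ?ltn_edge2 //.
  by rewrite ph1 ph2; case: (J j).
Qed.

Lemma schedule_bounded : bounded_reconf_seq gfrom (toggles gfrom schedule).
Proof.
rewrite /bounded_reconf_seq /reconf_seq path_toggles andbT.
apply/andP; split; first by apply: all_toggles; apply: schedule_legal.
apply/forallP => e; rewrite num_reversals_toggles count_uniq_mem ?leq_b1 //.
exact: schedule_uniq.
Qed.

Lemma schedule_last : last gfrom (toggles gfrom schedule) = gto.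
Proof.
rewrite last_toggles; apply/ffunP => e; rewrite [RHS]ffunE ffunE.
by rewrite count_uniq_mem ?schedule_uniq // mem_schedule addbT.
Qed.
End Schedule.

Definition gadget_c2c : c2c_instance := C2C gfrom_legal gto_legal.
Definition gadget_c2e : c2e_instance := C2E gmain gfrom_legal.

Lemma gmain_reversed J :
  0 < num_reversals gfrom (toggles gfrom (schedule J)) gmain.
Proof.
by rewrite num_reversals_toggles -has_count has_pred1 mem_schedule.
Qed.

Theorem gadget_c2e_yes : c2e_yes gadget_c2e <-> subset_sum.
Proof.
split=> [[s [/andP[rs _] e]]|[J JS]].
  have [D [D' [lD lD' r neq]]] := reversal_witness rs e.
  exact: subset_sum_reversal neq.
exists (toggles gfrom (schedule J)); split; last exact: gmain_reversed.
exact: schedule_bounded.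
Qed.

Theorem gadget_c2c_yes : c2c_yes gadget_c2c <-> subset_sum.
Proof.
split=> [[s [/andP[rs _] e]]|[J JS]].
  have [|D [D' [lD lD' r neq]]] := reversal_witness (e := gmain) rs.
    (* The final configuration disagrees with the initial one on [gmain], so every sequence between
       them reverses this edge. *)
    by apply: num_reversals_last; rewrite /= e [gto _]ffunE; case: (gfrom _).
  exact: subset_sum_reversal neq.
exists (toggles gfrom (schedule J)); split; last exact: schedule_last.
exact: schedule_bounded.
Qed.

End Gadget.

(** * Treewidth *)

Definition remove_edge (I : finType) (t : rel I) x y : rel I := fun a b =>
  [&& t a b, (a, b) != (x, y) & (a, b) != (y, x)].

(** A simple path avoiding the edge closes up with it to a cycle without repetition. [is_tree]
    bounds its length by 2, so the path would consist of the removed edge or have equal ends. *)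
Lemma tree_bridge (I : finType) (t : rel I) x y :
  is_tree t -> t x y -> ~~ connect (remove_edge t x y) x y.
Proof.
move=> [_ tsym tirr _ tacyc] txy; apply/negP => /connectP[p0 p0P yE].
case/shortenP: p0P yE => p pP up _ yE {p0}.
have ptP : path t x p by apply: sub_path pP => a b /andP[].
have := tacyc (x :: p); rewrite /ucycle up andbT /= rcons_path ptP -yE tsym txy.
move=> /(_ isT); case: p pP yE {up ptP} => [|z [|z' p]] //= pP yE _.
  by rewrite yE tirr in txy.
by move: pP; rewrite /remove_edge yE eqxx /= andbF.
Qed.

Lemma path_crossing (I : finType) (e : rel I) (P : pred I) x p :
  path e x p -> ~~ P x -> P (last x p) ->
  exists a b, [/\ connect [rel c d | [&& e c d, ~~ P c & ~~ P d]] x a,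
                  e a b, ~~ P a & P b].
Proof.
elim: p x => [|y p IH] x /=; first by move=> _ /negbTE->.
move=> /andP[exy pp] Px Pl; case Py: (P y).
  by exists x, y; rewrite connect0.
have [a [b [c1 eab Pa Pb]]] := IH y pp (negbT Py) Pl.
exists a, b; split=> //; apply: connect_trans c1.
by apply: connect1; rewrite /= exy Px Py.
Qed.

(* The bags with [v] lead from a bag without [w] to a bag with [w], crossing a tree
   edge [(a, b)]; going back from [a] and then along the bags with [u] and those
   with [w] reaches [b] without this edge, which is impossible in a tree. *)
Lemma triangle_treewidth (V : finType) (g : rel V) (D : tree_decomposition g)
    u v w : uniq [:: u; v; w] -> g u v -> g v w -> g u w -> 2 <= td_width D.
Proof.
move=> uvw guv gvw guw; rewrite leqNgt; apply/negP => small.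
have no3 (i : td_node D) : ~~ [&& u \in td_bag i, v \in td_bag i & w \in td_bag i].
  apply/negP => /and3P[ui vi wi].
  have: #|td_bag i| <= 2.
    have := leq_bigmax (F := fun i : td_node D => #|td_bag i|) i.
    by move: small; rewrite /td_width; lia.
  rewrite leqNgt => /negP; apply; rewrite -[3]/(size [:: u; v; w]) -(card_uniqP uvw).
  by apply/subset_leq_card/subsetP => z; rewrite !inE => /or3P[] /eqP->.
have [X /andP[uX vX]] := td_edge D guv.
have [Y /andP[vY wY]] := td_edge D gvw.
have [Z /andP[uZ wZ]] := td_edge D guw.
have [p pP YE] := connectP (td_connected vX vY).
have wX : w \notin td_bag X by have := no3 X; rewrite uX vX.
have [|a [b [cXa /and3P[tab va vb] wa wb]]] :=
  @path_crossing _ _ (fun i : td_node D => w \in td_bag i) _ _ pP wX; first by rewrite -YE.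
have ub : u \notin td_bag b by have := no3 b; rewrite vb wb !andbT.
have T := td_is_tree D; have [_ tsym _ _ _] := T.
apply/negP: (tree_bridge T tab); rewrite negbK.
have rsym : symmetric (remove_edge (@td_tree _ _ D) a b).
  by move=> c d; rewrite /remove_edge tsym !xpair_eqE
       [(d == a) && _]andbC [(d == b) && _]andbC [X in _ && X]andbC.
apply: connect_trans (connect_trans _ _).
- rewrite (sym_connect_sym rsym); apply: (connect_sub _) cXa.
  move=> c d /= /and3P[/and3P[tcd _ _] wc wd]; apply: connect1.
  rewrite /remove_edge tcd !xpair_eqE /=.
  by apply/andP; split; apply/negP => /andP[/eqP ec /eqP ed];
    move: wb; rewrite -?ec -?ed ?(negbTE wc) ?(negbTE wd).
- apply: (connect_sub _) (td_connected uX uZ).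
  move=> c d /= /and3P[tcd uc ud]; apply: connect1.
  rewrite /remove_edge tcd !xpair_eqE /=.
  by apply/andP; split; apply/negP => /andP[/eqP ec /eqP ed];
    move: ub; rewrite -?ec -?ed ?uc ?ud.
- apply: (connect_sub _) (td_connected wZ wb).
  move=> c d /= /and3P[tcd wc wd]; apply: connect1.
  rewrite /remove_edge tcd !xpair_eqE /=.
  by apply/andP; split; apply/negP => /andP[/eqP ec /eqP ed];
    move: wa; rewrite -?ec -?ed ?wc ?wd.
Qed.

Section GadgetTreewidth.
Variables (n : nat) (a : nat -> nat) (W R S : nat).
Hypothesis a_gt0 : forall j, 0 < a j.
Hypothesis W_gt0 : 0 < W.
Hypothesis n_gt0 : 0 < n.
Let G := @gadget n a W R S a_gt0 W_gt0.

(** Node 0 is the centre. The hubs lie in all bags and every item in exactly one, so any tree would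
    keep the bags of a vertex connected; for a star acyclicity is easy to check. *)
Definition star : rel 'I_n := fun i j => (i != j) && ((i == 0 :> nat) || (j == 0 :> nat)).

(** Every edge contains the centre, so a cycle of three or more nodes would visit the centre
    twice. *)
Lemma star_is_tree : is_tree star.
Proof.
pose c0 := Ordinal n_gt0.
have ssym : symmetric star by move=> i j; rewrite /star eq_sym orbC.
have c i : connect star c0 i.
  by case: (eqVneq c0 i) => [->|ne]; rewrite ?connect0 ?connect1 // /star ne.
split=> // [|i|i j|].
- by apply/card_gt0P; exists c0.
- by rewrite /star eqxx.
- by apply: connect_trans (c j); rewrite (sym_connect_sym ssym).
case=> [|x [|y [|z s]]] //=; rewrite /ucycle /star /= => /andP[].
move=> /and3P[/andP[_ xy] /andP[_ yz] p].
rewrite !inE !negb_or -!andbA => /and5P[nxy nxz _ nyz /andP[nys _]].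
have eq0 (i j : 'I_n) : i = 0 :> nat -> j = 0 :> nat -> i = j.
  by move=> i0 j0; apply: val_inj; rewrite /= i0 j0.
case y0: (y == 0 :> nat); last first.
  have /eqP x0 : x == 0 :> nat by move: xy; rewrite y0 orbF.
  have /eqP z0 : z == 0 :> nat by move: yz; rewrite y0.
  by rewrite (eq0 _ _ x0 z0) eqxx in nxz.
have x0 : (x == 0 :> nat) = false.
  by apply: contraNF nxy => /eqP x0; apply/eqP/eq0; rewrite ?x0 ?(eqP y0).
have z0 : (z == 0 :> nat) = false.
  by apply: contraNF nyz => /eqP z0; apply/eqP/eq0; rewrite ?z0 ?(eqP y0).
case: s p nys => [|v s] /=; rewrite z0 /= => /andP[/andP[_ /eqP v0] _].
  by rewrite v0 eqxx in x0.
by rewrite inE (eq0 _ _ (eqP y0) v0) eqxx.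
Qed.

Definition star_bag (i : 'I_n) : {set 'I_(nv G)} :=
  [set v : 'I_n.+2 | (v < 2) || (v == i.+2 :> nat)].

Lemma adj_gadget (u v : 'I_n.+2) : adj (G := G) u v ->
  exists i : 'I_n, (u \in star_bag i) && (v \in star_bag i).
Proof.
pose c0 := Ordinal n_gt0.
suff H (e : 'I_(n.*2).+1) : exists i : 'I_n,
    ((gends_ffun n e).1 \in star_bag i) && ((gends_ffun n e).2 \in star_bag i).
  case/existsP => e /orP[] /eqP eE; have [i] := H e; rewrite -[gends_ffun n e]/(ends G e) eE => h;
    exists i => //; by rewrite andbC.
case: e => [[|k] ltk]; first by exists c0; rewrite !inE gends1 gends2.
have ltkn : k./2 < n by lia.
by exists (Ordinal ltkn); rewrite !inE gends1 gends2 /= eqxx andbT; case: odd.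
Qed.

Lemma star_connected v i j : v \in star_bag i -> v \in star_bag j ->
  connect [rel x y | [&& star x y, v \in star_bag x & v \in star_bag y]] i j.
Proof.
rewrite !inE; case: (ltnP v 2) => /= lt2; last first.
  by move=> /eqP-> /eqP[]/val_inj->.
move=> _ _; have [_ _ _ c _] := star_is_tree; have := c i j.
by apply: connect_sub => x y sxy; apply: connect1; rewrite /= sxy !inE lt2.
Qed.

Lemma star_vertex (v : 'I_n.+2) : exists i : 'I_n, v \in star_bag i.
Proof.
case: v => [[|[|k]] ltk]; try by exists (Ordinal n_gt0); rewrite inE.
by exists (Ordinal (ltk : k < n)); rewrite inE /= eqxx.
Qed.

Definition star_decomposition : tree_decomposition (@adj G) :=
  TreeDecomposition star_is_tree star_vertex adj_gadget star_connected.

Theorem gadget_treewidth : has_treewidth G 2.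
Proof.
have lower (D : tree_decomposition (@adj G)) : 2 <= td_width D.
  (* Edges 0, 1 and 2 form the triangle of the two hubs and item 0, which exists because [n] is
     positive. *)
  have le2 : 1 < n.*2.+1 by lia.
  have le3 : 2 < n.*2.+1 by lia.
  have adjE (e : 'I_(n.*2).+1) : adj (G := G) (gends_ffun n e).1 (gends_ffun n e).2.
    by apply/existsP; exists e; rewrite -surjective_pairing eqxx.
  have := adjE ord0; have := adjE (Ordinal le2); have := adjE (Ordinal le3).
  rewrite !ffunE /= => h3 h2 h1.
  apply: triangle_treewidth h1 h3 h2.
  by rewrite /= !inE -!val_eqE /= !inordK // ltnS.
split=> //; exists star_decomposition; apply/eqP; rewrite eqn_leq lower andbT.
rewrite /td_width -subn1 leq_subLR; apply/bigmax_leqP => i _ /=.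
have sub : star_bag i \subset [:: inord 0; inord 1; inord i.+2 : 'I_n.+2].
  apply/subsetP => v; rewrite !inE -!val_eqE /= !inordK // ?ltnS //.
  by case: (val v) => [|[|]].
by apply: leq_trans (subset_leq_card sub) (card_size _).
Qed.

End GadgetTreewidth.

(** * Tilings as subset sums *)

Lemma digits_inj b Q (f g : nat -> nat) :
  (forall q, q < Q -> f q < b) -> (forall q, q < Q -> g q < b) ->
  \sum_(q < Q) b ^ q * f q = \sum_(q < Q) b ^ q * g q ->
  forall q, q < Q -> f q = g q.
Proof.
elim: Q f g => [|Q IH] f g fb gb //.
rewrite !big_ord_recl !mul1n => e.
have shift (h : nat -> nat) : \sum_(i < Q) b ^ lift ord0 i * h (lift ord0 i) =
    b * \sum_(i < Q) b ^ i * h i.+1.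
  by rewrite big_distrr; apply: eq_bigr => i _; rewrite /= expnS mulnA.
move: e; rewrite !shift /= => e.
have f0 := fb 0 isT; have g0 := gb 0 isT.
have e0 : f 0 = g 0.
  have := congr1 (modn^~ b) e.
  by rewrite ![b * _]mulnC !(addnC _ (_ * b)) !modnMDl !modn_small.
have b0 : 0 < b by lia.
move: e; rewrite e0 => /addnI /eqP; rewrite eqn_pmul2l // => /eqP e.
case=> [|q] //; rewrite ltnS => ltq.
by apply: (IH (fun q => f q.+1) (fun q => g q.+1) _ _ e) => // r ltr; [apply: (fb r.+1)|apply: (gb r.+1)].
Qed.

Definition padbits (w b : nat) : seq bool := mkseq (fun i => odd (b %/ 2 ^ i)) w.

Lemma padbitsS w b : padbits w.+1 b = odd b :: padbits w b./2.
Proof.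
rewrite /padbits /mkseq /= divn1 -[1]/(1 + 0) iotaDl -map_comp; congr (_ :: _).
by apply: eq_map => i /=; rewrite expnS divnMA divn2.
Qed.

Lemma bits_pad w b v : b < 2 ^ w -> 0 < v ->
  bits (b + 2 ^ w * v) = padbits w b ++ bits v.
Proof.
move=> + v_gt0; elim: w b => [|w IH] b; first by case: b => // _; rewrite mul1n.
rewrite expnS => ltb; have bE := odd_double_half b.
have -> : b + 2 * 2 ^ w * v = odd b + (b./2 + 2 ^ w * v).*2.
  by rewrite doubleD addnA bE -mul2n mulnA.
have w_gt0 : 0 < 2 ^ w by rewrite expn_gt0.
rewrite bits_double; last by nia.
by rewrite IH ?padbitsS //; lia.
Qed.

Definition bval (b : nat) (bs : seq nat) : nat := foldr (fun d v => d + b * v) 0 bs.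

Lemma bval_gt0 b bs d : 0 < b -> 0 < d -> 0 < bval b (rcons bs d).
Proof. by move=> b0 d0; elim: bs => [|e bs IH] /=; nia. Qed.

(** In a base that is a power of two, an expansion is printed by concatenating its digits, padded to
    width [w]. The leading digit is kept apart: it must be positive and unpadded, as [bits] has no
    leading zeros. *)
Lemma bits_bval w bs d : all (fun c => c < 2 ^ w) bs -> 0 < d ->
  bits (bval (2 ^ w) (rcons bs d)) = flatten (map (padbits w) bs) ++ bits d.
Proof.
move=> + d0; elim: bs => [|c bs IH] /=; first by rewrite muln0 addn0.
move=> /andP[ltc /IH IHe]; rewrite bits_pad ?IHe ?catA //.
by apply: bval_gt0; rewrite ?expn_gt0.
Qed.

Lemma bval_mkseq b f Q : bval b (mkseq f Q) = \sum_(q < Q) b ^ q * f q.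
Proof.
rewrite /mkseq; elim: Q f => [|Q IH] f; first by rewrite big_ord0.
rewrite big_ord_recl mul1n /= -[1]/(1 + 0) iotaDl -map_comp; congr (_ + _).
rewrite (IH (f \o addn 1)) big_distrr; apply: eq_bigr => i _.
by rewrite /= expnS mulnA.
Qed.

Lemma bval_cat b s t : bval b (s ++ t) = bval b s + b ^ size s * bval b t.
Proof.
elim: s => [|c s IH] /=; first by rewrite mul1n.
by rewrite IH expnS mulnDr addnA mulnA.
Qed.

Lemma bval_nseq0 b k : bval b (nseq k 0) = 0.
Proof. by elim: k => //= k ->; rewrite muln0. Qed.

Lemma sum_eq_index P (q : nat) (F : nat -> nat) :
  \sum_(p < P) (q == p :> nat) * F p = (q < P) * F q.
Proof.
case: ltnP => [ltq|le_q]; last first.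
  rewrite big1 // => p _; case: eqP => // e.
  by have := ltn_ord p; rewrite -e ltnNge le_q.
rewrite (bigD1 (Ordinal ltq)) //= eqxx big1 ?addn0 // => p.
by rewrite -val_eqE /= eq_sym => /negbTE->.
Qed.

Lemma sum_mul_split P t (F : nat -> nat) :
  \sum_(j < P * t) F j = \sum_(p < P) \sum_(k < t) F (p * t + k).
Proof.
elim: P => [|P IH]; first by rewrite !big_ord0.
by rewrite mulSn addnC big_split_ord IH big_ord_recr.
Qed.

Section Tiling.
Variables (tile hcol vcol : finType).
Variables (left right : tile -> hcol) (bot top : tile -> vcol).
Variables (wall : hcol) (init fin : nat -> vcol).

(* Cells are numbered along a helix: the cell above [p] is [p + N]. *)
Variables (N P : nat).

(** Horizontal matching also links the end of a row to the beginning of the next, so that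
    horizontally only the two ends of the helix are treated apart. *)
Definition tiling (sigma : nat -> tile) :=
  [/\ left (sigma 0) = wall /\ right (sigma P.-1) = wall,
      forall q, q.+1 < P -> right (sigma q) = left (sigma q.+1),
      forall q, q < N -> bot (sigma q) = init q,
      forall q, q + N < P -> top (sigma q) = bot (sigma (q + N)) &
      forall j, j < N -> top (sigma (P - N + j)) = fin j].

Definition ntiles := #|tile|.
Definition hsize := #|hcol|.+1.
Definition vsize := #|vcol|.+1.

(** Codes start at 1 so that a code and a complement are both positive; they sum to [hsize] exactly
    when they belong to the same color. *)
Definition hcode (c : hcol) : nat := (enum_rank c).+1.
Definition vcode (c : vcol) : nat := (enum_rank c).+1.
Definition hcompl c := hsize - hcode c.
Definition vcompl c := vsize - vcode c.

Lemma hcode_bound c : 0 < hcode c < hsize.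
Proof. by rewrite /hcode /hsize !ltnS /= ltn_ord. Qed.

Lemma vcode_bound c : 0 < vcode c < vsize.
Proof. by rewrite /vcode /vsize !ltnS /= ltn_ord. Qed.

Lemma hcompl_bound c : 0 < hcompl c < hsize.
Proof. by have := hcode_bound c; rewrite /hcompl; lia. Qed.

Lemma vcompl_bound c : 0 < vcompl c < vsize.
Proof. by have := vcode_bound c; rewrite /vcompl; lia. Qed.

Lemma hcode_inj c d : hcode c = hcode d -> c = d.
Proof. by case=> /ord_inj/enum_rank_inj. Qed.

Lemma vcode_inj c d : vcode c = vcode d -> c = d.
Proof. by case=> /ord_inj/enum_rank_inj. Qed.

Lemma hcompl_inj c d : hcompl c = hcompl d -> c = d.
Proof.
move=> e; apply: hcode_inj; move: e.
by have := hcode_bound c; have := hcode_bound d; rewrite /hcompl; lia.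
Qed.

Lemma vcompl_inj c d : vcompl c = vcompl d -> c = d.
Proof.
move=> e; apply: vcode_inj; move: e.
by have := vcode_bound c; have := vcode_bound d; rewrite /vcompl; lia.
Qed.

Lemma hcompl_eq c d : hcompl c + hcode d = hsize <-> d = c.
Proof.
have := hcode_bound c; have := hcode_bound d; rewrite /hcompl => ? ?.
by split=> [e|->]; [apply: hcode_inj|]; lia.
Qed.

Lemma vcompl_eq c d : vcompl c + vcode d = vsize <-> d = c.
Proof.
have := vcode_bound c; have := vcode_bound d; rewrite /vcompl => ? ?.
by split=> [e|->]; [apply: vcode_inj|]; lia.
Qed.

(** A bound on all digit sums, even with all tiles selected everywhere: a digit receives at most two
    contributions per tile, each below [hsize] or [vsize]. It serves as an exponent because
    [2 ^ width] exceeds [width], which spares a logarithm. *)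
Definition width := ntiles * (2 * (hsize + vsize)).
Definition base := 2 ^ width.
(** Three digits packed into one digit of base [bbase]: the number of tiles at a position, the
    horizontal sum and the vertical sum. *)
Definition block d0 d1 d2 := d0 + base * (d1 + base * d2).
Definition bbase := 2 ^ (3 * width).

Lemma base_gt : width < base. Proof. exact: ltn_expl. Qed.

Lemma bbaseE : bbase = base * (base * base).
Proof. by rewrite /bbase mulnC expnM /base !expnS expn0 muln1. Qed.

Lemma block_lt d0 d1 d2 : d0 < base -> d1 < base -> d2 < base ->
  block d0 d1 d2 < bbase.
Proof.
rewrite bbaseE /block => h0 h1 h2.
have h3 : d1 + base * d2 < base * base.
  by apply: (@leq_trans (base * d2.+1)); [rewrite mulnS|rewrite leq_mul2l h2 orbT]; lia.
by apply: (@leq_trans (base * (d1 + base * d2).+1)); 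
  [rewrite mulnS|rewrite leq_mul2l h3 orbT]; lia.
Qed.

Lemma block_inj d0 d1 d2 e0 e1 e2 : d0 < base -> d1 < base -> d2 < base ->
  e0 < base -> e1 < base -> e2 < base ->
  block d0 d1 d2 = block e0 e1 e2 -> [/\ d0 = e0, d1 = e1 & d2 = e2].
Proof.
move=> d0b d1b d2b e0b e1b e2b; have b0 : 0 < base by lia.
have step x y x' y' : x < base -> x' < base ->
    x + base * y = x' + base * y' -> x = x' /\ y = y'.
  move=> xb xb' e; have xx : x = x'.
    have := congr1 (modn^~ base) e.
    by rewrite ![base * _]mulnC !(addnC _ (_ * base)) !modnMDl !modn_small.
  by move: e; rewrite xx => /addnI /eqP; rewrite eqn_pmul2l // => /eqP.
by move=> /(step _ _ _ _ d0b e0b)[-> /(step _ _ _ _ d1b e1b)[-> ->]].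
Qed.

Lemma leq_block d0 d1 d2 e0 e1 e2 : d0 <= e0 -> d1 <= e1 -> d2 <= e2 ->
  block d0 d1 d2 <= block e0 e1 e2.
Proof. by move=> h0 h1 h2; rewrite !(leq_add, leq_mul). Qed.

(** The item of tile [s] at position [p] counts 1 and adds its left and bottom complements in block
    [p]; its right code goes to block [p.+1] and its top code to block [p + N], where they meet the
    complements of the neighbours. *)
Definition item_block0 s := block 1 (hcompl (left s)) (vcompl (bot s)).
Definition item_block1 s := block 0 (hcode (right s)) 0.
Definition item_block2 s := block 0 0 (vcode (top s)).

Definition item_blocks p s : seq nat :=
  nseq p 0 ++ item_block0 s :: item_block1 s :: nseq (N - 2) 0.

Definition item p s := bval bbase (rcons (item_blocks p s) (item_block2 s)).

Lemma item_gt0 p s : 0 < item p s.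
Proof.
apply: bval_gt0; first by rewrite expn_gt0.
rewrite /item_block2 /block; have b0 : 0 < base by rewrite expn_gt0.
by have := vcode_bound (top s); nia.
Qed.

Definition digit0 (p : nat) (s : tile) (q : nat) : nat := q == p.
Definition digit1 (p : nat) s (q : nat) := (q == p) * hcompl (left s) + (q == p.+1) * hcode (right s).
Definition digit2 (p : nat) s (q : nat) := (q == p) * vcompl (bot s) + (q == p + N) * vcode (top s).

(** The tops of the last row fall into [N] further blocks beyond the positions. *)
Definition Q := P + N.

Hypotheses (N_gt1 : 1 < N) (NP : N <= P).

Lemma itemE p s : p < P ->
  item p s = \sum_(q < Q) bbase ^ q * block (digit0 p s q) (digit1 p s q) (digit2 p s q).
Proof.
move=> ltp.
have -> : item p s = bbase ^ p * item_block0 s +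
    bbase ^ p.+1 * item_block1 s + bbase ^ (p + N) * item_block2 s.
  rewrite /item /item_blocks -cats1 -catA bval_cat bval_nseq0 size_nseq add0n.
  rewrite /= bval_cat bval_nseq0 size_nseq /= muln0 addn0 add0n.
  have -> : p + N = p + (N - 2).+2 by lia.
  by rewrite expnD !expnS; nia.
have dE q : bbase ^ q * block (digit0 p s q) (digit1 p s q) (digit2 p s q) =
    (p == q) * (bbase ^ q * item_block0 s) +
    (p.+1 == q) * (bbase ^ q * item_block1 s) +
    (p + N == q) * (bbase ^ q * item_block2 s).
  rewrite /digit0 /digit1 /digit2 /item_block0 /item_block1 /item_block2 /block.
  rewrite ![q == _]eq_sym; do 3 case: eqP => _; nia.
under eq_bigr => q _ do rewrite dE.
rewrite !big_split /= (sum_eq_index Q p (fun q => bbase ^ q * _)).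
rewrite (sum_eq_index Q p.+1 (fun q => bbase ^ q * _)).
rewrite (sum_eq_index Q (p + N) (fun q => bbase ^ q * _)).
by rewrite (_ : p < Q) 1?(_ : p.+1 < Q) 1?(_ : p + N < Q) ?mul1n // /Q; lia.
Qed.

(** An inner block asks for one tile and, in both directions, for a code plus its own complement.
    Where a neighbour is missing, a single complement or code remains, that of the wall or of the
    prescribed boundary color. *)
Definition tgt0 (q : nat) : nat := q < P.
Definition tgt1 (q : nat) := if q == 0 then hcompl wall else
  if q < P then hsize else if q == P then hcode wall else 0.
Definition tgt2 (q : nat) := if q < N then vcompl (init q) else
  if q < P then vsize else vcode (fin (q - P)).
Definition target_block q := block (tgt0 q) (tgt1 q) (tgt2 q).
Definition target := bval bbase (mkseq target_block Q).

Implicit Types sel : nat -> tile -> bool.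

Definition selected sel (f : tile -> nat) (p : nat) := \sum_s sel p s * f s.

Definition dig0 sel (q : nat) := (q < P) * selected sel (fun _ => 1) q.
Definition dig1 sel (q : nat) := (q < P) * selected sel (hcompl \o left) q +
  (0 < q <= P) * selected sel (hcode \o right) q.-1.
Definition dig2 sel (q : nat) := (q < P) * selected sel (vcompl \o bot) q +
  (N <= q < Q) * selected sel (vcode \o top) (q - N).

Lemma block_sum (I : finType) (c d0 d1 d2 : I -> nat) :
  \sum_i c i * block (d0 i) (d1 i) (d2 i) =
  block (\sum_i c i * d0 i) (\sum_i c i * d1 i) (\sum_i c i * d2 i).
Proof.
have e i : c i * block (d0 i) (d1 i) (d2 i) =
    c i * d0 i + (base * (c i * d1 i) + base * (base * (c i * d2 i))).
  by rewrite /block; nia.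
under eq_bigr => i _ do rewrite e.
by rewrite !big_split /= -!big_distrr /= /block mulnDr.
Qed.

Lemma block_sum1 (I : finType) (d0 d1 d2 : I -> nat) :
  \sum_i block (d0 i) (d1 i) (d2 i) =
  block (\sum_i d0 i) (\sum_i d1 i) (\sum_i d2 i).
Proof.
have e (f : I -> nat) : \sum_i f i = \sum_i 1 * f i.
  by apply: eq_bigr => i _; rewrite mul1n.
rewrite (e d0) (e d1) (e d2) (e (fun i => block (d0 i) (d1 i) (d2 i))).
exact: block_sum.
Qed.

Lemma selected_le sel f p b : (forall s, f s <= b) -> selected sel f p <= ntiles * b.
Proof.
move=> fb; rewrite -sum_nat_const; apply: leq_sum => s _.
by apply: leq_trans (fb s); case: (sel p s); rewrite ?mul1n.
Qed.

(** The sums are exchanged and the contributions to block [q] collected. That the coefficients are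
    genuine digits is a separate matter, settled by [dig_lt]. *)
Lemma sum_items sel : \sum_(p < P) \sum_s sel p s * item p s =
  \sum_(q < Q) bbase ^ q * block (dig0 sel q) (dig1 sel q) (dig2 sel q).
Proof.
have sel_const (x : nat) (g : tile -> nat) p :
    \sum_s sel p s * (x * g s) = x * selected sel g p.
  by rewrite big_distrr; apply: eq_bigr => s _ /=; rewrite mulnCA.
have e p : p < P -> \sum_s sel p s * item p s = \sum_(q < Q) bbase ^ q *
    block (\sum_s sel p s * digit0 p s q) (\sum_s sel p s * digit1 p s q)
          (\sum_s sel p s * digit2 p s q).
  move=> ltp; under eq_bigr => s _ do rewrite itemE // big_distrr /=.
  rewrite exchange_big; apply: eq_bigr => q _ /=.
  rewrite -block_sum big_distrr; apply: eq_bigr => s _ /=.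
  by rewrite mulnCA.
rewrite (eq_bigr _ (fun p _ => e (nat_of_ord p) (ltn_ord p))) exchange_big /=.
apply: eq_bigr => q _; rewrite -big_distrr /=; congr (_ * _).
rewrite block_sum1; congr block.
- rewrite /digit0 /dig0 -(sum_eq_index P q (selected sel (fun _ => 1))).
  by apply: eq_bigr => p _; rewrite -sel_const; apply: eq_bigr => s _; rewrite muln1.
- rewrite /dig1 -(sum_eq_index P q (selected sel (hcompl \o left))).
  have -> : (0 < q <= P) * selected sel (hcode \o right) q.-1 =
      \sum_(p < P) (q == p.+1 :> nat) * selected sel (hcode \o right) p.
    case: (nat_of_ord q) => [|q']; first by rewrite big1.
    by rewrite -sum_eq_index.
  rewrite -big_split; apply: eq_bigr => p _ /=; rewrite -!sel_const -big_split.
  by apply: eq_bigr => s _; rewrite /digit1 mulnDr.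
- rewrite /dig2 -(sum_eq_index P q (selected sel (vcompl \o bot))).
  have -> : (N <= q < Q) * selected sel (vcode \o top) (q - N) =
      \sum_(p < P) (q == p + N :> nat) * selected sel (vcode \o top) p.
    case: (leqP N q) => [leNq|ltqN]; last first.
      rewrite big1 // => p _; case: eqP => // e'.
      by have := leq_addl p N; rewrite -e' leqNgt ltqN.
    have -> : (q < Q) = (q - N < P) by rewrite ltn_subLR // addnC.
    rewrite -sum_eq_index; apply: eq_bigr => p _; congr (_ * _).
    by rewrite -[in RHS](subnK leNq) eqn_add2r.
  rewrite -big_split; apply: eq_bigr => p _ /=; rewrite -!sel_const -big_split.
  by apply: eq_bigr => s _; rewrite /digit2 mulnDr.
Qed.

Hypotheses (hsize_le : hsize <= ntiles) (vsize_le : vsize <= ntiles).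

Lemma ntiles_gt0 : 0 < ntiles.
Proof. exact: leq_trans hsize_le. Qed.

Lemma leq_width1 x : x <= ntiles * hsize + ntiles * hsize -> x < base.
Proof.
move=> h; apply: leq_ltn_trans h (leq_ltn_trans _ base_gt).
by rewrite /width; nia.
Qed.

Lemma leq_width2 x : x <= ntiles * vsize + ntiles * vsize -> x < base.
Proof.
move=> h; apply: leq_ltn_trans h (leq_ltn_trans _ base_gt).
by rewrite /width; nia.
Qed.

(** No carries: the sums stay below the base for every choice of tiles, so that a sum and the target
    can be compared digit by digit. *)
Lemma dig_lt sel q : [/\ dig0 sel q < base, dig1 sel q < base & dig2 sel q < base].
Proof.
have b (c : bool) x : c * x <= x by case: c; rewrite ?mul1n.
have h f := selected_le sel (f := f); split.
- apply: leq_width1; apply: leq_trans (b _ _) _.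
  apply: leq_trans (h (fun _ => 1) q 1 _) _ => //.
  by rewrite /hsize; nia.
- apply: leq_width1; apply: leq_add; apply: leq_trans (b _ _) (h _ _ _ _) => s /=.
    by have := hcompl_bound (left s); lia.
  by have := hcode_bound (right s); lia.
- apply: leq_width2; apply: leq_add; apply: leq_trans (b _ _) (h _ _ _ _) => s /=.
    by have := vcompl_bound (bot s); lia.
  by have := vcode_bound (top s); lia.
Qed.

Lemma tgt_lt q : [/\ tgt0 q < base, tgt1 q < base & tgt2 q < base].
Proof.
have n0 := ntiles_gt0; split.
- by apply: leq_width1; rewrite /tgt0 /hsize; case: (q < P); nia.
- apply: leq_width1; rewrite /tgt1.
  have := hcode_bound wall; have := hcompl_bound wall.
  by do 3?case: ifP => _; nia.
- apply: leq_width2; rewrite /tgt2.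
  have := vcompl_bound (init q); have := vcode_bound (fin (q - P)).
  by do 2?case: ifP => _; nia.
Qed.

Lemma sum_items_target sel :
  \sum_(p < P) \sum_s sel p s * item p s = target <->
  forall q, q < Q -> [/\ dig0 sel q = tgt0 q, dig1 sel q = tgt1 q & dig2 sel q = tgt2 q].
Proof.
rewrite sum_items /target bval_mkseq; split=> [e q ltq|H].
  have [d0 d1 d2] := dig_lt sel q; have [t0 t1 t2] := tgt_lt q.
  apply: block_inj => //.
  apply: (@digits_inj bbase Q (fun q => block (dig0 sel q) (dig1 sel q) (dig2 sel q))
            target_block _ _ e q ltq) => r _; apply: block_lt.
  - by have [] := dig_lt sel r.
  - by have [] := dig_lt sel r.
  - by have [] := dig_lt sel r.
  - by have [] := tgt_lt r.
  - by have [] := tgt_lt r.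
  - by have [] := tgt_lt r.
by apply: eq_bigr => q _; have [-> -> ->] := H q (ltn_ord q).
Qed.

Definition picks sel (sigma : nat -> tile) :=
  forall q f, q < P -> selected sel f q = f (sigma q).

(** A count digit equal to 1 leaves exactly one selected tile; [t0] is only a default. *)
Lemma picks_of_digits sel : (forall q, q < P -> dig0 sel q = 1) ->
  exists sigma, picks sel sigma.
Proof.
move=> H; have [t0 _] : exists t0 : tile, t0 \in tile by apply/card_gt0P/ntiles_gt0.
exists (fun q => odflt t0 [pick s | sel q s]) => q f ltq.
have := H q ltq; rewrite /dig0 ltq mul1n /selected /=.
case: (pickP (sel q)) => [s sq|none] e /=; last first.
  by move: e; rewrite big1 // => s _; rewrite none.
rewrite (bigD1 s) //= sq mul1n big1 ?addn0 // => s' ne.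
move: e; rewrite (bigD1 s) //= sq mul1n (bigD1 s') //=.
by case: (sel q s').
Qed.

(** With one tile per position, an inner digit is a complement plus a code and takes its target
    value exactly when the two colors agree. *)
Lemma picks_tiling sel sigma : picks sel sigma ->
  (forall q, q < Q ->
     [/\ dig0 sel q = tgt0 q, dig1 sel q = tgt1 q & dig2 sel q = tgt2 q]) <->
  tiling sigma.
Proof.
move=> pk; have P0 : 0 < P by lia.
have QP q : q < P -> q < Q by rewrite /Q; lia.
have d1E q : dig1 sel q = (if q < P then hcompl (left (sigma q)) else 0) +
    (if 0 < q <= P then hcode (right (sigma q.-1)) else 0).
  rewrite /dig1; congr (_ + _); case: ifP => h; rewrite // mul1n pk //.
  by move: h; lia.
have d2E q : q < Q -> dig2 sel q = (if q < P then vcompl (bot (sigma q)) else 0) +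
    (if N <= q then vcode (top (sigma (q - N))) else 0).
  move=> ltq; rewrite /dig2 ltq andbT; congr (_ + _); case: ifP => h; rewrite // mul1n pk //.
  by move: ltq h; rewrite /Q; lia.
split=> [H|[[t0 tP] th ti tv tf] q ltq].
  split.
  - split; have := H _ (QP _ P0); rewrite d1E P0 addn0 => -[_]. 
      by rewrite /tgt1 /= => /hcompl_inj.
    have ltPQ : P < Q by rewrite /Q; lia.
    have [_] := H _ ltPQ; rewrite d1E ltnn P0 leqnn /tgt1 ltnn eqxx gtn_eqF //.
    by rewrite add0n => /hcode_inj.
  - move=> q ltq; have [_ e _] := H _ (QP _ ltq).
    move: e; rewrite d1E /tgt1 ltq /= ltnW //.
    by move/hcompl_eq.
  - move=> q ltq; have ltqP : q < P by lia.
    have [_ _] := H _ (QP _ ltqP).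
    rewrite d2E ?QP // ltqP /tgt2 ltq leqNgt ltq addn0.
    exact: vcompl_inj.
  - move=> q ltq; have [_ _] := H _ (QP _ ltq).
    rewrite d2E ?QP // ltq /tgt2 ltq leq_addl ltnNge leq_addl /= addnK.
    by move/vcompl_eq.
  - move=> j ltj; have ltq : P + j < Q by rewrite /Q ltn_add2l.
    have [_ _] := H _ ltq.
    rewrite d2E // /tgt2 (_ : (P + j < P) = false) 1?(_ : (P + j < N) = false)
      1?(_ : N <= P + j) ?add0n; try lia.
    rewrite (_ : P + j - N = P - N + j) 1?(_ : P + j - P = j); try lia.
    exact: vcode_inj.
split.
- by rewrite /dig0 /tgt0; case: (ltnP q P) => h; rewrite ?mul1n // pk.
- rewrite d1E /tgt1; case: q ltq => [|q] ltq /=; first by rewrite P0 t0 addn0.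
  case: (ltngtP q.+1 P) => h.
  + by apply/hcompl_eq/th.
  + by [].
  + by rewrite add0n -tP -h.
- rewrite d2E // /tgt2; case: (ltnP q N) => h.
    by rewrite ifT ?addn0 ?ti //; lia.
  case: ifP => h'.
    by apply/vcompl_eq; rewrite tv subnK.
  rewrite add0n -tf; last by move: ltq; rewrite /Q; lia.
  by congr (vcode (top (sigma _))); move: h'; lia.
Qed.

Theorem tiling_sum :
  (exists sel, \sum_(p < P) \sum_s sel p s * item p s = target) <->
  exists sigma, tiling sigma.
Proof.
split=> [[sel /sum_items_target H]|[sigma T]].
  have [|sigma pk] := picks_of_digits (sel := sel).
    move=> q ltq; have [|-> _ _] := H q; first by rewrite /Q ltn_addr.
    by rewrite /tgt0 ltq.
  by exists sigma; apply/(picks_tiling pk).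
pose sel p s := s == sigma p; exists sel; apply: (sum_items_target sel).2.
apply: (picks_tiling (sel := sel) _).2 T => q f _.
by rewrite /selected (bigD1 (sigma q)) //= /sel eqxx mul1n big1 ?addn0 // => s /negbTE->.
Qed.

Definition hl_total := \sum_s hcompl (left s).
Definition hr_total := \sum_s hcode (right s).
Definition vb_total := \sum_s vcompl (bot s).
Definition vt_total := \sum_s vcode (top s).

Definition tot0 (q : nat) := (q < P) * ntiles.
Definition tot1 (q : nat) := (q < P) * hl_total + (0 < q <= P) * hr_total.
Definition tot2 (q : nat) := (q < P) * vb_total + (N <= q < Q) * vt_total.
(** What the sum of all items leaves when the target is removed, computed block by block; this
    number becomes the inflow of hub 0. *)
Definition rest_block q := block (tot0 q) (tot1 q) (tot2 q) - target_block q.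
Definition rest := bval bbase (mkseq rest_block Q).

Lemma total_ge f : (forall s, 0 < f s) -> ntiles <= \sum_(s : tile) f s.
Proof.
move=> f0; rewrite /ntiles -sum1_card; exact: leq_sum.
Qed.

(** Every code and complement is positive, so a total over all tiles is at least [ntiles], hence at
    least [hsize] and [vsize], which bound the target digits. This is where the tiles have to
    outnumber the colors. *)
Lemma target_block_le q : q < Q ->
  target_block q <= block (tot0 q) (tot1 q) (tot2 q) /\
  (q = Q.-1 -> target_block q < block (tot0 q) (tot1 q) (tot2 q)).
Proof.
move=> ltq; have n0 := ntiles_gt0.
have hl : ntiles <= hl_total by apply: total_ge => s; case/andP: (hcompl_bound (left s)).
have hr : ntiles <= hr_total by apply: total_ge => s; case/andP: (hcode_bound (right s)).
have vb : ntiles <= vb_total by apply: total_ge => s; case/andP: (vcompl_bound (bot s)).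
have vt : ntiles <= vt_total by apply: total_ge => s; case/andP: (vcode_bound (top s)).
have le0 : tgt0 q <= tot0 q by rewrite /tgt0 /tot0; case: (q < P); lia.
have le1 : tgt1 q <= tot1 q.
  have := hcompl_bound wall; have := hcode_bound wall; have P0 : 0 < P by lia.
  rewrite /tgt1 /tot1; case: q {ltq le0} => [|q] /=; first by rewrite P0; lia.
  move=> hc hw; case: (ltngtP q.+1 P) => h /=.
  - by lia.
  - by [].
  - by lia.
have le2 : tgt2 q <= tot2 q /\ (P <= q -> tgt2 q < tot2 q).
  have := vcompl_bound (init q); have := vcode_bound (fin (q - P)).
  rewrite /tgt2 /tot2 ltq andbT.
  case: (ltnP q N) => hN; case: (ltnP q P) => hP; lia.
have b0 : 0 < base by rewrite expn_gt0.
split=> [|qE]; first by apply: leq_block => //; case: le2.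
have lt2 : tgt2 q < tot2 q by apply: le2.2; rewrite qE /Q; lia.
by rewrite /target_block /block; nia.
Qed.

Lemma rest_target : rest + target = \sum_(p < P) \sum_s item p s.
Proof.
have -> : \sum_(p < P) \sum_s item p s =
    \sum_(p < P) \sum_s true * item p s.
  by apply: eq_bigr => p _; apply: eq_bigr => s _; rewrite mul1n.
rewrite (sum_items (fun _ _ => true)) /rest /target !bval_mkseq -big_split /=.
have selE f q : selected (fun _ _ => true) f q = \sum_s f s.
  by apply: eq_bigr => s _; rewrite mul1n.
apply: eq_bigr => q _; rewrite -mulnDr; congr (_ * _).
rewrite /rest_block subnK; last by have [] := target_block_le (ltn_ord q).
by rewrite /dig0 /dig1 /dig2 !selE sum1_card.
Qed.

End Tiling.

(** * Computations as tilings *)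

Section Simulation.
Variable M : tm.
Local Notation W := (tm_work M).
Local Notation k := (tm_tapes M).+1.
Local Notation sym := (symbol W).

(** [move] is a plain inductive type without finite type structure, so labels store moves as
    [option bool]. *)
Definition to_move (b : option bool) : move :=
  if b is Some r then (if r then MoveRight else MoveLeft) else Stay.
Definition of_move (m : move) : option bool :=
  match m with MoveLeft => Some false | Stay => None | MoveRight => Some true end.

Lemma of_moveK : cancel of_move to_move. Proof. by case. Qed.

(* A row of the tableau is a configuration: column 0 holds the state and the
   scanned symbols, column [j.+1] the symbols at distance [j.+1] to the left
   and to the right of the scanned cell, on all tapes at once. In column 0 the
   state [None] is an initial state placed before the input, and the content
   [None] is the accepting end of the tableau. *)
Definition head_content : finType := option (option (tm_state M) * {ffun 'I_k -> sym}).
Definition cell_content : finType := {ffun 'I_k -> sym * sym}.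
Definition content : finType := (head_content + cell_content)%type.

(** The action leading from a row to the next, guessed in every tile of the row and carried along by
    the horizontal colors. [None] labels the rows from the accepting configuration on. *)
Definition label : finType :=
  option (tm_state M * {ffun 'I_k -> sym * option bool}).

Definition blank_cell : cell_content := [ffun => (blank, blank)].

Definition cell_of (c : option content) : cell_content :=
  if c is Some (inr g) then g else blank_cell.

(** Columns are numbered by distance from the head, so a move shifts the two sides of a tape by one
    column in opposite directions. The written symbol enters at column 1, whose left neighbour [a]
    is the head column. *)
Definition next (l : label) (a : option content) (b : content)
    (c : option content) : content :=
  match l, b with
  | None, inl _ => inl None
  | None, inr _ => inr blank_cell
  | Some (q, w), inl _ => inl (Some (Some q, [ffun i =>
      match to_move (w i).2 with
      | MoveLeft => (cell_of c i).1
      | Stay => (w i).1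
      | MoveRight => (cell_of c i).2
      end]))
  | Some (q, w), inr f => inr [ffun i =>
      match to_move (w i).2 with
      | MoveLeft => ((cell_of c i).1, if a is Some (inr g) then (g i).2 else (w i).1)
      | Stay => f i
      | MoveRight => (if a is Some (inr g) then (g i).1 else (w i).1, (cell_of c i).2)
      end]
  end.

(** An artificial first step. It lets the tableau start on a blank in front of the input, so that
    column 0 is always the same and every other column depends on one input letter. *)
Definition start_label : label :=
  Some (tm_start M, [ffun i => (blank, if i == ord0 then Some true else None)]).

Definition action_label (x : tm_state M * ('I_k -> sym * move)) :
    tm_state M * {ffun 'I_k -> sym * option bool} :=
  (x.1, [ffun i => ((x.2 i).1, of_move (x.2 i).2)]).

Definition valid (l : label) (b : content) : bool :=
  match b with
  | inr _ => true
  | inl None => l == None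
  | inl (Some (None, _)) => l == start_label
  | inl (Some (Some q, s)) =>
      match l with
      | Some x => x \in map action_label (tm_delta q s)
      | None => nilp (tm_delta q s) && tm_acc q
      end
  end.

Definition is_head (b : content) : bool := if b is inl _ then true else false.

Lemma is_head_next l a b c : is_head (next l a b c) = is_head b.
Proof. by case: l b => [[q w]|] []. Qed.

Definition tile : finType :=
  (label * option content * content * option content)%type.
(** The color of an inner side consists of the label and the contents of both adjacent columns, so
    that each of two neighbouring tiles verifies what the other has guessed. *)
Definition hcolor : finType := option (option (label * content * content)).

Definition tile_label (s : tile) : label := s.1.1.1.
Definition tile_left (s : tile) : option content := s.1.1.2.
Definition tile_bot (s : tile) : content := s.1.2.
Definition tile_right (s : tile) : option content := s.2.
Definition tile_top (s : tile) : content :=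
  next (tile_label s) (tile_left s) (tile_bot s) (tile_right s).

Definition tile_ok (s : tile) : bool :=
  valid (tile_label s) (tile_bot s) && ((tile_left s == None) == is_head (tile_bot s)).

(* [None] is the color of no right side, and [Some None] that of the walls. *)
Definition left_color (s : tile) : hcolor :=
  if tile_ok s then
    Some (omap (fun a => (tile_label s, a, tile_bot s)) (tile_left s))
  else None.
Definition right_color (s : tile) : hcolor :=
  Some (omap (fun c => (tile_label s, tile_bot s, c)) (tile_right s)).

Definition row := nat -> content.

Definition row_left (r : row) (j : nat) : option content :=
  if j is i.+1 then Some (r i) else None.
Definition row_right (N : nat) (r : row) (j : nat) : option content :=
  if j.+1 < N then Some (r j.+1) else None.
Definition next_row (N : nat) (l : label) (r : row) (j : nat) : content :=
  next l (row_left r j) (r j) (row_right N r j).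

Definition tableau (N d : nat) (lam : nat -> label) (rho : nat -> row) :=
  forall t, t < d -> valid (lam t) (rho t 0) /\
    forall j, j < N -> rho t.+1 j = next_row N (lam t) (rho t) j.

Lemma tableau_is_head N d lam rho : tableau N d lam rho ->
  (forall j, j < N -> is_head (rho 0 j) = (j == 0)) ->
  forall t j, t <= d -> j < N -> is_head (rho t j) = (j == 0).
Proof.
move=> T h0; elim=> [|t IH] j td ltj; first exact: h0.
have [_ ->] := T t td; last by [].
by rewrite is_head_next IH // ltnW.
Qed.

Section Tableau.
Variables (N : nat) (init fin : row).
Hypothesis N_gt1 : 1 < N.
Hypothesis init_head : forall j, j < N -> is_head (init j) = (j == 0).

(** The colors do not count columns. But [next] keeps head contents in their column, the initial row
    has one in column 0 only, and [tile_ok] ties them to a missing left neighbour; hence the walls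
    stand exactly at the row ends. *)
Lemma tiling_tableau (sigma : nat -> tile) :
  tiling left_color right_color tile_bot tile_top (Some None) init fin N (N * N) sigma ->
  exists lam rho, [/\ tableau N N lam rho, forall j, j < N -> rho 0 j = init j &
                      forall j, j < N -> rho N j = fin j].
Proof.
move=> [[t0 tP] th ti tv tf].
pose cell t j := sigma (t * N + j).
have N0 : 0 < N by lia.
have lt_cell t j : t < N -> j < N -> t * N + j < N * N by nia.
have ok p : p < N * N -> tile_ok (sigma p).
  case: p => [|p] ltp.
    by move: t0; rewrite /left_color; case: ifP.
  by have := th p ltp; rewrite /left_color /right_color; case: ifP.
exists (fun t => tile_label (cell t 0)).
(* No tile lies in row [N], so it is defined as the prescribed final row. *)
pose rho t j := if t < N then tile_bot (cell t j) else fin j; exists rho.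
have top t j : t < N -> j < N -> tile_top (cell t j) = rho t.+1 j.
  move=> ltt ltj; rewrite /rho /cell; case: ltnP => h.
    by rewrite tv ?(mulSn t) 1?addnAC 1?[N + _]addnC // ; nia.
  have tE : t = N.-1 by lia.
  by rewrite -tf // tE; congr (tile_top (sigma (_ + _))); nia.
have is_head_rho t j : t < N -> j < N -> is_head (rho t j) = (j == 0).
  elim: t j => [|t IH] j ltt ltj.
    by rewrite /rho N0 /cell mul0n add0n ti // init_head.
  have lt' : t < N by lia.
  by rewrite -top // is_head_next -(IH j) // /rho lt'.
have left_none t j : t < N -> j < N -> (tile_left (cell t j) == None) = (j == 0).
  move=> ltt ltj; rewrite -(is_head_rho t j) // /rho ltt.
  by have := ok _ (lt_cell t j ltt ltj) => /andP[_ /eqP].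
have step t j : t < N -> j.+1 < N ->
    [/\ tile_label (cell t j.+1) = tile_label (cell t j),
        tile_left (cell t j.+1) = Some (tile_bot (cell t j)) &
        tile_right (cell t j) = Some (tile_bot (cell t j.+1))].
  move=> ltt ltj; have := left_none t j.+1 ltt ltj.
  have := th (t * N + j); rewrite -addnS => /(_ (lt_cell t j.+1 ltt ltj)).
  rewrite /left_color ok ?lt_cell // /right_color -/(cell t j) -/(cell t j.+1).
  case: (tile_left (cell t j.+1)) => [a|] //=.
  by case: (tile_right (cell t j)) => [c|] //= [-> -> ->].
have lastc t : t < N -> tile_right (cell t N.-1) = None.
  move=> ltt; have := lt_cell t N.-1 ltt; rewrite prednK // => /(_ (leqnn _)) ltp.
  suff: right_color (cell t N.-1) = Some None.
    by rewrite /right_color; case: tile_right.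
  case: (ltnP t.+1 N) => h; last first.
    by rewrite -tP /cell; congr (right_color (sigma _)); nia.
  have e : (t * N + N.-1).+1 = t.+1 * N + 0 by nia.
  rewrite th e; last by apply: lt_cell.
  rewrite /left_color ok ?lt_cell // -/(cell t.+1 0).
  by have /eqP-> : tile_left (cell t.+1 0) == None by rewrite left_none.
have lab t j : t < N -> j < N -> tile_label (cell t j) = tile_label (cell t 0).
  by move=> ltt; elim: j => [|j IH] // ltj; have [-> _ _] := step t j ltt ltj; apply: IH; lia.
split.
- move=> t ltt; split.
    by rewrite /rho ltt; have /andP[] := ok _ (lt_cell t 0 ltt N0).
  move=> j ltj; rewrite -top // /tile_top lab // /next_row.
  have -> : rho t j = tile_bot (cell t j) by rewrite /rho ltt.
  congr next.
    case: j ltj => [|j] ltj /=; last by have [_ -> _] := step t j ltt ltj; rewrite /rho ltt.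
    by apply/eqP; rewrite left_none.
  rewrite /row_right; case: ltnP => h.
    by have [_ _ ->] := step t j ltt h; rewrite /rho ltt.
  have -> : j = N.-1 by lia.
  exact: lastc.
- by move=> j ltj; rewrite /rho N0 /cell ti.
- by move=> j ltj; rewrite /rho ltnn.
Qed.

Lemma tableau_tiling lam rho : tableau N N lam rho ->
  (forall j, j < N -> rho 0 j = init j) -> (forall j, j < N -> rho N j = fin j) ->
  exists sigma,
    tiling left_color right_color tile_bot tile_top (Some None) init fin N (N * N) sigma.
Proof.
move=> T r0 rN; have N0 : 0 < N by lia.
have hd := tableau_is_head T; have {}hd t j : t <= N -> j < N -> is_head (rho t j) = (j == 0).
  by apply: hd => i lti; rewrite r0 // init_head.
pose cell t j : tile := (lam t, row_left (rho t) j, rho t j, row_right N (rho t) j).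
have okc t j : t < N -> j < N -> tile_ok (cell t j).
  move=> ltt ltj; rewrite /tile_ok /cell /tile_label /tile_left /tile_bot /=.
  rewrite hd // 1?ltnW //; case: j ltj => [|j] ltj /=.
    by have [-> _] := T t ltt.
  by have := hd t j.+1 (ltnW ltt) ltj; case: (rho t j.+1).
have dm t j : j < N -> ((t * N + j) %/ N = t) * ((t * N + j) %% N = j).
  by move=> ltj; rewrite divnMDl // divn_small // addn0 modnMDl modn_small.
exists (fun p => cell (p %/ N) (p %% N)).
have top t j : t < N -> j < N -> tile_top (cell t j) = rho t.+1 j.
  by move=> ltt ltj; have [_ ->] := T t ltt.
split.
- split.
    rewrite div0n mod0n /left_color okc //.
  have -> : (N * N).-1 = N.-1 * N + N.-1 by nia.
  have ltN : N.-1 < N by lia.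
  by rewrite !dm // /right_color /cell /tile_right /row_right /= prednK // ltnn.
- move=> p ltp; have ltt : p %/ N < N by rewrite ltn_divLR //; lia.
  have ltj : p %% N < N by rewrite ltn_mod.
  have pE := divn_eq p N; move: (p %/ N) (p %% N) pE ltt ltj => t j -> ltt ltj in ltp *.
  rewrite /right_color /cell /tile_right /row_right /=; case: ltnP => h.
    by rewrite -addnS !dm // /left_color okc.
  have jE : j = N.-1 by lia.
  have -> : (t * N + j).+1 = t.+1 * N + 0 by nia.
  by rewrite !dm // /left_color okc //; nia.
- by move=> q ltq; rewrite divn_small // modn_small // -r0.
- move=> q ltq; have pE := divn_eq q N.
  have ltj : q %% N < N by rewrite ltn_mod.
  move: (q %/ N) (q %% N) pE ltj => t j -> ltj in ltq *.
  have -> : t * N + j + N = t.+1 * N + j by rewrite mulSn; lia.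
  by rewrite !dm // top //; nia.
- move=> j ltj; have -> : N * N - N + j = N.-1 * N + j by nia.
  by rewrite !dm // top ?prednK // ?rN //; lia.
Qed.

End Tableau.
End Simulation.

(* Actions contain functions and have no decidable equality, so that [mapP] does
   not apply to a list of actions. *)
Lemma in_map_witness (A : Type) (T : eqType) (f : A -> T) s y : y \in map f s ->
  exists a, y = f a /\ forall (T' : eqType) (g : A -> T'), g a \in map g s.
Proof.
elim: s => //= b s IH; rewrite inE => /orP[/eqP->|/IH[a [-> h]]].
  by exists b; split=> // T' g; rewrite inE eqxx.
by exists a; split=> // T' g; rewrite inE h orbT.
Qed.

(** * Accepting computations and tableaux *)

Section Acceptance.
Variable M : tm.
Local Notation W := (tm_work M).
Local Notation k := (tm_tapes M).+1.
Local Notation sym := (symbol W).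
Local Notation tapes := ('I_k -> tape W).

Definition rep (q : option (tm_state M)) (T : tapes) : row M := fun j =>
  if j is i.+1 then
    inr [ffun x => (nth blank (T x).1 i, nth blank (T x).2 i.+1)]
  else inl (Some (q, [ffun x => scan (T x)])).

Lemma rep_ext q (T T' : tapes) j : (forall i, eqtape (T i) (T' i)) ->
  rep q T j = rep q T' j.
Proof.
move=> e; case: j => [|j]; rewrite /rep.
  by congr (inl (Some (q, _))); apply/ffunP => i; rewrite !ffunE; apply: eqtape_scan.
by congr inr; apply/ffunP => i; rewrite !ffunE; have [-> _] := e i j; have [_ ->] := e i j.+1.
Qed.

(** Exactly the cells that [N] columns can show: distance at most [N - 1] from the head on either
    side. *)
Definition fits (N : nat) (T : tapes) :=
  forall i, size (T i).1 < N /\ size (T i).2 <= N.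

Definition apply_label (w : {ffun 'I_k -> sym * option bool}) (T : tapes) : tapes :=
  fun i => write_move ((w i).1, to_move (w i).2) (T i).

(** The column after the last one is missing and read as blank, which is correct because the tapes
    fit. *)
Lemma cell_of_rep N q T j i : fits N T -> j < N ->
  cell_of (row_right N (rep q T) j) i = (nth blank (T i).1 j, nth blank (T i).2 j.+1).
Proof.
move=> fT ltj; rewrite /row_right; case: ltnP => h /=; rewrite ffunE //.
by have [h1 h2] := fT i; rewrite !nth_default //; lia.
Qed.

Lemma next_row_rep N q q' w T j : fits N T -> j < N ->
  next_row N (Some (q', w)) (rep q T) j = rep (Some q') (apply_label w T) j.
Proof.
move=> fT ltj; rewrite /next_row /next; case: j ltj => [|j] ltj /=.
  congr (inl (Some (_, _))); apply/ffunP => i.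
  rewrite !ffunE (cell_of_rep _ _ fT ltj) /apply_label.
  by case: (w i) => a [[]|]; case: (T i) => l r; rewrite /scan /= -?nth0 ?nth_behead.
congr inr; apply/ffunP => i; rewrite !ffunE (cell_of_rep _ _ fT ltj) /apply_label.
case: (w i) => a [[]|]; case E: (T i) => [l r] /=; rewrite ?nth_behead //.
  by case: j ltj => [|j] ltj /=; rewrite ?ffunE ?E.
by case: j ltj => [|j] ltj /=; rewrite ?ffunE ?E ?nth_behead.
Qed.

Definition end_row : row M := fun j => if j is _.+1 then inr (blank_cell M) else inl None.

Lemma next_row_end N r : (forall j, j < N -> is_head (r j) = (j == 0)) ->
  forall j, j < N -> next_row N None r j = end_row j.
Proof. by move=> h j /h; rewrite /next_row /next; case: (r j) => a; case: j. Qed.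

Lemma rep_head q T j : is_head (rep q T j) = (j == 0).
Proof. by case: j. Qed.

Lemma end_row_head j : is_head (end_row j) = (j == 0).
Proof. by case: j. Qed.

Variable x : seq bool.
Let n := size x.

(** Each step adds at most one cell to either side. The extra 1 on the right pays for writing on an
    empty list, which creates a cell before the move adds another. *)
Definition bounded_size (tau : nat) (T : tapes) :=
  forall i, size (T i).1 <= tau /\ size (T i).2 <= n.+1 + tau.

Lemma bounded_size_init : bounded_size 0 (tm_init M x).2.
Proof. by move=> i; rewrite ffunE /=; case: eqP => _; rewrite /= ?size_map /n; lia. Qed.

Lemma bounded_size_step tau (c c' : tm_config M) : bounded_size tau c.2 -> tm_step c c' ->
  bounded_size tau.+1 c'.2.
Proof.
rewrite /tm_step => b /in_map_witness[a [-> _]] i; rewrite ffunE /=; have [] := b i.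
case: (a.2 i) => s m; case: (c.2 i) => l r /=.
by case: m; rewrite /= ?size_behead; lia.
Qed.

Lemma bounded_size_path s (c : tm_config M) tau : bounded_size tau c.2 -> path (@tm_step M) c s ->
  bounded_size (tau + size s) (last c s).2.
Proof.
elim: s c tau => [|c' s IH] c tau b /=; first by rewrite addn0.
move=> /andP[st ps]; rewrite addnS -addSn; apply: IH ps.
exact: bounded_size_step st.
Qed.

Variable m : nat.
Hypothesis time_bound : forall s, path (@tm_step M) (tm_init M x) s -> size s <= m.
(** Width and height of the tableau: room for the start step, up to [m] steps and an ending step,
    and for all cells in use. It is also the length of [word x m], which has two marks besides input
    and padding. *)
Let N := n + m + 2.

Lemma fits_bounded tau T : tau <= m -> bounded_size tau T -> fits N T.
Proof. by move=> le_tau b i; have := b i; rewrite /N; lia. Qed.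

(* The leftmost cell of the word on tape 0 is the one that [start_label] erases. *)
Definition start_tapes : tapes :=
  fun i => ([::], if i == ord0 then blank :: map bit x else [::]).

Definition start_row : row M := rep None start_tapes.

Lemma start_fits : fits N start_tapes.
Proof. by move=> i; rewrite /start_tapes /N /n; case: eqP => _; rewrite /= ?size_map; lia. Qed.

Lemma next_row_start j : j < N ->
  next_row N (start_label M) start_row j = rep (Some (tm_start M)) (tm_init M x).2 j.
Proof.
move=> ltj; rewrite /start_label /start_row next_row_rep //; last exact: start_fits.
apply: rep_ext => i; rewrite /apply_label /start_tapes !ffunE.
by case: eqP => _ /= -[|[|a]] //=; rewrite ?nth_nil.
Qed.

Lemma step_label (c c' : tm_config M) : tm_step c c' -> exists w,
  [/\ valid (Some (c'.1, w)) (rep (Some c.1) c.2 0) &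
      forall i, apply_label w c.2 i = c'.2 i].
Proof.
rewrite /tm_step => /in_map_witness[a [-> aP]]; exists [ffun i => ((a.2 i).1, of_move (a.2 i).2)].
split; first exact: aP.
by move=> i; rewrite /apply_label !ffunE of_moveK; case: (a.2 i).
Qed.

Lemma label_step (c : tm_config M) q w : valid (Some (q, w)) (rep (Some c.1) c.2 0) ->
  exists c', [/\ tm_step c c', c'.1 = q & forall i, apply_label w c.2 i = c'.2 i].
Proof.
move=> /in_map_witness[a [[-> ->] aP]].
exists (a.1, [ffun i => write_move (a.2 i) (c.2 i)]); split=> //.
  exact: aP.
by move=> i; rewrite /apply_label !ffunE of_moveK; case: (a.2 i).
Qed.

(** From row 1 on, each label [Some] extends a computation by one step, and its tapes fit because no
    computation is longer than [m]. The last row is no configuration, so [None] must occur, and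
    [valid] then makes the current configuration halting and accepting. *)
Lemma tableau_accepts lam rho : tableau N N lam rho ->
  (forall j, j < N -> rho 0 j = start_row j) ->
  (forall j, j < N -> rho N j = end_row j) -> tm_accepts M x.
Proof.
move=> T r0 rN; have N0 : 0 < N by rewrite /N; lia.
have congr_row (l : label M) (r r' : row M) j : j < N -> (forall i, i < N -> r i = r' i) ->
    next_row N l r j = next_row N l r' j.
  move=> ltj e; rewrite /next_row e //; congr next.
    by case: j ltj => [|j] ltj //=; rewrite e //; lia.
  by rewrite /row_right; case: ltnP => // h; rewrite e.
have H d : forall t s, t + d = N -> t = (size s).+1 ->
    path (@tm_step M) (tm_init M x) s ->
    (forall j, j < N -> rho t j = rep (Some (last (tm_init M x) s).1) (last (tm_init M x) s).2 j) ->
    tm_accepts M x.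
  elim: d => [|d IH] t s td ts ps rt.
    (* Column 0 of the last row would be both a configuration and the end marker. *)
    by have := rt 0 N0; rewrite -[t]addn0 td rN.
  have ltt : t < N by lia.
  have [vt nt] := T t ltt; move: vt nt; rewrite rt //.
  case: (lam t) => [[q w]|] vt nt; last first.
    by case/andP: vt => h a; exists s; split=> //; apply: h.
  have [c' [st qE e]] := label_step vt; rewrite -{}qE in nt.
  apply: (IH t.+1 (rcons s c')).
  - by lia.
  - by rewrite size_rcons ts.
  - by rewrite rcons_path ps.
  move=> j ltj; rewrite last_rcons nt // (congr_row _ _ _ _ ltj rt).
  rewrite next_row_rep //.
    by apply: rep_ext => i; rewrite e.
  apply: (@fits_bounded (size s)); first exact: time_bound.
  exact: bounded_size_path bounded_size_init ps.
have [v0 n0] := T 0 N0.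
apply: (H N.-1 1 [::]) => //; first by lia.
move=> j ltj; rewrite n0 // (congr_row _ _ _ _ ltj r0).
move: v0; rewrite r0 //= => /eqP->; exact: next_row_start.
Qed.

Lemma tableau_cons d (l : label M) (r : row M) (lam : nat -> label M) rho : valid l (r 0) ->
  (forall j, j < N -> rho 0 j = next_row N l r j) -> tableau N d lam rho ->
  tableau N d.+1 (fun t => if t is t'.+1 then lam t' else l)
                 (fun t => if t is t'.+1 then rho t' else r).
Proof. by move=> v e T [|t] ltt; [split|apply: T]. Qed.

Lemma end_tableau d : tableau N d (fun _ => None : label M) (fun _ => end_row).
Proof.
move=> t _; split=> // j ltj; rewrite next_row_end // => i _.
exact: end_row_head.
Qed.

(** The [d] additional end rows fill up the tableau, whose height does not depend on the length of
    the computation. *)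
Lemma path_tableau s (c : tm_config M) tau d : path (@tm_step M) c s -> tm_halted (last c s) ->
  tm_acc (last c s).1 -> bounded_size tau c.2 -> tau + size s <= m ->
  exists lam rho, [/\ tableau N ((size s).+1 + d) lam rho,
    forall j, rho 0 j = rep (Some c.1) c.2 j &
    forall j, rho ((size s).+1 + d) j = end_row j].
Proof.
elim: s c tau => [|c' s IH] c tau /=.
  move=> _ h a b le_tau.
  exists (fun t => if t is t'.+1 then None else None : label M).
  exists (fun t => if t is t'.+1 then end_row else rep (Some c.1) c.2).
  split=> //; apply: (@tableau_cons d None _ (fun _ => None) (fun _ => end_row)).
  - by apply/andP; split; [apply: h|apply: a].
  - by move=> j ltj; rewrite next_row_end // => i _; apply: rep_head.
  - exact: end_tableau.
move=> /andP[st ps] h a b le_m.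
have [||lam [rho [T r0 rN]]] := IH c' tau.+1 ps h a.
- exact: bounded_size_step st.
- by rewrite addSnnS.
have [w [v e]] := step_label st.
exists (fun t => if t is t'.+1 then lam t' else Some (c'.1, w)).
exists (fun t => if t is t'.+1 then rho t' else rep (Some c.1) c.2).
split=> //; apply: tableau_cons => // j ltj.
rewrite r0 next_row_rep //; first by apply: rep_ext => i; rewrite e.
by apply: fits_bounded b; lia.
Qed.

Lemma accepts_tableau : tm_accepts M x ->
  exists lam rho, [/\ tableau N N lam rho, forall j, j < N -> rho 0 j = start_row j &
                      forall j, j < N -> rho N j = end_row j].
Proof.
move=> [s [ps h a]]; have le_m := time_bound ps.
have [|lam [rho [T r0 rN]]] :=
  path_tableau (n + m - size s) ps h a bounded_size_init; first by rewrite add0n.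
have NE : N = ((size s).+1 + (n + m - size s)).+1 by rewrite /N; lia.
exists (fun t => if t is t'.+1 then lam t' else start_label M).
exists (fun t => if t is t'.+1 then rho t' else start_row).
split=> [||j _] //; last by rewrite [in X in X = _]NE rN.
rewrite [X in tableau _ X]NE; apply: tableau_cons => //; first by rewrite /= eqxx.
by move=> j ltj; rewrite r0 next_row_start.
Qed.

Theorem accepts_tiling : tm_accepts M x <-> exists sigma,
  tiling (@left_color M) (@right_color M) (@tile_bot M) (@tile_top M)
    (Some None) start_row end_row N (N * N) sigma.
Proof.
have N_gt1 : 1 < N by rewrite /N; lia.
have hd j : j < N -> is_head (start_row j) = (j == 0) by rewrite rep_head.
split=> [/accepts_tableau[lam [rho [T r0 rN]]]|[sigma T]].
  exact: tableau_tiling T r0 rN.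
have [lam [rho [T' r0 rN]]] := tiling_tableau N_gt1 hd T.
exact: tableau_accepts T' r0 rN.
Qed.

End Acceptance.

(** * Encodings of the gadget *)

Lemma enc_seqE T (E : T -> seq bool) s :
  enc_seq E s = flatten [seq true :: E x | x <- s] ++ [:: false].
Proof. by elim: s => //= x s ->; rewrite catA. Qed.

Lemma codom_ord n T (F : nat -> T) (f : 'I_n -> T) : (forall i, f i = F i) ->
  codom f = mkseq F n.
Proof.
move=> e; rewrite /codom /image_mem (eq_map e) (map_comp F (@nat_of_ord n)).
by rewrite val_enum_ord.
Qed.

Lemma flatten_mkseq_double T (F : nat -> seq T) n :
  flatten (mkseq F n.*2) = flatten (mkseq (fun j => F j.*2 ++ F j.*2.+1) n).
Proof.
elim: n => // n IH; rewrite doubleS !mkseqS -!cats1 !flatten_cat IH /=.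
by rewrite !cats0 catA.
Qed.

Lemma flatten_mkseq_mul T (F : nat -> seq T) a b :
  flatten (mkseq F (a * b)) =
  flatten (mkseq (fun i => flatten (mkseq (fun j => F (i * b + j)) b)) a).
Proof.
elim: a => [|a IH]; first by rewrite mul0n.
rewrite mulSnr mkseqS -cats1 flatten_cat /= cats0 -IH /mkseq iotaD map_cat flatten_cat.
have -> : iota (0 + a * b) b = map (addn (a * b)) (iota 0 b) by rewrite -iotaDl addnC.
by rewrite -map_comp.
Qed.

Lemma mkseq_recl T (F : nat -> T) n : mkseq F n.+1 = F 0 :: mkseq (fun i => F i.+1) n.
Proof. by rewrite /mkseq /= -[1]/(1 + 0) iotaDl -map_comp. Qed.

Section GadgetCode.
Variables (n : nat) (a : nat -> nat) (W R S : nat).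
Hypothesis a_gt0 : forall j, 0 < a j.
Hypothesis W_gt0 : 0 < W.
Let G := @gadget n a W R S a_gt0 W_gt0.

Definition edges_code (j : nat) : seq bool :=
  (true :: enc_nat 0 ++ enc_nat j.+2 ++ enc_nat (a j)) ++
  (true :: enc_nat 1 ++ enc_nat j.+2 ++ enc_nat (a j)).

(** The code takes the shape that an expression can print: constants around one piece per item, the
    two edges of an item being consecutive. *)
Lemma enc_gadget : enc_cgraph G =
  true :: enc_nat R ++ true :: enc_nat S ++
  flatten (mkseq (fun _ => true :: enc_nat 1) n) ++ [:: false] ++
  true :: enc_nat 0 ++ enc_nat 1 ++ enc_nat W ++
  flatten (mkseq edges_code n) ++ [:: false].
Proof.
rewrite /enc_cgraph !enc_seqE.
rewrite (@codom_ord _ _ (ginflow R S)); last by move=> i; rewrite ffunE.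
rewrite !mkseq_recl /= -/mkseq.
have -> : [seq true :: enc_nat (ends G e).1 ++ enc_nat (ends G e).2 ++
    enc_nat (weight G e) | e <- enum 'I_(ne G)] =
  mkseq (fun k => true :: enc_nat (gends k).1 ++ enc_nat (gends k).2 ++
    enc_nat (gweight a W k)) (n.*2).+1.
  apply: codom_ord => e.
  by rewrite [weight _ _]ffunE -(gends1 e) -(gends2 e).
rewrite mkseq_recl /= flatten_mkseq_double.
have -> : mkseq (fun j =>
     (true :: enc_nat (odd j.*2) ++ enc_nat (j.*2)./2.+2 ++ enc_nat (a (j.*2)./2)) ++
     (true :: enc_nat (odd j.*2.+1) ++ enc_nat (uphalf j.*2).+2 ++ enc_nat (a (uphalf j.*2)))) n
   = mkseq edges_code n.
  by apply: eq_mkseq => j; rewrite /= odd_double doubleK uphalf_double.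
by rewrite /mkseq -map_comp -!catA /= -!catA.
Qed.

Hypothesis RS : R + S = \sum_(j < n) a j.
Hypotheses (SW : S <= W) (RW : R <= W).

Lemma enc_gfrom : enc_config (@gfrom n a W R S a_gt0 W_gt0) =
  [:: true; true] ++ flatten (mkseq (fun _ => [:: true; false; true; true]) n) ++ [:: false].
Proof.
rewrite /enc_config /enc_bits enc_seqE.
rewrite (@codom_ord _ _ (fun k => if k is k'.+1 then odd k' else true)); last first.
  by move=> i; rewrite ffunE.
rewrite mkseq_recl /= /mkseq -map_comp -/(mkseq _ _) flatten_mkseq_double.
by congr [:: _, _ & flatten _ ++ _]; apply: eq_mkseq => j; rewrite /= odd_double.
Qed.

Lemma enc_gto : enc_config (@gto n a W R S a_gt0 W_gt0) =
  [:: true; false] ++ flatten (mkseq (fun _ => [:: true; true; true; false]) n) ++ [:: false].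
Proof.
rewrite /enc_config /enc_bits enc_seqE.
rewrite (@codom_ord _ _ (fun k => ~~ if k is k'.+1 then odd k' else true)); last first.
  by move=> i; rewrite !ffunE.
rewrite mkseq_recl /= /mkseq -map_comp -/(mkseq _ _) flatten_mkseq_double.
by congr [:: _, _ & flatten _ ++ _]; apply: eq_mkseq => j; rewrite /= odd_double.
Qed.

End GadgetCode.

(** * Expressions for words and numbers *)

Local Notation marks := (option bool : finType).
Definition letter : finType := (bool + marks)%type.
Definition first_mark : letter := inr (Some true).
Definition last_mark : letter := inr (Some false).
Definition pad_mark : letter := inr None.

Implicit Types (e : expr marks) (r : nat -> seq letter).

Definition str (w : seq bool) : seq letter := map inl w.

Lemma str_cat u v : str (u ++ v) = str u ++ str v. Proof. exact: map_cat. Qed.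

Lemma str_flatten ss : str (flatten ss) = flatten (map str ss).
Proof. exact: map_flatten. Qed.

Lemma str_mkseq F n : str (flatten (mkseq F n)) = flatten (mkseq (fun i => str (F i)) n).
Proof. by rewrite str_flatten /mkseq -map_comp. Qed.

#[local] Arguments eval : simpl never.

Lemma eval_const r u : eval r (EConst u) = u. Proof. by []. Qed.

Lemma eval_cat r e1 e2 : eval r (ECat e1 e2) = eval r e1 ++ eval r e2.
Proof. by []. Qed.

Lemma eval_let r e1 e2 : eval r (ELet e1 e2) = eval (scons (eval r e1) r) e2.
Proof. by []. Qed.

Lemma eval_if r i P e1 e2 :
  eval r (EIf i P e1 e2) = if P (ohead (r i)) then eval r e1 else eval r e2.
Proof. by []. Qed.

Lemma eval_bin r i : eval r (EBin _ i) = str (bits (size (r i))).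
Proof. by []. Qed.

Definition cst (w : seq bool) : expr marks := EConst (str w).

Lemma eval_cst r u : eval r (cst u) = str u. Proof. by []. Qed.

(** A body sees its position as the length of the prefix in variable 1; [G] may depend on this
    position and on the current letter. *)
Lemma eval_for r i e (G : letter -> nat -> seq letter) a0 :
  (forall a s pre, eval (scons (a :: s) (scons pre r)) e = G a (size pre)) ->
  eval r (EFor i e) =
  flatten (mkseq (fun j => G (nth a0 (r i) j) j) (size (r i))).
Proof.
move=> eG; rewrite /eval -/eval.
have H w pre : loop (fun w pre => eval (scons w (scons pre r)) e) pre w =
    flatten (mkseq (fun j => G (nth a0 w j) (size pre + j)) (size w)).
  elim: w pre => // a w IH pre; rewrite [size _]/= mkseq_recl /= IH eG addn0.
  by congr (_ ++ flatten _); apply: eq_mkseq => j; rewrite /= addSnnS.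
by rewrite H.
Qed.

Lemma eval_for_const r i e w :
  (forall a s pre, eval (scons (a :: s) (scons pre r)) e = w) ->
  eval r (EFor i e) = flatten (nseq (size (r i)) w).
Proof.
move=> h; rewrite (@eval_for _ _ _ (fun _ _ => w) first_mark h).
by congr flatten; elim: (size _) => // n IH; rewrite mkseq_recl IH.
Qed.

Lemma eval_for_letter r i e (G : letter -> seq letter) :
  (forall a s pre, eval (scons (a :: s) (scons pre r)) e = G a) ->
  eval r (EFor i e) = flatten (map G (r i)).
Proof.
move=> h; rewrite (@eval_for _ _ _ (fun a _ => G a) first_mark h); congr flatten.
by rewrite -[in RHS](mkseq_nth first_mark (r i)) /mkseq -map_comp.
Qed.

Definition cats (es : seq (expr marks)) : expr marks := foldr (@ECat marks) (EConst [::]) es.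

Lemma eval_cats r es : eval r (cats es) = flatten (map (eval r) es).
Proof. by elim: es => //= e es IH; rewrite eval_cat IH. Qed.

(** All computation on letters is done in advance: [f] is tabulated over the finite alphabet when
    the expression is built. *)
Definition switch (i : nat) (f : letter -> seq letter) : expr marks :=
  foldr (fun a e => EIf i (pred1 (Some a)) (EConst (f a)) e) (EConst [::]) (enum letter).

Lemma eval_switch r i f a s : r i = a :: s -> eval r (switch i f) = f a.
Proof.
move=> ri; rewrite /switch; have := mem_enum letter a.
elim: (enum letter) => //= b l IH; rewrite eval_if ri inE /= [Some a == _](_ : _ = (a == b)) //.
by case: eqP => [->|_].
Qed.

(* [enc_bits] without its terminator. *)
Definition esc (w : seq bool) : seq bool := flatten [seq [:: true; b] | b <- w].

Lemma enc_bitsE w : enc_bits w = esc w ++ [:: false].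
Proof. by rewrite /enc_bits enc_seqE. Qed.

Lemma esc_cat u v : esc (u ++ v) = esc u ++ esc v.
Proof. by rewrite /esc map_cat flatten_cat. Qed.

Lemma esc_flatten ss : esc (flatten ss) = flatten (map esc ss).
Proof. by elim: ss => //= s ss IH; rewrite esc_cat IH. Qed.

(** Arithmetic is done in unary, on lengths of words; [EBin] converts the length, and the loop
    inserts the continuation marks of [enc_bits]. *)
Definition count_code (e : expr marks) : expr marks :=
  ELet e (ELet (EBin marks 0) (ECat
    (EFor 0 (switch 0 (fun a => if a is inl b then str [:: true; b] else [::])))
    (cst [:: false]))).

Lemma eval_count_code r e : eval r (count_code e) = str (enc_nat (size (eval r e))).
Proof.
rewrite /count_code !(eval_let, eval_cat, eval_bin).
rewrite (@eval_for_letter _ 0 _ (fun a => if a is inl b then str [:: true; b] else [::])).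
  rewrite /enc_nat enc_bitsE str_cat; congr (_ ++ _).
  by rewrite /esc str_flatten /= -!map_comp.
by move=> a s pre; rewrite (@eval_switch _ 0 _ a s).
Qed.

Lemma size_flatten_nseq T n (w : seq T) : size (flatten (nseq n w)) = n * size w.
Proof. by elim: n => //= n IH; rewrite size_cat IH. Qed.

Lemma flatten_nseq_mul T a b (w : seq T) :
  flatten (nseq a (flatten (nseq b w))) = flatten (nseq (a * b) w).
Proof. by elim: a => //= a ->; rewrite mulSn nseqD flatten_cat. Qed.

(** The index grows by 2 because each enclosing loop binds two variables. *)
Fixpoint power (d i : nat) : expr marks :=
  if d is d'.+1 then EFor i (power d' i.+2) else EConst [:: pad_mark].

Lemma eval_power d i r : eval r (power d i) = nseq (size (r i) ^ d) pad_mark.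
Proof.
elim: d i r => [|d IH] i r //.
rewrite [power _ _]/= (@eval_for_const _ _ _ (nseq (size (r i) ^ d) pad_mark)).
  by rewrite expnS; elim: {1 3}(size (r i)) => //= n ->; rewrite mulSn nseqD.
by move=> a s pre; rewrite IH.
Qed.

(** A loop over this word makes one round per column of the tableau, and the marks distinguish the
    first and the last round. The padding [m] stands for the time bound. *)
Definition word (x : seq bool) (m : nat) : seq letter :=
  first_mark :: str x ++ nseq m pad_mark ++ [:: last_mark].

Definition word_expr (d : nat) : expr marks :=
  ELet (ECat (EFor 0 (EConst [:: pad_mark])) (EConst [:: pad_mark; pad_mark]))
    (cats [:: EConst [:: first_mark];
              EFor 1 (switch 0 (fun a => [:: a]));
              power d 0; EConst [:: last_mark]]).

Lemma eval_word_expr d x r : r 0 = str x ->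
  eval r (word_expr d) = word x ((size x).+2 ^ d).
Proof.
move=> r0; rewrite /word_expr eval_let eval_cats; set r' := scons _ _.
rewrite [map _ _]/= !eval_const.
rewrite (@eval_for_letter _ 1 _ (fun a => [:: a])); last first.
  by move=> a s pre; rewrite (@eval_switch _ 0 _ a s).
rewrite eval_power flatten_map1 map_id /= r0 /word; congr (_ :: _ ++ _).
rewrite (_ : size (r' 0) = (size x).+2) // /r' /= eval_cat.
rewrite (@eval_for_const _ _ _ [:: pad_mark]) // size_cat size_flatten_nseq.
by rewrite r0 size_map muln1 addn2.
Qed.

Lemma size_word x m : size (word x m) = size x + m + 2.
Proof. by rewrite /= !size_cat size_map size_nseq /=; lia. Qed.

Section Numbers.
Variable w : nat.
Let b := 2 ^ w.

(* A number with [N * N + N] digits in base [b] for a word of length [N]: the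
   first and last [N] digits depend on the letters of the word. *)
Definition wide_digits (u : seq letter) (f : letter -> nat) (mid : nat) (g : letter -> nat) :=
  map f u ++ nseq (size u * size u - size u) mid ++ map g u.

(** The [N * N - N] middle digits come from two nested loops, the outer one skipping the first
    letter. The very last digit is printed without padding, being the leading one. *)
Definition wide_expr (i : nat) (f : letter -> nat) (mid : nat) (g : letter -> nat) : expr marks :=
  cats [:: EFor i (switch 0 (fun a => str (esc (padbits w (f a)))));
           EFor i (EIf 0 (pred1 (Some first_mark)) (EConst [::])
                         (EFor i.+2 (cst (esc (padbits w mid)))));
           EFor i (switch 0 (fun a => str (esc
             (if a == last_mark then bits (g a) else padbits w (g a)))));
           cst [:: false]].

Lemma eval_wide r i x m f mid g : r i = word x m ->
  (forall a, f a < b) -> mid < b -> (forall a, g a < b) -> 0 < g last_mark ->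
  eval r (wide_expr i f mid g) =
  str (enc_nat (bval b (wide_digits (word x m) f mid g))).
Proof.
move=> ri fb midb gb g0.
pose v : seq letter := first_mark :: str x ++ nseq m pad_mark.
have uE : word x m = rcons v last_mark by rewrite /v /word /= -cats1 catA.
have lastv a : a \in v -> (a == last_mark) = false.
  rewrite inE mem_cat => /or3P[/eqP->|/mapP[c _ ->]|/nseqP[-> _]] //.
rewrite /wide_expr eval_cats [map _ _]/=.
rewrite (@eval_for_letter _ i _ (fun a => str (esc (padbits w (f a))))); last first.
  by move=> a s pre; rewrite (@eval_switch _ 0 _ a s).
rewrite (@eval_for_letter _ i _ (fun a => if a == first_mark then [::] else
   flatten (nseq (size (word x m)) (str (esc (padbits w mid)))))); last first.
  move=> a s pre; rewrite eval_if /= [Some a == _](_ : _ = (a == first_mark)) //.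
  by case: eqP => // _; rewrite (@eval_for_const _ i.+2 _ (str (esc (padbits w mid)))) //= ri.
rewrite (@eval_for_letter _ i _ (fun a => str (esc
             (if a == last_mark then bits (g a) else padbits w (g a))))); last first.
  by move=> a s pre; rewrite (@eval_switch _ 0 _ a s).
rewrite ri /wide_digits.
have -> : flatten [seq if a == first_mark then [::] else
      flatten (nseq (size (word x m)) (str (esc (padbits w mid)))) | a <- word x m] =
    str (esc (flatten (map (padbits w)
      (nseq (size (word x m) * size (word x m) - size (word x m)) mid)))).
  have -> : word x m = first_mark :: (str x ++ nseq m pad_mark ++ [:: last_mark]) by [].
  set v' := str x ++ _; rewrite /= map_nseq esc_flatten map_nseq str_flatten map_nseq.
  have -> : (size v').+1 * (size v').+1 - (size v').+1 = size v' * (size v').+1 by lia.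
  rewrite -flatten_nseq_mul.
  have: all (fun a => a != first_mark) v'.
    apply/allP => a; rewrite !mem_cat => /or3P[/mapP[c _ ->]|/nseqP[-> _]|] //.
    by rewrite inE => /eqP->.
  rewrite [flatten (nseq (size v').+1 _)]/=; set z := str _ ++ flatten _.
  by elim: (v') => //= a s IH /andP[/negbTE-> /IH->].
move: (word x m) uE {ri} => u uE; clearbody v.
have -> : map f u ++ nseq (size u * size u - size u) mid ++ map g u =
    rcons (map f u ++ nseq (size u * size u - size u) mid ++ map g v) (g last_mark).
  by rewrite !rcons_cat -map_rcons -uE.
rewrite /enc_nat bits_bval //; last first.
  rewrite !all_cat; apply/and3P; split.
  - by apply/allP => _ /mapP[a _ ->]; apply: fb.
  - by apply/allP => _ /nseqP[-> _].
  - by apply/allP => _ /mapP[a _ ->]; apply: gb.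
rewrite enc_bitsE !map_cat !flatten_cat !esc_cat !str_cat -!catA.
congr (_ ++ (_ ++ _)); first by rewrite esc_flatten str_flatten -!map_comp.
rewrite uE map_rcons -cats1 flatten_cat [flatten [:: _]]/= !cats0.
rewrite -catA; congr (_ ++ _).
rewrite esc_flatten str_flatten -!map_comp; congr flatten.
by apply/eq_in_map => a /lastv h; rewrite /= h.
Qed.

End Numbers.

(** Induction along Horner's scheme. The form [n.+2 ^ d] is the one that [power] can produce as an
    amount of padding. *)
Lemma poly_nat_bound (p : {poly nat}) : exists d, forall n, p.[n]%R <= n.+2 ^ d.
Proof.
elim/poly_ind: p => [|p c [d IH]]; first by exists 0 => n; rewrite horner0.
exists (d.+1 + c).+1 => n; rewrite hornerMXaddC.
apply: leq_exp_add => //; last exact: leq_exp_const.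
rewrite -[d.+1]addn1; apply: (@leq_exp_mul _ p.[n]%R n); first exact: IH.
by rewrite expn1; lia.
Qed.

Lemma sum_enum_nth (T : finType) (t0 : T) (F : T -> nat) :
  \sum_(k < #|T|) F (nth t0 (enum T) k) = \sum_s F s.
Proof.
rewrite -[RHS]big_enum /= (big_nth t0) -cardE big_mkord.
by apply: eq_bigl.
Qed.

(** Items are numbered position by position: number [k] stands for position [k %/ #|T|] and the tile
    of rank [k %% #|T|]. *)
Lemma subset_sum_grid (T : finType) (t0 : T) P (f : nat -> T -> nat) S :
  subset_sum (P * #|T|) (fun k => f (k %/ #|T|) (nth t0 (enum T) (k %% #|T|))) S <->
  exists sel : nat -> T -> bool, \sum_(p < P) \sum_s sel p s * f p s = S.
Proof.
have T0 : 0 < #|T| by apply/card_gt0P; exists t0.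
have dm p k : k < #|T| -> ((p * #|T| + k) %/ #|T| = p) * ((p * #|T| + k) %% #|T| = k).
  by move=> ltk; rewrite divnMDl // divn_small // addn0 modnMDl modn_small.
split=> [[J JS]|[sel selS]].
  exists (fun p s => J (p * #|T| + index s (enum T))); rewrite -JS.
  rewrite (sum_mul_split P _ (fun k => J k * f (k %/ #|T|) (nth t0 (enum T) (k %% #|T|)))).
  apply: eq_bigr => p _.
  rewrite -(sum_enum_nth t0 (fun s => J (p * #|T| + index s (enum T)) * f p s)).
  apply: eq_bigr => k _; rewrite !dm //; congr (J (_ + _) * _).
  by rewrite index_uniq ?enum_uniq // -cardE.
exists (fun k => sel (k %/ #|T|) (nth t0 (enum T) (k %% #|T|))).
rewrite -selS (sum_mul_split P _ (fun k =>
  sel (k %/ #|T|) (nth t0 (enum T) (k %% #|T|)) * f (k %/ #|T|) (nth t0 (enum T) (k %% #|T|)))).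
apply: eq_bigr => p _.
rewrite -(sum_enum_nth t0 (fun s => sel p s * f p s)).
by apply: eq_bigr => k _; rewrite !dm.
Qed.

Lemma bval_lt b s : all (fun c => c < b) s -> bval b s < b ^ size s.
Proof.
elim: s => //= c s IH /andP[ltc /IH lts]; rewrite expnS.
apply: (@leq_trans (b * (bval b s).+1)); last by rewrite leq_mul2l lts orbT.
by rewrite mulnS -addSn leq_add2r.
Qed.

Lemma wide_digits_lt b u f mid g : (forall a, f a < b) -> mid < b ->
  (forall a, g a < b) -> all (fun c => c < b) (wide_digits u f mid g).
Proof.
move=> fb midb gb; rewrite !all_cat; apply/and3P; split.
- by apply/allP => _ /mapP[a _ ->].
- by apply/allP => _ /nseqP[-> _].
- by apply/allP => _ /mapP[a _ ->].
Qed.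

Lemma wide_digitsE x m f mid g F : let u := word x m in let N := size u in
  (forall q, q < N -> F q = f (nth first_mark u q)) ->
  (forall q, N <= q < N * N -> F q = mid) ->
  (forall j, j < N -> F (N * N + j) = g (nth first_mark u j)) ->
  mkseq F (N * N + N) = wide_digits u f mid g.
Proof.
move=> u N h1 h2 h3; have N0 : 0 < N by rewrite /N /u size_word; lia.
have NN : N <= N * N by rewrite leq_pmull.
have szE : size (wide_digits u f mid g) = N * N + N.
  by rewrite /wide_digits !size_cat !size_map size_nseq -/N; lia.
apply: (@eq_from_nth _ 0) => [|q]; first by rewrite size_mkseq szE.
rewrite size_mkseq => ltq; rewrite nth_mkseq // /wide_digits !nth_cat.
rewrite !size_map size_nseq -/N; case: ltnP => hq.
  by rewrite h1 // (nth_map first_mark).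
case: ltnP => hq'.
  by rewrite nth_nseq hq' h2 //; lia.
have -> : q = N * N + (q - N * N) by lia.
rewrite h3; last by lia.
rewrite (nth_map first_mark) -/N; last by lia.
by congr (g (nth _ _ _)); lia.
Qed.

Lemma word_nth_first x m q : q < size (word x m) ->
  (nth first_mark (word x m) q == first_mark) = (q == 0).
Proof.
case: q => [|q] //= ltq; have: nth first_mark (str x ++ nseq m pad_mark ++ [:: last_mark]) q
    \in str x ++ nseq m pad_mark ++ [:: last_mark] by apply: mem_nth.
rewrite !mem_cat => /or3P[/mapP[c _ ->]|/nseqP[-> _]|] //.
by rewrite inE => /eqP->.
Qed.

Lemma eval_for2_const r i w :
  eval r (EFor i (EFor i.+2 (cst w))) = str (flatten (nseq (size (r i) * size (r i)) w)).
Proof.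
rewrite (@eval_for_const _ _ _ (flatten (nseq (size (r i)) (str w)))).
  by rewrite flatten_nseq_mul str_flatten map_nseq.
by move=> a s pre; rewrite (@eval_for_const _ _ _ (str w)).
Qed.

Lemma nseq_mkseq T n (w : T) : nseq n w = mkseq (fun _ => w) n.
Proof. by elim: n => // n IH; rewrite mkseq_recl -IH. Qed.

(** * Expressions for the instance *)

Section Printing.
Variable M : tm.
Local Notation T := (tile M).
Local Notation H := (hcolor M).
Local Notation V := (content M).
Local Notation tau := (ntiles T).
Local Notation lc := (@left_color M).
Local Notation rc := (@right_color M).
Local Notation bc := (@tile_bot M).
Local Notation tc := (@tile_top M).
Local Notation wall := (Some None : H).
Local Notation blk := (block T H V).
Local Notation bb := (bbase T H V).

Definition bwidth := 3 * width T H V.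

Lemma card_content_gt1 : 1 < #|V|.
Proof.
have /card_uniqP /= <- : uniq [:: inl None : V; inr (blank_cell M) : V].
  by [].
exact: max_card.
Qed.

Lemma card_label_gt0 : 0 < #|label M|.
Proof. by apply/card_gt0P; exists None. Qed.

Lemma card_tile : #|T| = #|label M| * #|V|.+1 * #|V| * #|V|.+1.
Proof. by rewrite !card_prod !card_option. Qed.

Lemma card_hcolor : #|H| = (#|label M| * #|V| * #|V|).+2.
Proof. by do 2!rewrite [in LHS]card_option; rewrite !card_prod. Qed.

(** Inner colors consist of a label and two contents, tiles of a label and three, two of them
    optional; with at least two contents the surplus covers the extra colors. *)
Lemma hsize_le_tile : hsize H <= tau.
Proof.
rewrite /hsize /ntiles card_tile card_hcolor.
by have := card_content_gt1; have := card_label_gt0; nia.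
Qed.

Lemma vsize_le_tile : vsize V <= tau.
Proof.
rewrite /vsize /ntiles card_tile.
by have := card_content_gt1; have := card_label_gt0; nia.
Qed.

Definition tile0 : T := (None, None, inr (blank_cell M), None).

(** A function of the letter alone, thanks to the head being on a blank before the input; padding
    and end mark give blank cells. *)
Definition init_content (a : letter) : V :=
  if a == first_mark then inl (Some (None, [ffun => blank])) else
  inr [ffun i => (blank, if i == ord0 then
    (if a is inl b then bit b else blank) else blank)].
Definition end_content (a : letter) : V :=
  if a == first_mark then inl None else inr (blank_cell M).

Lemma init_contentE x m j : j < size (word x m) ->
  start_row M x j = init_content (nth first_mark (word x m) j).
Proof.
move=> ltj; rewrite /init_content word_nth_first //; case: j ltj => [|j] ltj.
  congr (inl (Some (_, _))); apply/ffunP => i; rewrite !ffunE /scan /=.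
  by case: (i == ord0).
rewrite /start_row /rep /=; congr inr; apply/ffunP => i; rewrite !ffunE nth_nil.
congr (_, _); case: (i == ord0); rewrite ?nth_nil //= nth_cat size_map.
case: ltnP => h; first by rewrite !(nth_map false) // !size_map.
rewrite [LHS]nth_default ?size_map // nth_cat size_nseq; case: ltnP => h'.
  by rewrite nth_nseq h'.
by case: (_ - m) => [|[|k]].
Qed.

Lemma end_contentE x m j : j < size (word x m) ->
  end_row M j = end_content (nth first_mark (word x m) j).
Proof. by move=> ltj; rewrite /end_content word_nth_first //; case: j ltj. Qed.

(** Digits of the target in the first [N], the middle and the last [N] blocks. Column 0 is
    recognised by [first_mark]: it has the complement of the wall in block 0 and its code in block
    [N * N]. *)
Definition target_first a :=
  blk 1 (if a == first_mark then hcompl wall else hsize H) (vcompl (init_content a)).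
Definition target_mid := blk 1 (hsize H) (vsize V).
Definition target_last a :=
  blk 0 (if a == first_mark then hcode wall else 0) (vcode (end_content a)).

(** Block 0 has no predecessor and thus receives no right codes; those of the last position turn up
    in block [N * N]. *)
Definition rest_first a := blk tau
  (hl_total lc + (if a == first_mark then 0 else hr_total rc)) (vb_total bc) - target_first a.
Definition rest_mid :=
  blk tau (hl_total lc + hr_total rc) (vb_total bc + vt_total tc) - target_mid.
Definition rest_last a :=
  blk 0 (if a == first_mark then hr_total rc else 0) (vt_total tc) - target_last a.

Section Word.
Variables (x : seq bool) (m : nat).
Let u := word x m.
Let N := size u.

Let N_gt1 : 1 < N. Proof. by rewrite /N size_word; lia. Qed.
Let NN : N <= N * N. Proof. by rewrite leq_pmull // ltnW. Qed.

Definition target_num := target T wall (start_row M x) (end_row M) N (N * N).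
Definition rest_num := rest lc rc bc tc wall (start_row M x) (end_row M) N (N * N).

Local Notation tblock := (target_block T wall (start_row M x) (end_row M) N (N * N)).

Lemma target_block_first q : q < N -> tblock q = target_first (nth first_mark u q).
Proof.
move=> ltq; rewrite /target_block /target_first word_nth_first // /tgt0 /tgt1 /tgt2 ltq.
by rewrite (leq_trans ltq NN) (init_contentE (m := m)) //; case: eqP.
Qed.

Lemma target_block_mid q : N <= q < N * N -> tblock q = target_mid.
Proof.
move=> hq; have [h1 h2] : N <= q /\ q < N * N by lia.
rewrite /target_block /target_mid /tgt0 /tgt1 /tgt2.
by rewrite h2 ltnNge h1 gtn_eqF //; lia.
Qed.

Lemma target_block_last j : j < N -> tblock (N * N + j) = target_last (nth first_mark u j).
Proof.
move=> ltj; rewrite /target_block /target_last word_nth_first // /tgt0 /tgt1 /tgt2.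
rewrite !(ltnNge (_ + _)) leq_addr (leq_trans NN) ?leq_addr //=.
by rewrite -[X in _ == X]addn0 eqn_add2l addKn (end_contentE (x := x) (m := m)).
Qed.

Lemma target_numE :
  target_num = bval bb (wide_digits u target_first target_mid target_last).
Proof.
rewrite /target_num /target /Q (wide_digitsE (f := target_first)
  (mid := target_mid) (g := target_last)) //.
- exact: target_block_first.
- exact: target_block_mid.
- exact: target_block_last.
Qed.

Lemma rest_numE : rest_num = bval bb (wide_digits u rest_first rest_mid rest_last).
Proof.
rewrite /rest_num /rest /Q (wide_digitsE (f := rest_first)
  (mid := rest_mid) (g := rest_last)) //; rewrite -/u -/N => q hq.
- rewrite /rest_block target_block_first // /rest_first word_nth_first //.
  rewrite /tot0 /tot1 /tot2 (leq_trans hq NN) (leqNgt N q) hq !mul1n addn0.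
  congr (blk _ (_ + _) _ - _); case: q hq => [|q] hq //=.
  by rewrite ltnW ?mul1n // (leq_trans hq).
- have [h1 h2] : N <= q /\ q < N * N by lia.
  rewrite /rest_block target_block_mid // /rest_mid /tot0 /tot1 /tot2 h1 h2.
  by rewrite (ltnW h2) (ltn_addr _ h2) (leq_trans (ltnW N_gt1) h1) !mul1n.
- rewrite /rest_block target_block_last // /rest_last word_nth_first //.
  rewrite /tot0 /tot1 /tot2 ltnNge leq_addr /Q ltn_add2l hq.
  rewrite (leq_trans NN) ?leq_addr // !mul0n !add0n !mul1n; congr (blk _ _ _ - _).
  rewrite andTb -[X in _ <= X]addn0 leq_add2l leqn0.
  by case: eqP; rewrite ?mul1n.
Qed.

End Word.

Local Notation bnd := (width T H V).

Lemma blk_lt d0 d1 d2 : d0 <= bnd -> d1 <= bnd -> d2 <= bnd -> blk d0 d1 d2 < bb.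
Proof. by move=> h0 h1 h2; apply: block_lt; apply: leq_ltn_trans (base_gt _ _ _). Qed.

Lemma ntiles_bnd : tau <= bnd.
Proof. by rewrite /width /hsize; nia. Qed.

Lemma hsize_bnd : hsize H <= bnd.
Proof. by have := hsize_le_tile; rewrite /width; have : 0 < hsize H by []; nia. Qed.

Lemma vsize_bnd : vsize V <= bnd.
Proof. by have := vsize_le_tile; rewrite /width; have : 0 < vsize V by []; nia. Qed.

Lemma total_bnd (f : T -> nat) b : (forall s, f s < b) -> \sum_s f s <= tau * b.
Proof.
by move=> fb; rewrite /ntiles -sum_nat_const; apply: leq_sum => s _; apply: ltnW.
Qed.

Lemma hl_bnd : hl_total lc <= tau * hsize H.
Proof. by apply: total_bnd => s; case/andP: (hcompl_bound (lc s)). Qed.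
Lemma hr_bnd : hr_total rc <= tau * hsize H.
Proof. by apply: total_bnd => s; case/andP: (hcode_bound (rc s)). Qed.
Lemma vb_bnd : vb_total bc <= tau * vsize V.
Proof. by apply: total_bnd => s; case/andP: (vcompl_bound (bc s)). Qed.
Lemma vt_bnd : vt_total tc <= tau * vsize V.
Proof. by apply: total_bnd => s; case/andP: (vcode_bound (tc s)). Qed.

Lemma target_first_lt a : target_first a < bb.
Proof.
have := hsize_bnd; have := vsize_bnd; have := hcompl_bound wall.
have := vcompl_bound (init_content a).
by move=> *; apply: blk_lt; [|case: eqP|]; lia.
Qed.

Lemma target_mid_lt : target_mid < bb.
Proof.
by apply: blk_lt; [apply: leq_trans hsize_bnd|apply: hsize_bnd|apply: vsize_bnd].
Qed.

Lemma target_last_lt a : target_last a < bb.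
Proof.
have := hsize_bnd; have := vsize_bnd; have := hcode_bound wall.
have := vcode_bound (end_content a).
by move=> *; apply: blk_lt; [|case: eqP|]; lia.
Qed.

Lemma target_last_gt0 a : 0 < target_last a.
Proof.
have b0 : 0 < base T H V by rewrite expn_gt0.
by have := vcode_bound (end_content a); rewrite /target_last /block; nia.
Qed.

Lemma rest_first_lt a : rest_first a < bb.
Proof.
apply: leq_ltn_trans (leq_subr _ _) _; have := hl_bnd; have := hr_bnd; have := vb_bnd.
by move=> *; apply: blk_lt; [exact: ntiles_bnd|case: eqP|]; rewrite /width; nia.
Qed.

Lemma rest_mid_lt : rest_mid < bb.
Proof.
apply: leq_ltn_trans (leq_subr _ _) _.
have := hl_bnd; have := hr_bnd; have := vb_bnd; have := vt_bnd.
by move=> *; apply: blk_lt; [exact: ntiles_bnd| |]; rewrite /width; nia.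
Qed.

Lemma rest_last_lt a : rest_last a < bb.
Proof.
apply: leq_ltn_trans (leq_subr _ _) _; have := hr_bnd; have := vt_bnd.
by move=> *; apply: blk_lt; [|case: eqP|]; rewrite /width; nia.
Qed.

(** The leading block is printed without padding and must be positive: the top codes of all tiles
    add up to at least [tau], more than a single code. *)
Lemma rest_last_gt0 : 0 < rest_last last_mark.
Proof.
rewrite subn_gt0 /target_last /= /block; have b0 : 0 < base T H V by rewrite expn_gt0.
have vt : tau <= vt_total tc.
  by apply: total_ge => s; case/andP: (vcode_bound (tc s)).
have := vcode_bound (end_content last_mark); have := vsize_le_tile; nia.
Qed.

End Printing.

Lemma flatten_cons T (s : seq T) ss : flatten (s :: ss) = s ++ flatten ss.
Proof. by []. Qed.

Lemma str_flatten_nseq k z : str (flatten (nseq k z)) = flatten (nseq k (str z)).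
Proof. by rewrite str_flatten map_nseq. Qed.

Lemma str_esc_nseq k z :
  str (esc (flatten (nseq k z))) = flatten (nseq k (str (esc z))).
Proof. by rewrite esc_flatten map_nseq str_flatten_nseq. Qed.

(** * The instance of an input word and its printed code *)

Section Instance.
Variable M : tm.
Local Notation T := (tile M).
Local Notation H := (hcolor M).
Local Notation V := (content M).
Local Notation tau := (ntiles T).
Local Notation lc := (@left_color M).
Local Notation rc := (@right_color M).
Local Notation bc := (@tile_bot M).
Local Notation tc := (@tile_top M).
Local Notation bb := (bbase T H V).
Local Notation w := (bwidth M).

Lemma tau_gt0 : 0 < tau.
Proof. exact: ntiles_gt0 (hsize_le_tile M). Qed.

Definition weights (N k : nat) : nat :=
  item lc rc bc tc N (k %/ tau) (nth (tile0 M) (enum T) (k %% tau)).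

Definition zeros : seq bool := esc (padbits w 0).

(** Evaluated inside two nested loops over the word: variables 3 and 1 are the prefixes of the row
    and column loops, whose lengths give the position, and variable 4 is the word itself, called 6
    inside one more loop. Skipping both marks leaves [N - 2] zero blocks. *)
Definition item_expr (s : T) : expr (option bool) :=
  cats [:: EFor 3 (EFor 6 (cst zeros)); EFor 1 (cst zeros);
           cst (esc (padbits w (item_block0 lc bc s)));
           cst (esc (padbits w (item_block1 V rc s)));
           EFor 4 (switch 0 (fun a =>
             if (a == first_mark) || (a == last_mark) then [::] else str zeros));
           cst (esc (bits (item_block2 H tc s)) ++ [:: false])].

(** Item [k] is vertex [k.+2], where [k] is [tau] times the position plus [i]; this number is
    spelled out in unary before its conversion. *)
Definition vertex_expr (i : nat) : expr (option bool) :=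
  count_code (cats [:: EFor 3 (EFor 6 (cst (nseq tau true)));
    EFor 1 (cst (nseq tau true)); cst (nseq i.+2 true)]).

Definition edge_expr (i : nat) : expr (option bool) :=
  let s := nth (tile0 M) (enum T) i in
  cats [:: cst (true :: enc_nat 0); vertex_expr i; item_expr s;
           cst (true :: enc_nat 1); vertex_expr i; item_expr s].

Section Word.
Variables (x : seq bool) (m : nat).
Let u := word x m.
Let N := size u.

Let N_gt1 : 1 < N. Proof. by rewrite /N size_word; lia. Qed.
Let NN : N <= N * N. Proof. by rewrite leq_pmull // ltnW. Qed.

Section Body.
Variable r : nat -> seq letter.
Hypothesis r4 : r 4 = u.

Lemma eval_grid z : eval r (EFor 3 (EFor 6 (cst z))) =
  str (flatten (nseq (size (r 3) * N) z)).
Proof.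
rewrite (@eval_for_const _ _ _ (flatten (nseq N (str z)))).
  by rewrite flatten_nseq_mul str_flatten map_nseq.
by move=> a s pre; rewrite (@eval_for_const _ _ _ (str z)) //= r4.
Qed.

Lemma eval_item s : eval r (item_expr s) =
  str (enc_nat (item lc rc bc tc N (size (r 3) * N + size (r 1)) s)).
Proof.
rewrite /item_expr eval_cats [map _ _]/= eval_grid.
rewrite (@eval_for_const _ 1 _ (str zeros)) //.
rewrite (@eval_for_letter _ 4 _ (fun a =>
    if (a == first_mark) || (a == last_mark) then [::] else str zeros)); last first.
  by move=> a s' pre; rewrite (@eval_switch _ 0 _ a s').
have -> : flatten [seq if (a == first_mark) || (a == last_mark) then [::] else str zeros
    | a <- r 4] = str (flatten (nseq (N - 2) zeros)).
  rewrite r4 str_flatten map_nseq /u /word /= map_cat map_cat /=.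
  have -> : N - 2 = size x + m by rewrite /N size_word addnK.
  rewrite nseqD !flatten_cat /= cats0; congr (_ ++ _).
    by elim: (x) => //= b y ->.
  by elim: (m) => //= k ->.
rewrite /item /enc_nat bits_bval; first last.
- have b0 : 0 < base T H V by rewrite expn_gt0.
  by have := vcode_bound (tc s); rewrite /item_block2 /block; nia.
- have := hsize_bnd M; have := vsize_bnd M; have := hcompl_bound (lc s).
  have := hcode_bound (rc s); have := vcompl_bound (bc s) => *.
  rewrite all_cat /= !all_nseq expn_gt0 !orbT /=.
  by apply/and3P; split=> //; apply: blk_lt; lia.
rewrite enc_bitsE !esc_cat !str_cat /item_blocks map_cat flatten_cat esc_cat.
rewrite /= !esc_cat !map_nseq nseqD flatten_cat esc_cat.
rewrite !str_cat !str_esc_nseq !str_flatten_nseq -/zeros !eval_cst cats0.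
by rewrite !str_cat -!catA.
Qed.

Lemma eval_vertex i : eval r (vertex_expr i) =
  str (enc_nat (((size (r 3) * N + size (r 1)) * tau + i).+2)).
Proof.
rewrite /vertex_expr eval_count_code eval_cats [map _ _]/= eval_grid.
rewrite (@eval_for_const _ 1 _ (str (nseq tau true))) //.
rewrite eval_cst [flatten [:: _, _ & _]]/= -[_ :: _ :: _]/(str (nseq i.+2 true) ++ _) cats0.
rewrite !size_cat !size_map !size_flatten_nseq size_map !size_nseq.
by congr (str (enc_nat _)); rewrite mulnDl !addnS addnA.
Qed.

Lemma eval_edge i : i < tau -> eval r (edge_expr i) =
  str (edges_code (weights N) ((size (r 3) * N + size (r 1)) * tau + i)).
Proof.
move=> lti; rewrite /edge_expr eval_cats [map _ _]/= !eval_vertex !eval_item.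
rewrite /edges_code /weights divnMDl ?tau_gt0 // divn_small // addn0.
rewrite modnMDl modn_small // !eval_cst !flatten_cons cats0 -!str_cat.
by rewrite !cat_cons -!catA.
Qed.
End Body.

Variable r : nat -> seq letter.
Hypothesis r0 : r 0 = u.

Lemma eval_edges : eval r (EFor 0 (EFor 2 (cats (mkseq edge_expr tau)))) =
  str (flatten (mkseq (edges_code (weights N)) (N * N * tau))).
Proof.
rewrite !flatten_mkseq_mul str_mkseq.
rewrite (@eval_for _ _ _ (fun _ t => flatten (mkseq (fun j =>
    str (flatten (mkseq (fun i => edges_code (weights N) ((t * N + j) * tau + i)) tau))) N)) first_mark).
  by rewrite r0; congr flatten; apply: eq_mkseq => t; rewrite str_mkseq.
move=> a s pre.
rewrite (@eval_for _ _ _ (fun _ j =>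
  str (flatten (mkseq (fun i => edges_code (weights N) ((size pre * N + j) * tau + i)) tau))) first_mark).
  by rewrite /= r0.
move=> b s' pre'; rewrite eval_cats str_mkseq; congr flatten.
rewrite /mkseq -map_comp; apply/eq_in_map => i; rewrite mem_iota => lti.
by rewrite /= eval_edge.
Qed.

Definition wmax_expr : expr (option bool) :=
  cats [:: EFor 0 (EFor 2 (cst zeros)); EFor 0 (cst zeros); cst [:: true; true; false]].

(** Both inflows have [N * N + N] digits in base [bb], so this power bounds them, and its binary
    form is zeros followed by a one. *)
Definition wmax : nat := bb ^ (N * N + N).

Lemma wmaxE : bits wmax = nseq (w * (N * N + N)) false ++ [:: true].
Proof.
have -> : wmax = 0 + 2 ^ (w * (N * N + N)) * 1 by rewrite add0n muln1 expnM.
rewrite bits_pad ?expn_gt0 // bits_half // bits0; congr (_ ++ _).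
by rewrite nseq_mkseq; apply: eq_mkseq => i; rewrite div0n.
Qed.

Lemma eval_wmax : eval r wmax_expr = str (enc_nat wmax).
Proof.
rewrite /wmax_expr eval_cats [map _ _]/= eval_for2_const (@eval_for_const _ 0 _ (str zeros)) // r0.
rewrite /enc_nat wmaxE enc_bitsE esc_cat -/N.
have -> : nseq (w * (N * N + N)) false = flatten (nseq (N * N + N) (padbits w 0)).
  have -> : padbits w 0 = nseq w false.
    by rewrite nseq_mkseq; apply: eq_mkseq => i; rewrite div0n.
  by rewrite mulnC; elim: (N * N + N) => //= k <-; rewrite mulSn nseqD.
rewrite !str_cat str_esc_nseq nseqD flatten_cat str_flatten_nseq !flatten_cons eval_cst.
by rewrite -!catA.
Qed.

Definition target_expr := wide_expr w 0 (@target_first M) (target_mid M) (@target_last M).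
Definition rest_expr := wide_expr w 0 (@rest_first M) (rest_mid M) (@rest_last M).

Lemma eval_target : eval r target_expr = str (enc_nat (target_num M x m)).
Proof.
rewrite /target_expr (@eval_wide _ _ _ x m) ?target_numE //.
- exact: target_first_lt.
- exact: target_mid_lt.
- exact: target_last_lt.
- exact: target_last_gt0.
Qed.

Lemma eval_rest : eval r rest_expr = str (enc_nat (rest_num M x m)).
Proof.
rewrite /rest_expr (@eval_wide _ _ _ x m) ?rest_numE //.
- exact: rest_first_lt.
- exact: rest_mid_lt.
- exact: rest_last_lt.
- exact: rest_last_gt0.
Qed.

Lemma weights_gt0 k : 0 < weights N k.
Proof. exact: item_gt0. Qed.

Lemma wmax_gt0 : 0 < wmax.
Proof. by rewrite !expn_gt0. Qed.

Lemma size_wide_digits f mid g : size (wide_digits u f mid g) = N * N + N.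
Proof. by rewrite /wide_digits !size_cat !size_map size_nseq -/N; lia. Qed.

Lemma target_le_wmax : target_num M x m <= wmax.
Proof.
rewrite target_numE ltnW // /wmax -(size_wide_digits (@target_first M) (target_mid M) (@target_last M)).
apply/bval_lt/wide_digits_lt; [exact: target_first_lt|exact: target_mid_lt|exact: target_last_lt].
Qed.

Lemma rest_le_wmax : rest_num M x m <= wmax.
Proof.
rewrite rest_numE ltnW // /wmax -(size_wide_digits (@rest_first M) (rest_mid M) (@rest_last M)).
apply/bval_lt/wide_digits_lt; [exact: rest_first_lt|exact: rest_mid_lt|exact: rest_last_lt].
Qed.

Lemma sum_weights : rest_num M x m + target_num M x m =
  \sum_(k < N * N * tau) weights N k.
Proof.
rewrite /rest_num /target_num rest_target //; first last.
- exact: vsize_le_tile.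
- exact: hsize_le_tile.
rewrite sum_mul_split; apply: eq_bigr => p _.
rewrite -(sum_enum_nth (tile0 M)); apply: eq_bigr => k _.
by rewrite /weights divnMDl ?tau_gt0 // divn_small // addn0 modnMDl modn_small.
Qed.

Lemma subset_sum_accepts :
  (forall s, path (@tm_step M) (tm_init M x) s -> size s <= m) ->
  subset_sum (N * N * tau) (weights N) (target_num M x m) <-> tm_accepts M x.
Proof.
move=> tb; rewrite (accepts_tiling tb) -(size_word x m) -/u -/N.
rewrite -(tiling_sum _ _ _ _ _ _ _ N_gt1 NN (hsize_le_tile M) (vsize_le_tile M)).
exact: (subset_sum_grid (tile0 M) (N * N) (fun p s => item lc rc bc tc N p s)).
Qed.

Definition c2e : c2e_instance :=
  gadget_c2e weights_gt0 wmax_gt0 sum_weights target_le_wmax rest_le_wmax.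
Definition c2c : c2c_instance :=
  gadget_c2c weights_gt0 wmax_gt0 sum_weights target_le_wmax rest_le_wmax.

Lemma items_gt0 : 0 < N * N * tau.
Proof. by rewrite !muln_gt0 tau_gt0 (ltnW N_gt1). Qed.

End Word.

(** The constant [[:: false; true]] closes the list of inflows and announces the first edge. *)
Definition graph_expr : expr (option bool) :=
  cats [:: cst [:: true]; rest_expr; cst [:: true]; target_expr;
    EFor 0 (EFor 2 (cst (flatten (nseq tau (true :: enc_nat 1)))));
    cst [:: false; true]; cst (enc_nat 0); cst (enc_nat 1); wmax_expr;
    EFor 0 (EFor 2 (cats (mkseq edge_expr tau))); cst [:: false]].

(** In [c] and [d] every bit of the configuration is preceded by the mark [true] of [enc_bits]; [c]
    is for the edge between the hubs, [d] for the two edges of an item. *)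
Definition config_expr (c d : seq bool) : expr (option bool) :=
  cats [:: cst c; EFor 0 (EFor 2 (cst (flatten (nseq tau d)))); cst [:: false]].

Lemma eval_graph r x m : r 0 = word x m ->
  eval r graph_expr = str (enc_cgraph (c2e_graph (c2e x m))).
Proof.
move=> r0; rewrite /graph_expr eval_cats !map_cons !flatten_cons.
rewrite (eval_rest r0) (eval_target r0) (eval_edges r0) (eval_wmax r0) eval_for2_const r0.
rewrite !eval_cst flatten_nseq_mul [enc_cgraph _]enc_gadget -nseq_mkseq.
by rewrite -[flatten (map _ [::])]/(str [::]) -!str_cat.
Qed.

Lemma eval_config r x m c d : r 0 = word x m ->
  eval r (config_expr c d) =
  str (c ++ flatten (mkseq (fun _ => d) (size (word x m) * size (word x m) * tau)) ++ [:: false]).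
Proof.
move=> r0; rewrite /config_expr eval_cats !map_cons !flatten_cons eval_for2_const r0 !eval_cst.
by rewrite flatten_nseq_mul -nseq_mkseq -[flatten (map _ [::])]/(str [::]) -!str_cat.
Qed.

Definition c2e_expr : expr (option bool) :=
  cats [:: graph_expr; cst (enc_nat 0); config_expr [:: true; true] [:: true; false; true; true]].

Definition c2c_expr : expr (option bool) :=
  cats [:: graph_expr; config_expr [:: true; true] [:: true; false; true; true];
           config_expr [:: true; false] [:: true; true; true; false]].

Lemma eval_c2e r x m : r 0 = word x m -> eval r c2e_expr = str (enc_c2e (c2e x m)).
Proof.
move=> r0; rewrite /c2e_expr eval_cats !map_cons !flatten_cons (eval_graph r0) (eval_config _ _ r0).
rewrite eval_cst /enc_c2e [enc_config _]enc_gfrom.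
by rewrite -[flatten (map _ [::])]/(str [::]) -!str_cat cats0.
Qed.

Lemma eval_c2c r x m : r 0 = word x m -> eval r c2c_expr = str (enc_c2c (c2c x m)).
Proof.
move=> r0; rewrite /c2c_expr eval_cats !map_cons !flatten_cons (eval_graph r0) !(eval_config _ _ r0).
rewrite /enc_c2c [enc_config (c2c_from _)]enc_gfrom [enc_config (c2c_to _)]enc_gto.
by rewrite -[flatten (map _ [::])]/(str [::]) -!str_cat cats0.
Qed.

End Instance.

Theorem theorem11 :
  NP_hard_on (P := bounded_C2E)
    (fun I : c2e_instance => has_treewidth (c2e_graph I) 2)
  /\
  NP_hard_on (P := bounded_C2C)
    (fun I : c2c_instance => has_treewidth (c2c_graph I) 2).
Proof.
(* The running time of [M] is bounded by [n.+2 ^ d] for inputs of length [n], and this number is the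
   padding of the input word. *)
split=> L [M [[p pP] LE]]; have [d dP] := poly_nat_bound p.
- exists (fun x => c2e M x ((size x).+2 ^ d)); split.
  + apply: (expr_polytime_computable (e := ELet (word_expr d) (c2e_expr M))) => x.
    by rewrite eval_let (@eval_c2e M _ x ((size x).+2 ^ d)) //; apply: eval_word_expr.
  + by move=> x; apply: gadget_treewidth; apply: items_gt0.
  + move=> x; rewrite LE -(@subset_sum_accepts M x ((size x).+2 ^ d)).
      by apply: iff_sym; apply: gadget_c2e_yes.
    by move=> s ps; apply: leq_trans (pP x s ps) (dP _).
- exists (fun x => c2c M x ((size x).+2 ^ d)); split.
  + apply: (expr_polytime_computable (e := ELet (word_expr d) (c2c_expr M))) => x.
    by rewrite eval_let (@eval_c2c M _ x ((size x).+2 ^ d)) //; apply: eval_word_expr.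
  + by move=> x; apply: gadget_treewidth; apply: items_gt0.
  + move=> x; rewrite LE -(@subset_sum_accepts M x ((size x).+2 ^ d)).
      by apply: iff_sym; apply: gadget_c2c_yes.
    by move=> s ps; apply: leq_trans (pP x s ps) (dP _).
Qed.
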